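(* Let $m\ge 2$, $n=m+1$, $s\ge 1$, $0\le t\le s$, and let $x:\mathbf M^m_t\to\mathbb Q^{n}_s$ be a (regular) Blaschke para-umbilical hypersurface. Then $x$ is locally conformally equivalent to a regular hypersurface with constant scalar curvature and constant mean curvature in one of the pseudo-Riemannian space forms $\mathbb R^{n}_s$, $\mathbb S^{n}_s$ or $\mathbb H^{n}_s$ (these being regarded as subsets of $\mathbb Q^n_s$ via the standard conformal embeddings).
   Context: **Ambient spaces.** $\mathbb R^N_s$ is $\mathbb R^N$ with inner product $\langle\xi,\eta\rangle=-\sum_{i=1}^s x_iy_i+\sum_{i=s+1}^N x_iy_i$. The light cone is $C^{n+1}=\{\xi\in\mathbb R^{n+2}_{s+1}:\langle\xi,\xi\rangle=0,\ \xi\ne0\}$ and the conformal space is $\mathbb Q^n_s=C^{n+1}/(\mathbb R\setminus\{0\})\subset\mathbb RP^{n+1}$, with its natural conformal class of pseudo-Riemannian metrics of index $s$ (for a local lift, i.e. a local section $\sigma$ of $C^{n+1}\to\mathbb Q^n_s$, the metric $\langle d\sigma,d\sigma\rangle$ belongs to this class). Every conformal transformation of $\mathbb Q^n_s$ has the form $[X]\mapsto[XT]$ with $T$ in the orthogonal group of $\mathbb R^{n+2}_{s+1}$. Put $\mathbb S^n_s=\{u\in\mathbb R^{n+1}_s:\langle u,u\rangle=1\}$, $\mathbb H^n_s=\{u\in\mathbb R^{n+1}_{s+1}:\langle u,u\rangle=-1\}$. The standard conformal embeddings into $\mathbb Q^n_s$ are $u\mapsto[(1,u)]$ on $\mathbb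 S^n_s$, $u\mapsto[(u,1)]$ on $\mathbb H^n_s$, and $u\mapsto[(\tfrac{\langle u,u\rangle+1}{2},u,\tfrac{\langle u,u\rangle-1}{2})]$ on $\mathbb R^n_s$. **Regular hypersurfaces.** Let $x:\mathbf M^m_t\to\mathbb Q^{m+1}_s$ be an immersed hypersurface whose induced (conformal class of) metric is non-degenerate of index $t$. For a local lift $y:U\to C^{m+2}$ of $x$ let $\Delta$ and $\rho$ be the Laplacian and scalar curvature of $\langle dy,dy\rangle$. The 2-form $g=\pm\big(\langle\Delta y,\Delta y\rangle-\frac{m}{m-1}\rho\big)\langle dy,dy\rangle$ does not depend on the choice of $y$; $x$ is called regular if $g$ is non-degenerate, where the sign $\pm$ is taken so that the factor in front of $\langle dy,dy\rangle$ is positive. $g$ is called the conformal metric. For regular $x$ there is a lift $Y$ (canonical lift, unique up to sign) with $g=\langle dY,dY\rangle$. A hypersurface $u$ of $\mathbb R^n_s$, $\mathbb S^n_s$ or $\mathbb H^n_s$ is called regular if its composition with the corresponding standard conformal embedding is regular. **Conformal invariants.** Let $\{e_i\}_{i=1}^m$ be a local frame of $T\mathbf M$, $Y_i=e_i(Y)$, $g_{ij}=\langle Y_i,Y_j\rangle$, $(g^{ij})=(g_{ij})^{-1}$, $\Delta$ the Laplacian of $g$, and $N=-\frac1m\Delta Y-\frac1{2m^2}\langle\Delta Y,\Delta Y\rangle Y$. Then $\langle N,Y\rangle=1$, $\langle N,N\rangle=0$, $\langle N,Y_i\rangle=0$. Let $\xi$ be a local unit vector field ($\varepsilon=\langle\xi,\xi\rangle=\pm1$)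 orthogonal to $Y,N,Y_1,\dots,Y_m$. Define $A_{ij}=\langle e_j(N),Y_i\rangle$, $B_{ij}=\varepsilon\langle e_j(Y_i),\xi\rangle$, $C_i=\varepsilon\langle e_i(N),\xi\rangle$, the matrices $A=(A^i_j)$, $B=(B^i_j)$ with $A^i_j=\sum_k g^{ik}A_{kj}$, $B^i_j=\sum_k g^{ik}B_{kj}$, and the conformal form $\Phi=\sum_i C_i\,\omega^i\,\xi$, where $\{\omega^i\}$ is the dual coframe. **Blaschke para-umbilical.** A regular hypersurface $x:\mathbf M^m_t\to\mathbb Q^{m+1}_s$ is Blaschke para-umbilical if $\Phi\equiv0$ and there are smooth functions $\lambda,\mu$ on $\mathbf M$ with $A=\lambda I_m+\mu B$, where $I_m$ is the $m\times m$ identity matrix. **Conformal equivalence.** Two submanifolds $x,\tilde x$ of $\mathbb Q^n_s$ are conformally equivalent if there is a conformal transformation $\sigma$ of $\mathbb Q^n_s$ with $\tilde x=\sigma\circ x$ (up to a diffeomorphism of the parameter manifolds); locally conformally equivalent means this holds for the restriction of $x$ to a neighborhood of each point. *)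

(* Defs.v *)
(* Vectors of R^N are rows and matrices act on the right. *)
From HB Require Import structures.
From mathcomp Require Import all_boot all_order all_algebra.
From mathcomp Require Import all_classical all_reals all_analysis.
Set Implicit Arguments.
Unset Strict Implicit.
Unset Printing Implicit Defensive.
Import Order.TTheory GRing.Theory Num.Theory.
Import numFieldNormedType.Exports.
Local Open Scope classical_set_scope.
Local Open Scope ring_scope.

Definition pd (R : realType) (m : nat) (V : normedModType R) (i : 'I_m)
    (F : 'rV[R]_m -> V) (z : 'rV[R]_m) : V :=
  'D_(delta_mx 0 i) F z.

Fixpoint Ck (R : realType) (m : nat) (V : normedModType R) (k : nat)
    (D : set 'rV[R]_m) (F : 'rV[R]_m -> V) : Prop :=
  match k with
  | 0 => forall z, D z -> {for z, continuous F}
  | k'.+1 => (forall z, D z -> differentiable F z) /\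
             (forall i : 'I_m, Ck k' D (pd i F))
  end.

(* only used for open D *)
Definition smooth_on (R : realType) (m : nat) (V : normedModType R)
    (D : set 'rV[R]_m) (F : 'rV[R]_m -> V) : Prop :=
  forall k : nat, Ck k D F.

Record chart (R : realType) (M : topologicalType) (m : nat) := Chart {
  chart_dom : set M;
  chart_map : M -> 'rV[R]_m;
  chart_inv : 'rV[R]_m -> M;
  chart_dom_open : open chart_dom;
  chart_img_open : open (chart_map @` chart_dom);
  chart_mapK : forall p, chart_dom p -> chart_inv (chart_map p) = p;
  chart_map_cont : forall p, chart_dom p -> {for p, continuous chart_map};
  chart_inv_cont :
    forall z, (chart_map @` chart_dom) z -> {for z, continuous chart_inv} }.

Record manifold (R : realType) (m : nat) := Manifold {
  manifold_sort :> topologicalType;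
  manifold_hausdorff : hausdorff_space manifold_sort;
  manifold_second_countable : @second_countable manifold_sort;
  atlas : set (chart R manifold_sort m);
  atlas_cover : forall p, exists2 c, atlas c & chart_dom c p;
  atlas_compat : forall c c', atlas c -> atlas c' ->
    smooth_on (chart_map c @` (chart_dom c `&` chart_dom c'))
              (chart_map c' \o chart_inv c) }.

Definition msmooth (R : realType) (m : nat) (M : manifold R m)
    (V : normedModType R) (U : set M) (f : M -> V) : Prop :=
  forall c, atlas c ->
    smooth_on (chart_map c @` (U `&` chart_dom c)) (f \o chart_inv c).

Definition ip (R : realType) (N s : nat) (u v : 'rV[R]_N) : R :=
  \sum_(i < N) (if (i < s)%N then -1 else 1) * u 0 i * v 0 i.

Definition neg_definite (R : realType) (k : nat) (G : 'M[R]_k) : Prop :=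
  forall v : 'rV[R]_k, v != 0 -> (v *m G *m v^T) 0 0 < 0.

(* Non-degenerate symmetric form whose maximal negative definite subspaces
   (spanned by the rows of W) have dimension t. *)
Definition has_index (R : realType) (m : nat) (G : 'M[R]_m) (t : nat) : Prop :=
  [/\ G \in unitmx,
      exists W : 'M[R]_(t, m), neg_definite (W *m G *m W^T) &
      forall (k : nat) (W : 'M[R]_(k, m)),
        neg_definite (W *m G *m W^T) -> (k <= t)%N].

Definition gram (R : realType) (m N s : nat) (F : 'rV[R]_m -> 'rV[R]_N)
    (z : 'rV[R]_m) : 'M[R]_m :=
  \matrix_(i, j) ip s (pd i F z) (pd j F z).

Section Metric.
Variables (R : realType) (m : nat) (G : 'rV[R]_m -> 'M[R]_m).

Definition gentry (i j : 'I_m) (z : 'rV[R]_m) : R := G z i j.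

(* Gamma^k_ij *)
Definition christoffel (k i j : 'I_m) (z : 'rV[R]_m) : R :=
  2^-1 * \sum_l invmx (G z) k l *
    (pd i (gentry j l) z + pd j (gentry i l) z - pd l (gentry i j) z).

Definition laplacian (N : nat) (F : 'rV[R]_m -> 'rV[R]_N) (z : 'rV[R]_m) :
    'rV[R]_N :=
  \sum_i \sum_j invmx (G z) i j *:
    (pd i (pd j F) z - \sum_k christoffel k i j z *: pd k F z).

(* The component l of R(d_i, d_j) d_k, where
   R(X, Y) = [nabla_X, nabla_Y] - nabla_[X, Y]. *)
Definition riemann (l k i j : 'I_m) (z : 'rV[R]_m) : R :=
  pd i (christoffel l j k) z - pd j (christoffel l i k) z
  + \sum_p (christoffel l i p z * christoffel p j k z
            - christoffel l j p z * christoffel p i k z).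

(* Unnormalized: the unit m-sphere has scalar curvature m (m - 1). *)
Definition scalar_curvature (z : 'rV[R]_m) : R :=
  \sum_j \sum_k invmx (G z) j k * \sum_i riemann i k i j z.

End Metric.

Definition lightcone (R : realType) (N s : nat) : set 'rV[R]_N :=
  [set X | ip s.+1 X X = 0 /\ X != 0].

Definition proj_class (R : realType) (N : nat) (X : 'rV[R]_N) : set 'rV[R]_N :=
  [set a *: X | a in [set a : R | a != 0]].

(* Q^n_s for N = n + 2; a point is represented by its class of nonzero
   multiples. *)
Definition conformal_space (R : realType) (N s : nat) : set (set 'rV[R]_N) :=
  [set proj_class X | X in @lightcone R N s].

Definition orthogonal_mx (R : realType) (N s : nat) (T : 'M[R]_N) : Prop :=
  forall X X' : 'rV[R]_N, ip s (X *m T) (X' *m T) = ip s X X'.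

Definition conf_transf (R : realType) (N : nat) (T : 'M[R]_N)
    (L : set 'rV[R]_N) : set 'rV[R]_N :=
  [set X *m T | X in L].

Section LiftInvariants.
Variables (R : realType) (m N s : nat) (F X : 'rV[R]_m -> 'rV[R]_N).
Implicit Types z : 'rV[R]_m.

Definition lift_gram z : 'M[R]_m := gram s.+1 F z.

Definition lift_laplacian z : 'rV[R]_N := laplacian lift_gram F z.

Definition conf_factor z : R :=
  ip s.+1 (lift_laplacian z) (lift_laplacian z)
  - m%:R / (m%:R - 1) * scalar_curvature lift_gram z.

(* The sign making the factor positive is chosen by the absolute value. *)
Definition conf_metric z : 'M[R]_m := `|conf_factor z| *: lift_gram z.

Definition conf_N z : 'rV[R]_N :=
  - (m%:R^-1 *: lift_laplacian z)
  - ((2 * m%:R ^+ 2)^-1 * ip s.+1 (lift_laplacian z) (lift_laplacian z))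
    *: F z.

(* Here F is a canonical lift, X is the unit normal field xi, and the frame
   is the coordinate frame; the conditions imposed below on A, B and Phi are
   tensorial, hence independent of the frame. *)
Definition is_unit_normal z : Prop :=
  [/\ ip s.+1 (X z) (X z) = 1 \/ ip s.+1 (X z) (X z) = -1,
      ip s.+1 (X z) (F z) = 0,
      ip s.+1 (X z) (conf_N z) = 0 &
      forall i, ip s.+1 (X z) (pd i F z) = 0].

Definition conf_A z : 'M[R]_m :=
  invmx (lift_gram z) *m \matrix_(i, j) ip s.+1 (pd j conf_N z) (pd i F z).

Definition conf_B z : 'M[R]_m :=
  invmx (lift_gram z) *m
  \matrix_(i, j) (ip s.+1 (X z) (X z) * ip s.+1 (pd j (pd i F) z) (X z)).

Definition conf_C (i : 'I_m) z : R :=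
  ip s.+1 (X z) (X z) * ip s.+1 (pd i conf_N z) (X z).

Definition conf_Phi z (v : 'rV[R]_m) : 'rV[R]_N :=
  (\sum_i conf_C i z * v 0 i) *: X z.

End LiftInvariants.

Section Hypersurface.
Variables (R : realType) (m s : nat) (M : manifold R m).
Variable x : M -> set 'rV[R]_m.+3.
Implicit Types (U V : set M).

Definition local_lift V (y : M -> 'rV[R]_m.+3) : Prop :=
  [/\ open V, msmooth V y &
      forall p, V p -> @lightcone R m.+3 s (y p) /\ x p = proj_class (y p)].

(* Around each point of U there is a local lift whose coordinate expressions
   satisfy P. It is used with properties P that do not depend on the choice
   of the lift. Since C^(n+1) -> Q^n_s is a submersion with local sections,
   the existence of such lifts also expresses the smoothness of x on U. *)
Definition locally_lifts U
    (P : ('rV[R]_m -> 'rV[R]_m.+3) -> 'rV[R]_m -> Prop) : Prop :=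
  forall p, U p -> exists V y,
    [/\ V p, V `<=` U, local_lift V y &
        forall c q, atlas c -> V q -> chart_dom c q ->
          P (y \o chart_inv c) (chart_map c q)].

(* The kernel of the differential of C^(n+1) -> Q^n_s at F z is the line
   spanned by F z: x is an immersion when no nonzero tangent vector is
   mapped by dF into that line. *)
Definition lift_immersive (F : 'rV[R]_m -> 'rV[R]_m.+3) (z : 'rV[R]_m) : Prop :=
  forall (v : 'rV[R]_m) (a : R),
    \sum_i v 0 i *: pd i F z = a *: F z -> v = 0.

Definition immersed_hypersurface (t : nat) U : Prop :=
  (forall p, U p -> @conformal_space R m.+3 s (x p)) /\
  locally_lifts U
    (fun F z => lift_immersive F z /\ has_index (lift_gram s F z) t).

Definition regular_hypersurface (t : nat) U : Prop :=
  immersed_hypersurface t U /\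
  locally_lifts U (fun F z => conf_metric s F z \in unitmx).

Definition canonical_lift V (Y : M -> 'rV[R]_m.+3) : Prop :=
  local_lift V Y /\
  forall c q, atlas c -> V q -> chart_dom c q ->
    conf_metric s (Y \o chart_inv c) (chart_map c q)
    = lift_gram s (Y \o chart_inv c) (chart_map c q).

(* Y and xi are only determined up to sign, and B changes sign with either of
   them; hence the equations are required for suitable local choices. *)
Definition blaschke_para_umbilical : Prop :=
  exists lambda mu : M -> R,
    [/\ msmooth setT lambda, msmooth setT mu &
        forall p, exists V Y xi,
          [/\ V p, canonical_lift V Y, msmooth V xi &
              forall c q, atlas c -> V q -> chart_dom c q ->
                let F := Y \o chart_inv c in
                let X := xi \o chart_inv c in
                let z := chart_map c q in
                [/\ is_unit_normal s F X z,
                    forall v, conf_Phi s F X z v = 0 &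
                    conf_A s F z = (lambda q)%:M + mu q *: conf_B s F X z]]].

End Hypersurface.

(* A space form inside R^dim_index, together with a lift of its standard
   conformal embedding into the conformal space. *)
Record space_form (R : realType) (m : nat) := SpaceForm {
  sf_dim : nat;
  sf_index : nat;
  sf_carrier : set 'rV[R]_sf_dim;
  sf_tangent : 'rV[R]_sf_dim -> set 'rV[R]_sf_dim;
  sf_embed : 'rV[R]_sf_dim -> 'rV[R]_m.+3 }.

Definition row_cons (R : realType) (N : nat) (a : R) (u : 'rV[R]_N) :
    'rV[R]_N.+1 :=
  \row_i (if unlift ord0 i is Some j then u 0 j else a).

Definition row_rcons (R : realType) (N : nat) (u : 'rV[R]_N) (a : R) :
    'rV[R]_N.+1 :=
  \row_i (if unlift ord_max i is Some j then u 0 j else a).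

Definition flat_form (R : realType) (m s : nat) : space_form R m :=
  @SpaceForm R m m.+1 s setT (fun=> setT)
    (fun u => row_cons ((ip s u u + 1) / 2)
                       (row_rcons u ((ip s u u - 1) / 2))).

Definition sphere_form (R : realType) (m s : nat) : space_form R m :=
  @SpaceForm R m m.+2 s [set u | ip s u u = 1]
    (fun u => [set v | ip s u v = 0]) (fun u => row_cons 1 u).

Definition hyperbolic_form (R : realType) (m s : nat) : space_form R m :=
  @SpaceForm R m m.+2 s.+1 [set u | ip s.+1 u u = -1]
    (fun u => [set v | ip s.+1 u v = 0]) (fun u => row_rcons u 1).

Section SpaceFormHypersurface.
Variables (R : realType) (m s : nat) (M : manifold R m) (S : space_form R m).
Variables (U : set M) (u : M -> 'rV[R]_(sf_dim S)).

Definition sf_hypersurface_in_Q (p : M) : set 'rV[R]_m.+3 :=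
  proj_class (sf_embed (u p)).

Definition sf_regular (t : nat) : Prop :=
  [/\ forall p, U p -> sf_carrier (u p), msmooth U u &
      regular_hypersurface s sf_hypersurface_in_Q t U].

Definition sf_gram (c : chart R M m) : 'rV[R]_m -> 'M[R]_m :=
  gram (sf_index S) (u \o chart_inv c).

Definition constant_scalar_curvature : Prop :=
  exists rho : R, forall c q, atlas c -> U q -> chart_dom c q ->
    scalar_curvature (sf_gram c) (chart_map c q) = rho.

Definition sf_unit_normal (eta : M -> 'rV[R]_(sf_dim S)) : Prop :=
  msmooth U eta /\
  forall c q, atlas c -> U q -> chart_dom c q ->
    [/\ sf_tangent (u q) (eta q),
        ip (sf_index S) (eta q) (eta q) = 1 \/
          ip (sf_index S) (eta q) (eta q) = -1 &
        forall i,
          ip (sf_index S) (eta q) (pd i (u \o chart_inv c) (chart_map c q)) = 0].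

(* The mean curvature vector is H *: eta; as eta is tangent to the space form,
   second derivatives may be taken in the ambient pseudo-Euclidean space. *)
Definition mean_curvature (eta : M -> 'rV[R]_(sf_dim S)) (c : chart R M m)
    (q : M) : R :=
  m%:R^-1 * ip (sf_index S) (eta q) (eta q) *
  \sum_i \sum_j invmx (sf_gram c (chart_map c q)) i j *
    ip (sf_index S) (pd i (pd j (u \o chart_inv c)) (chart_map c q)) (eta q).

Definition constant_mean_curvature : Prop :=
  exists eta, sf_unit_normal eta /\
  exists H : R, forall c q, atlas c -> U q -> chart_dom c q ->
    mean_curvature eta c q = H.

End SpaceFormHypersurface.

(* The parameter manifold of the second hypersurface has been identified with
   the open set U by means of the diffeomorphism. *)
Definition conf_equivalent_on (R : realType) (m s : nat) (M : manifold R m)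
    (U : set M) (x x' : M -> set 'rV[R]_m.+3) : Prop :=
  exists2 T : 'M[R]_m.+3, orthogonal_mx s.+1 T &
    forall p, U p -> x' p = conf_transf T (x p).

Definition equivalent_to_csc_cmc (R : realType) (m s t : nat)
    (M : manifold R m) (U : set M) (x : M -> set 'rV[R]_m.+3)
    (S : space_form R m) : Prop :=
  exists u : M -> 'rV[R]_(sf_dim S),
    [/\ sf_regular s U u t,
        constant_scalar_curvature U u,
        constant_mean_curvature U u &
        conf_equivalent_on s U x (sf_hypersurface_in_Q u)].

(* Main.v *)
(* Let N be the second null normal of the canonical lift Y, xi the unit normal and
   e = <xi, xi>. Since the conformal form vanishes, A = lambda I + mu B says that
   dN = lambda dY - e mu dxi. The point is that lambda and mu are constant: then
   c = N + e mu xi - lambda Y is a constant vector with <c, Y> = 1, and an orthogonal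
   map sending c to a standard null, negative or positive vector places Y, up to a
   constant factor, in R^n_s, S^n_s or H^n_s; there the metric is a constant multiple
   of the conformal metric and the normal is a multiple of xi - mu Y.

   Constancy. Exactness of dN gives dlambda /\ I + dmu /\ B = 0, tr B = 0, and the
   normalization of the conformal metric together with the contracted Gauss equation
   gives tr B^2 = +-(m-1)/m. Where dmu <> 0 these force (B + d I)^2 = kappa I with d and
   kappa <> 0 constant (for m > 2, B is scalar plus rank one; for m = 2 use Cayley-
   Hamilton with d = 0). As B is a Codazzi tensor, its covariant derivative is totally
   symmetric and anticommutes with B + d I, so B is parallel and commutes with the
   curvature. By the Gauss equation 2 (lambda - e mu d) is then constant, which together
   with the first relation gives dmu = 0, and finally dlambda = 0. *)

(* The metric is indefinite, so the operator g^-1 h (h the second fundamental form along xi) need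
   not be diagonalizable, and for m = 2 the constant kappa may be negative.

   Origin of d: for m > 2 the characteristic roots of g^-1 h are b, with multiplicity m - 1, and (1
   - m) b. The shift d = (m - 2) b / 2 is minus their midpoint, so the roots of g^-1 h + d I are
   opposite and its square is scalar. Since tr (g^-1 h)^2 = m (m - 1) b^2 is a nonzero constant, b
   is constant too. For m = 2 the shift is 0 and b may vary.

   Why parallelism helps: a symmetric k with constant nonzero square that is parallel commutes with
   the curvature. Substituting the Gauss equation and contracting gives a scalar times the
   trace-free part of g^-1 k, which is g^-1 h and hence nonzero. The scalar must vanish, and this is
   the equation for lambda - e mu d.

   All these identities are differentiated, so the contradiction is derived on the open set where
   one partial derivative of mu does not vanish. *)
Require Import Defs.
From HB Require Import structures.
From mathcomp Require Import all_boot all_order all_algebra perm.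
From mathcomp Require Import all_classical all_reals all_analysis.
From mathcomp Require Import ring lra.
Set Implicit Arguments.
Unset Strict Implicit.
Unset Printing Implicit Defensive.
Import Order.TTheory GRing.Theory Num.Theory.
Import numFieldNormedType.Exports.
Local Open Scope classical_set_scope.
Local Open Scope ring_scope.

(** * Smooth functions on open sets *)

Lemma near_eq_differentiable (R : numFieldType) (V W : normedModType R)
    (f g : V -> W) (x : V) :
  {near x, f =1 g} -> differentiable f x -> differentiable g x.
Proof.
move=> fg df; have [dfc dfx] := (diff_locallyP x f).1 df.
have key : g \o shift x = cst (g x) + 'd f x +o_ 0 id.
  apply/eqaddoP => _/posnumP[eps].
  have /eqaddoP/(_ _ (gt0 eps)) := dfx.
  have fg0 : \forall y \near (0 : V), f (y + x) = g (y + x).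
    have : \forall y \near x, [set y | f y = g y] y := fg.
    by rewrite (near_shift 0) subr0.
  apply: filterS2 fg0 => y /= fgy.
  by rewrite /cst !fctE /= fgy (nbhs_singleton fg).
apply/diff_locallyP; rewrite (diff_unique dfc key); split => //.
Qed.

Section Smooth.
Variables (R : realType) (m : nat).
Implicit Types (V W : normedModType R) (D : set 'rV[R]_m).

Lemma pd_near V (F G : 'rV[R]_m -> V) i z :
  (\forall y \near z, F y = G y) -> pd i F z = pd i G z.
Proof. exact: near_eq_derive. Qed.

Lemma open_near D (z : 'rV[R]_m) : open D -> D z -> \forall y \near z, D y.
Proof. by move=> oD Dz; apply: open_nbhs_nbhs. Qed.

Lemma pd_on D V (F G : 'rV[R]_m -> V) i z : open D -> D z ->
  (forall y, D y -> F y = G y) -> pd i F z = pd i G z.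
Proof.
move=> oD Dz FG; apply: pd_near.
by apply: filterS (open_near oD Dz).
Qed.

Lemma differentiable_on D V (F G : 'rV[R]_m -> V) z : open D -> D z ->
  (forall y, D y -> F y = G y) -> differentiable F z -> differentiable G z.
Proof.
move=> oD Dz FG; apply: near_eq_differentiable.
by apply: filterS (open_near oD Dz).
Qed.

Lemma Ck_on D V k (F G : 'rV[R]_m -> V) : open D ->
  (forall z, D z -> F z = G z) -> Ck k D F -> Ck k D G.
Proof.
move=> oD; elim: k F G => [|k IH] F G FG /=.
  move=> cF z Dz; have := cF z Dz; rewrite /prop_for /continuous_at -(FG z Dz).
  have nFG : {near z, F =1 G} by apply: filterS FG (open_near oD Dz).
  exact: cvg_trans (near_eq_cvg nFG).
move=> [dF cF]; split=> [z Dz|i].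
  exact: differentiable_on oD Dz FG (dF z Dz).
by apply: IH (cF i) => z Dz; apply: pd_on oD Dz FG.
Qed.

Lemma smooth_onE D V (F : 'rV[R]_m -> V) :
  smooth_on D F <->
  (forall z, D z -> differentiable F z) /\ (forall i, smooth_on D (pd i F)).
Proof.
split=> [sF|[dF sF]].
  by split=> [|i k]; [by case: (sF 1%N)|by case: (sF k.+1) => _; apply].
case=> [|k] /=; last by split=> // i; apply: sF.
by move=> z /dF; apply: differentiable_continuous.
Qed.

Lemma smooth_diff D V (F : 'rV[R]_m -> V) z :
  smooth_on D F -> D z -> differentiable F z.
Proof. by move=> /smooth_onE[dF _] /dF. Qed.

Lemma smooth_pd D V (F : 'rV[R]_m -> V) i :
  smooth_on D F -> smooth_on D (pd i F).
Proof. by move=> /smooth_onE[_]. Qed.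

Lemma smooth_eq D V (F G : 'rV[R]_m -> V) : open D ->
  (forall z, D z -> F z = G z) -> smooth_on D F -> smooth_on D G.
Proof. by move=> oD FG sF k; apply: Ck_on FG (sF k). Qed.

Lemma smooth_sub D D' V (F : 'rV[R]_m -> V) :
  D' `<=` D -> smooth_on D F -> smooth_on D' F.
Proof.
move=> DD' sF k; elim: k F {sF}(sF k) => [|k IH] F /= => [cF z /DD'/cF //|].
by move=> [dF cF]; split=> [z /DD'/dF //|i]; apply: IH.
Qed.

Lemma derivable_pd V (F : 'rV[R]_m -> V) z v :
  differentiable F z -> derivable F z v.
Proof. exact: diff_derivable. Qed.

Lemma pd_cst V (a : V) (i : 'I_m) (z : 'rV[R]_m) : pd i (fun=> a) z = 0 :> V.
Proof. exact: derive_cst. Qed.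

Lemma pdD V (F G : 'rV[R]_m -> V) i z :
  differentiable F z -> differentiable G z ->
  pd i (fun y => F y + G y) z = pd i F z + pd i G z.
Proof. by move=> dF dG; apply: deriveD; apply: derivable_pd. Qed.

Lemma pdN V (F : 'rV[R]_m -> V) i z :
  differentiable F z -> pd i (fun y => - F y) z = - pd i F z.
Proof. by move=> dF; apply: deriveN; apply: derivable_pd. Qed.

Lemma pdB V (F G : 'rV[R]_m -> V) i z :
  differentiable F z -> differentiable G z ->
  pd i (fun y => F y - G y) z = pd i F z - pd i G z.
Proof. by move=> dF dG; apply: deriveB; apply: derivable_pd. Qed.

Lemma pdM (f g : 'rV[R]_m -> R) i z :
  differentiable f z -> differentiable g z ->
  pd i (fun y => f y * g y) z = pd i f z * g z + f z * pd i g z.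
Proof.
move=> df dg; rewrite /pd.
have := @deriveM _ _ f g z (delta_mx 0 i) (derivable_pd df) (derivable_pd dg).
by move=> ->; rewrite addrC [in LHS]/GRing.scale /= [g z * _]mulrC.
Qed.

Lemma pdV (f : 'rV[R]_m -> R) i z : f z != 0 ->
  differentiable f z -> pd i (fun y => (f y)^-1) z = - (f z ^- 2) * pd i f z.
Proof. by move=> nz df; apply: deriveV => //; apply: derivable_pd. Qed.

Lemma smooth_cst D V (a : V) : smooth_on D (fun=> a).
Proof.
move=> k; elim: k a => [|k IH] a /=.
  by move=> z _; apply: cst_continuous.
split=> [z _|i]; first exact: differentiable_cst.
have -> : pd i (fun=> a) = fun=> 0 by apply/funext => z; apply: pd_cst.
exact: IH.
Qed.

Lemma smoothD D V (F G : 'rV[R]_m -> V) : open D ->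
  smooth_on D F -> smooth_on D G -> smooth_on D (fun y => F y + G y).
Proof.
move=> oD sF sG k.
have dFG F' G' z : smooth_on D F' -> smooth_on D G' -> D z ->
    differentiable (fun y => F' y + G' y : V) z.
  move=> sF' sG' Dz.
  by apply: differentiableD; [apply: smooth_diff sF' Dz|apply: smooth_diff sG' Dz].
elim: k F G sF sG => [|k IH] F G sF sG /=.
  by move=> z Dz; apply: differentiable_continuous; apply: dFG.
split=> [z Dz|i]; first exact: dFG.
apply: (Ck_on oD _ (IH _ _ (smooth_pd i sF) (smooth_pd i sG))) => z Dz.
by rewrite pdD //; [apply: smooth_diff sF Dz|apply: smooth_diff sG Dz].
Qed.

Lemma smoothN D V (F : 'rV[R]_m -> V) : open D ->
  smooth_on D F -> smooth_on D (fun y => - F y).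
Proof.
move=> oD sF k.
have dF' F' z : smooth_on D F' -> D z -> differentiable (fun y => - F' y : V) z.
  by move=> sF' Dz; apply: differentiableN; apply: smooth_diff sF' Dz.
elim: k F sF => [|k IH] F sF /=.
  by move=> z Dz; apply: differentiable_continuous; apply: dF'.
split=> [z Dz|i]; first exact: dF'.
apply: (Ck_on oD _ (IH _ (smooth_pd i sF))) => z Dz.
by rewrite pdN //; apply: smooth_diff sF Dz.
Qed.

Lemma smoothB D V (F G : 'rV[R]_m -> V) : open D ->
  smooth_on D F -> smooth_on D G -> smooth_on D (fun y => F y - G y).
Proof. by move=> oD sF sG; apply: smoothD => //; apply: smoothN. Qed.

(** The finite-order form is needed for products: in the induction of [Ck_M] the terms of the
    product rule are only known to be of class [Ck k]. *)
Lemma Ck_D D V k (F G : 'rV[R]_m -> V) : open D ->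
  Ck k D F -> Ck k D G -> Ck k D (fun y => F y + G y).
Proof.
move=> oD; elim: k F G => [|k IH] F G /=.
  by move=> cF cG z Dz; apply: continuousD; [apply: cF|apply: cG].
move=> [dF cF] [dG cG]; split=> [z Dz|i].
  by apply: differentiableD; [apply: dF|apply: dG].
apply: (Ck_on oD _ (IH _ _ (cF i) (cG i))) => z Dz.
by rewrite pdD //; [apply: dF|apply: dG].
Qed.

Lemma Ck_pred D V k (F : 'rV[R]_m -> V) : Ck k.+1 D F -> Ck k D F.
Proof.
elim: k F => [|k IH] F [dF cF]; last by split=> // i; apply: IH.
by move=> z /dF; apply: differentiable_continuous.
Qed.

Lemma Ck_M D k (f g : 'rV[R]_m -> R) : open D ->
  Ck k D f -> Ck k D g -> Ck k D (fun y => f y * g y).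
Proof.
move=> oD; elim: k f g => [|k IH] f g.
  by move=> cf cg z Dz; apply: continuousM; [apply: cf|apply: cg].
move=> cf cg; have [df pf] := cf; have [dg pg] := cg; split=> [z Dz|i].
  by apply: (@differentiableM _ _ f g); [apply: df|apply: dg].
apply: (Ck_on oD _ (Ck_D oD (IH _ _ (pf i) (Ck_pred cg))
                            (IH _ _ (Ck_pred cf) (pg i)))) => z Dz.
by rewrite pdM //; [apply: df|apply: dg].
Qed.

Lemma smoothM D (f g : 'rV[R]_m -> R) : open D ->
  smooth_on D f -> smooth_on D g -> smooth_on D (fun y => f y * g y).
Proof. by move=> oD sf sg k; apply: Ck_M. Qed.

Lemma smoothV D (f : 'rV[R]_m -> R) : open D ->
  (forall z, D z -> f z != 0) ->
  smooth_on D f -> smooth_on D (fun y => (f y)^-1).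
Proof.
move=> oD nz sf k.
have df z : D z -> differentiable (fun y => (f y)^-1 : R) z.
  by move=> Dz; apply: differentiableV; [apply: smooth_diff sf Dz|apply: nz].
elim: k => [|k IH] /=.
  by move=> z Dz; apply: differentiable_continuous; apply: df.
split=> // i.
(* The derivative of 1/f is -(1/f)^2 times that of f, so class k of 1/f gives class k + 1. *)
have c1 := Ck_M oD (Ck_M oD IH IH) (smoothN oD (smooth_pd i sf) k).
apply: (Ck_on oD _ c1) => z Dz /=.
rewrite pdV; [by rewrite expr2 invfM mulNr mulrN|exact: nz|].
exact: smooth_diff sf Dz.
Qed.

Lemma smooth_sum D V (I : Type) (r : seq I) (P : pred I)
    (F : I -> 'rV[R]_m -> V) : open D ->
  (forall i, P i -> smooth_on D (F i)) ->
  smooth_on D (fun z => \sum_(i <- r | P i) F i z).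
Proof.
move=> oD sF; elim: r => [|a r IH].
  have -> : (fun z => \sum_(i <- [::] | P i) F i z) = fun=> 0.
    by apply/funext => z; rewrite big_nil.
  exact: smooth_cst.
have -> : (fun z => \sum_(i <- a :: r | P i) F i z) =
    fun z => (if P a then F a z + \sum_(i <- r | P i) F i z
              else \sum_(i <- r | P i) F i z).
  by apply/funext => z; rewrite big_cons.
by case Pa: (P a) => //; apply: smoothD => //; apply: sF.
Qed.

Lemma smooth_prod D (I : Type) (r : seq I) (P : pred I)
    (F : I -> 'rV[R]_m -> R) : open D ->
  (forall i, P i -> smooth_on D (F i)) ->
  smooth_on D (fun z => \prod_(i <- r | P i) F i z).
Proof.
move=> oD sF; elim: r => [|a r IH].
  have -> : (fun z => \prod_(i <- [::] | P i) F i z) = fun=> 1.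
    by apply/funext => z; rewrite big_nil.
  exact: smooth_cst.
have -> : (fun z => \prod_(i <- a :: r | P i) F i z) =
    fun z => (if P a then F a z * \prod_(i <- r | P i) F i z
              else \prod_(i <- r | P i) F i z).
  by apply/funext => z; rewrite big_cons.
by case Pa: (P a) => //; apply: smoothM => //; apply: sF.
Qed.

Lemma pd_sum V (I : Type) (r : seq I) (F : I -> 'rV[R]_m -> V) i z :
  (forall k, differentiable (F k) z) ->
  pd i (fun y => \sum_(k <- r) F k y) z = \sum_(k <- r) pd i (F k) z.
Proof.
move=> dF; suff [] : differentiable (fun y => \sum_(k <- r) F k y) z /\
  pd i (fun y => \sum_(k <- r) F k y) z = \sum_(k <- r) pd i (F k) z by [].
elim: r => [|a r [IH1 IH2]].
  have -> : (fun y => \sum_(k <- [::]) F k y) = fun=> 0.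
    by apply/funext => y; rewrite big_nil.
  by rewrite big_nil pd_cst; split=> //; apply: differentiable_cst.
have -> : (fun y => \sum_(k <- a :: r) F k y) =
    fun y => F a y + \sum_(k <- r) F k y.
  by apply/funext => y; rewrite big_cons.
by rewrite big_cons pdD // IH2; split=> //; apply: differentiableD.
Qed.

Lemma diff_coord n (F : 'rV[R]_m -> 'rV[R]_n) k z :
  differentiable F z -> differentiable (fun y => F y 0 k) z.
Proof.
move=> dF.
by apply: (@differentiable_comp _ _ _ _ F (fun N : 'rV[R]_n => N 0 k) z dF);
  apply: differentiable_coord.
Qed.

Lemma pd_coord n (F : 'rV[R]_m -> 'rV[R]_n) i k z :
  differentiable F z -> pd i (fun y => F y 0 k) z = pd i F z 0 k.
Proof.
move=> dF; rewrite /pd derive_mx; last exact: derivable_pd.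
by rewrite mxE.
Qed.

Lemma smooth_coord D n (F : 'rV[R]_m -> 'rV[R]_n) k :
  open D -> smooth_on D F -> smooth_on D (fun y => F y 0 k).
Proof.
move=> oD sF j; elim: j F sF => [|j IH] F sF /=.
  move=> z Dz; apply: differentiable_continuous.
  by apply: diff_coord; apply: smooth_diff sF Dz.
split=> [z Dz|i]; first by apply: diff_coord; apply: smooth_diff sF Dz.
apply: (Ck_on oD _ (IH _ (smooth_pd i sF))) => z Dz.
by rewrite pd_coord //; apply: smooth_diff sF Dz.
Qed.

Lemma pdZl V (f : 'rV[R]_m -> R) (v : V) i z : differentiable f z ->
  pd i (fun y => f y *: v) z = pd i f z *: v.
Proof.
by move=> df; rewrite /pd !deriveE ?diffZl //; apply: differentiableZl.
Qed.

Lemma smoothZl D V (f : 'rV[R]_m -> R) (v : V) :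
  open D -> smooth_on D f -> smooth_on D (fun y => f y *: v).
Proof.
move=> oD sf k; elim: k f sf => [|k IH] f sf /=.
  move=> z Dz; apply: differentiable_continuous.
  by apply: differentiableZl; apply: smooth_diff sf Dz.
split=> [z Dz|i]; first by apply: differentiableZl; apply: smooth_diff sf Dz.
apply: (Ck_on oD _ (IH _ (smooth_pd i sf))) => z Dz.
by rewrite pdZl //; apply: smooth_diff sf Dz.
Qed.

Lemma smooth_row D n (F : 'rV[R]_m -> 'rV[R]_n) :
  open D -> (forall k, smooth_on D (fun y => F y 0 k)) -> smooth_on D F.
Proof.
move=> oD sF.
have -> : F = fun y => \sum_k F y 0 k *: delta_mx 0 k.
  by apply/funext => y; rewrite -row_sum_delta.
by apply: smooth_sum => // k _; apply: smoothZl.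
Qed.

Lemma smooth_mulmx D n n' (F : 'rV[R]_m -> 'rV[R]_n) (P : 'M[R]_(n, n')) :
  open D -> smooth_on D F -> smooth_on D (fun y => F y *m P).
Proof.
move=> oD sF; apply: smooth_row => // k.
have -> : (fun y => (F y *m P) 0 k) = fun y => \sum_j F y 0 j * P j k.
  by apply/funext => y; rewrite mxE.
apply: smooth_sum => // j _; apply: smoothM => //; first exact: smooth_coord.
exact: smooth_cst.
Qed.

Lemma smoothZ D n (f : 'rV[R]_m -> R) (F : 'rV[R]_m -> 'rV[R]_n) :
  open D -> smooth_on D f -> smooth_on D F -> smooth_on D (fun y => f y *: F y).
Proof.
move=> oD sf sF; apply: smooth_row => // k.
have -> : (fun y => (f y *: F y) 0 k) = fun y => f y * F y 0 k.
  by apply/funext => y; rewrite mxE.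
by apply: smoothM => //; apply: smooth_coord.
Qed.

End Smooth.

(** * Mean value theorem and symmetry of second derivatives *)

Section Lines.
Variables (R : realType) (m : nat).
Implicit Types (D : set 'rV[R]_m).

Lemma is_derive_line (f : 'rV[R]_m -> R) (w v : 'rV[R]_m) (s : R) :
  differentiable f (w + s *: v) ->
  is_derive s 1 (fun t => f (w + t *: v)) ('D_v f (w + s *: v)).
Proof.
move=> df.
have dl : is_diff s (fun t : R => w + t *: v) ( *:%R ^~ v).
  have h1 : is_diff s (cst w : R -> 'rV[R]_m) 0 by apply: is_diff_cst.
  have h2 : is_diff s ( *:%R ^~ v : R -> 'rV[R]_m) ( *:%R ^~ v).
    by apply: is_diff_scalel.
  by move: (is_diffD h1 h2); rewrite add0r.
have df' := differentiableP df.
have dc := @is_diff_comp _ _ _ _ _ _ f _ s dl df'.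
have dd : differentiable (fun t : R => f (w + t *: v)) s by case: dc.
apply: DeriveDef; first exact: diff_derivable.
rewrite deriveE // [in RHS]deriveE //.
have -> : 'd (fun t => f (w + t *: v)) s = ('d f (w + s *: v) \o *:%R ^~ v) :> (R -> R).
  by case: dc.
by rewrite /= scale1r.
Qed.

Lemma MVT_line (f : 'rV[R]_m -> R) (w v : 'rV[R]_m) (h : R) : 0 < h ->
  (forall s, 0 <= s <= h -> differentiable f (w + s *: v)) ->
  exists2 s, 0 <= s <= h & f (w + h *: v) - f w = 'D_v f (w + s *: v) * h.
Proof.
move=> h0 df.
have dd s : 0 <= s <= h ->
    is_derive s 1 (fun t => f (w + t *: v)) ('D_v f (w + s *: v)).
  by move=> hs; apply: is_derive_line; apply: df.
have [||s] := @MVT R (fun t => f (w + t *: v)) (fun s => 'D_v f (w + s *: v)) 0 h h0.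
- by move=> x /andP[x0 xh]; apply: dd; rewrite !bnd_simp in x0 xh; rewrite !ltW.
- apply: derivable_within_continuous => x; rewrite in_itv /= => hx.
  by case: (dd x hx).
rewrite in_itv /= subr0 scale0r addr0 => /andP[s0 sh] ->.
by exists s => //; rewrite !ltW.
Qed.

(** The second difference is the increment in direction i of y |-> f (y + h v) - f y. The mean value
    theorem is applied to this function, and then to [pd i f] in direction j. *)
Lemma mixed_difference D (f : 'rV[R]_m -> R) (z : 'rV[R]_m) i j (h : R) :
  smooth_on D f -> 0 < h ->
  (forall s t : R, 0 <= s <= h -> 0 <= t <= h ->
     D (z + s *: delta_mx 0 i + t *: delta_mx 0 j)) ->
  exists s t, [/\ 0 <= s <= h, 0 <= t <= h &
    f (z + h *: delta_mx 0 i + h *: delta_mx 0 j) - f (z + h *: delta_mx 0 i)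
    - f (z + h *: delta_mx 0 j) + f z =
    pd j (pd i f) (z + s *: delta_mx 0 i + t *: delta_mx 0 j) * h ^+ 2].
Proof.
move=> sf h0 hD; set u := delta_mx 0 i; set v := delta_mx 0 j.
have h0h : 0 <= h <= h by rewrite (ltW h0) lexx.
have z0h : 0 <= (0 : R) <= h by rewrite lexx (ltW h0).
pose F (y : 'rV[R]_m) : R := f (y + h *: v) - f y.
have dsh (y : 'rV[R]_m) : D (y + h *: v) -> is_diff y (fun y => f (y + h *: v)) ('d f (y + h *: v)).
  move=> Dy; have dl : is_diff y (fun y : 'rV[R]_m => y + h *: v) id.
    have h1 : is_diff y (cst (h *: v) : 'rV[R]_m -> 'rV[R]_m) 0.
      by apply: is_diff_cst.
    have h2 : is_diff y (id : 'rV[R]_m -> 'rV[R]_m) id by apply: is_diff_id.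
    by move: (is_diffD h2 h1); rewrite addr0.
  have df' := differentiableP (smooth_diff sf Dy).
  exact: (@is_diff_comp _ _ _ _ _ _ f _ y dl df').
have dF (s : R) : 0 <= s <= h -> is_diff (z + s *: u) F
    
    (('d f (z + s *: u + h *: v) : 'rV[R]_m -> R) - ('d f (z + s *: u) : 'rV[R]_m -> R)).
  move=> hs; apply: is_diffB; first by apply: dsh; apply: hD.
  apply: differentiableP; apply: smooth_diff sf _.
  by have := hD s 0 hs z0h; rewrite scale0r addr0.
have [s hs Es] := @MVT_line F z u h h0 (fun s hs => let: DiffDef a _ := dF s hs in a).
have DF : 'D_u F (z + s *: u) = pd i f (z + s *: u + h *: v) - pd i f (z + s *: u).
  have D1 : D (z + s *: u) by have := hD s 0 hs z0h; rewrite scale0r addr0.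
  rewrite deriveE; last by case: (dF s hs).
  have -> : 'd F (z + s *: u) = 
    (('d f (z + s *: u + h *: v) : 'rV[R]_m -> R) - ('d f (z + s *: u) : 'rV[R]_m -> R)) :> (_ -> _).
    by case: (dF s hs).
  by rewrite /pd (deriveE _ (smooth_diff sf D1)) (deriveE _ (smooth_diff sf (hD s h hs h0h))).
have [t ht Et] : exists2 t, 0 <= t <= h &
    pd i f (z + s *: u + h *: v) - pd i f (z + s *: u) =
    'D_v (pd i f) (z + s *: u + t *: v) * h.
  apply: MVT_line h0 _ => t ht.
  by apply: smooth_diff (smooth_pd i sf) _; apply: hD.
exists s, t; split => //.
rewrite expr2 mulrA -[pd j _ _]/('D_v (pd i f) _) -Et -DF -Es /F.
by rewrite -!addrA; congr (_ + _); congr (_ + _); rewrite opprB addrC.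
Qed.

Lemma norm_delta (i : 'I_m) : `|delta_mx 0 i : 'rV[R]_m| <= 1.
Proof.
rewrite [leLHS]/Num.Def.normr /= mx_normrE bigmax_le // => -[k l] _.
by rewrite mxE; case: (_ && _); rewrite ?normr1 ?normr0 // ler01.
Qed.

(** The same second difference equals h^2 times either mixed derivative at some nearby point. If the
    two differed by e > 0 at z, continuity would keep each within e / 2 of its value at z, a
    contradiction. *)
Lemma schwarz D (f : 'rV[R]_m -> R) i j z : open D -> smooth_on D f -> D z ->
  pd i (pd j f) z = pd j (pd i f) z.
Proof.
move=> oD sf Dz; apply/eqP/negPn/negP => ne.
set e := `|pd i (pd j f) z - pd j (pd i f) z|.
have e0 : 0 < e / 2 by rewrite divr_gt0 // normr_gt0 subr_eq0.
have c1 := differentiable_continuous (smooth_diff (smooth_pd i (smooth_pd j sf)) Dz).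
have c2 := differentiable_continuous (smooth_diff (smooth_pd j (smooth_pd i sf)) Dz).
have /cvgrPdist_lt/(_ _ e0) n1 := c1; have /cvgrPdist_lt/(_ _ e0) n2 := c2.
have /nbhs_ballP[r /= r0 hr] : \forall y \near z,
  [/\ D y, `|pd i (pd j f) z - pd i (pd j f) y| < e / 2 &
   `|pd j (pd i f) z - pd j (pd i f) y| < e / 2].
  have n3 := open_near oD Dz.
  apply: (@filterS3 _ (nbhs z) _ _ _ _ _ _ n3 n1 n2).
  move=> y h1 h2 h3.
  constructor.
  exact: h1.
  exact: h2.
  exact: h3.
(* Two displacements of norm at most h stay within r / 2 of z, so the whole square lies in the
   ball. *)
pose h := r / 4.
have h0 : 0 < h by rewrite divr_gt0.
have inb k l s t : 0 <= s <= h -> 0 <= t <= h ->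
    ball z r (z + s *: delta_mx 0 k + t *: delta_mx 0 l).
  move=> /andP[s0 sh] /andP[t0 th]; rewrite -ball_normE /=.
  rewrite -addrA opprD addrA subrr sub0r normrN.
  rewrite (le_lt_trans (ler_normD _ _)) // !normrZ !ger0_norm //.
  have n1' := norm_delta k; have n2' := norm_delta l.
  have a1 : s * `|delta_mx 0 k : 'rV[R]_m| <= h by rewrite -[leRHS]mulr1 ler_pM.
  have a2 : t * `|delta_mx 0 l : 'rV[R]_m| <= h by rewrite -[leRHS]mulr1 ler_pM.
  apply: le_lt_trans (lerD a1 a2) _.
  clear -r0; rewrite /h; lra.
have [s [t [hs ht E1]]] := mixed_difference sf h0
  (fun s t hs ht => let: And3 a _ _ := hr _ (inb i j s t hs ht) in a).
have [s' [t' [hs' ht' E2]]] := mixed_difference sf h0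
  (fun s t hs ht => let: And3 a _ _ := hr _ (inb j i s t hs ht) in a).
have [_ _ b1] := hr _ (inb i j s t hs ht).
have [_ b2 _] := hr _ (inb j i s' t' hs' ht').
have E : pd j (pd i f) (z + s *: delta_mx 0 i + t *: delta_mx 0 j) =
         pd i (pd j f) (z + s' *: delta_mx 0 j + t' *: delta_mx 0 i).
  apply: (@mulIf _ (h ^+ 2)); first by rewrite expf_neq0 // gt_eqF.
  apply: etrans (esym E1) (etrans _ E2).
  have -> : z + h *: delta_mx 0 i + h *: delta_mx 0 j =
            z + h *: delta_mx 0 j + h *: delta_mx 0 i by apply: addrAC.
  by congr (_ + _); apply: addrAC.
rewrite E in b1.
have : e < e / 2 + e / 2.
  set w := pd i (pd j f) (z + s' *: delta_mx 0 j + t' *: delta_mx 0 i) in b1 b2.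
  apply: le_lt_trans (ltrD b2 b1); rewrite [X in _ + X]distrC /e.
  exact: ler_distD.
by rewrite -splitr ltxx.
Qed.

Lemma derive_sum_pd (f : 'rV[R]_m -> R) z v : differentiable f z ->
  'D_v f z = \sum_i v 0 i * pd i f z.
Proof.
move=> df; rewrite deriveE // {1}[v]row_sum_delta linear_sum.
by apply: eq_bigr => i _; rewrite linearZ /= /pd deriveE.
Qed.

(** The ball contains the segment from its centre to z, along which the mean value theorem
    applies. *)
Lemma pd0_const_ball (f : 'rV[R]_m -> R) z0 r z :
  (forall y, ball z0 r y -> differentiable f y) ->
  (forall y i, ball z0 r y -> pd i f y = 0) ->
  ball z0 r z -> f z = f z0.
Proof.
move=> df pf bz.
have inb s : 0 <= s <= 1 -> ball z0 r (z0 + s *: (z - z0)).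
  move: bz; rewrite -ball_normE /= opprD addrA subrr sub0r normrN => bz.
  move=> /andP[s0 s1]; rewrite normrZ ger0_norm // -normrN opprB.
  by apply: le_lt_trans bz; rewrite ler_piMl.
have [||s hs] := @MVT_line f z0 (z - z0) 1; first exact: ltr01.
  by move=> s hs; apply: df; apply: inb.
rewrite derive_sum_pd; last by apply: df; apply: inb.
rewrite big1 => [|i _]; last by rewrite pf ?mulr0 //; apply: inb.
by rewrite mul0r scale1r [z0 + _]addrC subrK => /eqP; rewrite subr_eq0 => /eqP.
Qed.

Lemma pd_comp n (F : 'rV[R]_m -> 'rV[R]_n) (phi : 'rV[R]_m -> 'rV[R]_m) z :
  differentiable phi z -> differentiable F (phi z) -> forall i,
  pd i (F \o phi) z = \sum_k pd i phi z 0 k *: pd k F (phi z).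
Proof.
move=> dp dF i.
rewrite /pd deriveE; last exact: (differentiable_comp dp dF).
rewrite (diff_comp dp dF) (deriveE _ dp) /=; set w := 'd phi z _.
rewrite {1}[w]row_sum_delta linear_sum.
by apply: eq_bigr => k _; rewrite linearZ (deriveE _ dF).
Qed.

End Lines.

(** * Pseudo-Euclidean linear algebra and models of the space forms *)

Section InnerProduct.
Variables (R : realType) (N s : nat).
Implicit Types u v w : 'rV[R]_N.

Lemma ipC u v : ip s u v = ip s v u.
Proof. by apply: eq_bigr => i _; rewrite mulrAC. Qed.

Lemma ipDl u v w : ip s (u + v) w = ip s u w + ip s v w.
Proof.
by rewrite -big_split; apply: eq_bigr => i _ /=; rewrite mxE mulrDr mulrDl.
Qed.

Lemma ipZl a u v : ip s (a *: u) v = a * ip s u v.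
Proof.
by rewrite mulr_sumr; apply: eq_bigr => i _; rewrite mxE mulrCA !mulrA.
Qed.

Lemma ipDr u v w : ip s u (v + w) = ip s u v + ip s u w.
Proof. by rewrite ipC ipDl !(ipC _ u). Qed.

Lemma ipZr a u v : ip s u (a *: v) = a * ip s u v.
Proof. by rewrite ipC ipZl ipC. Qed.

Lemma ipNl u v : ip s (- u) v = - ip s u v.
Proof. by rewrite -scaleN1r ipZl mulN1r. Qed.

Lemma ipNr u v : ip s u (- v) = - ip s u v.
Proof. by rewrite ipC ipNl ipC. Qed.

Lemma ipBl u v w : ip s (u - v) w = ip s u w - ip s v w.
Proof. by rewrite ipDl ipNl. Qed.

Lemma ipBr u v w : ip s u (v - w) = ip s u v - ip s u w.
Proof. by rewrite ipDr ipNr. Qed.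

Lemma ip0l u : ip s 0 u = 0.
Proof. by rewrite -(scale0r u) ipZl mul0r. Qed.

Lemma ip0r u : ip s u 0 = 0.
Proof. by rewrite ipC ip0l. Qed.

Lemma ip_suml (I : Type) (r : seq I) (F : I -> 'rV[R]_N) v :
  ip s (\sum_(i <- r) F i) v = \sum_(i <- r) ip s (F i) v.
Proof.
elim: r => [|a r IH]; first by rewrite !big_nil ip0l.
by rewrite !big_cons ipDl IH.
Qed.

Lemma ip_sumr (I : Type) (r : seq I) (F : I -> 'rV[R]_N) v :
  ip s v (\sum_(i <- r) F i) = \sum_(i <- r) ip s v (F i).
Proof. by rewrite ipC ip_suml; apply: eq_bigr => i _; rewrite ipC. Qed.

Definition ip_mx : 'M[R]_N :=
  diag_mx (\row_i (if (i < s)%N then -1 else 1)).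

Lemma ipE u v : ip s u v = (u *m ip_mx *m v^T) 0 0.
Proof.
rewrite mxE; apply: eq_bigr => i _.
by rewrite mul_mx_diag !mxE [u 0 i * _]mulrC.
Qed.

Lemma ip_mx_sq : ip_mx *m ip_mx = 1%:M.
Proof.
apply/matrixP => i j; rewrite mul_diag_mx !mxE.
case: eqP => [->|_]; last by rewrite !mulr0n mulr0.
by rewrite !mulr1n; case: ifP; rewrite ?mulr1 ?mulrNN ?mulr1.
Qed.

Lemma ip_delta u i : ip s u (delta_mx 0 i) = (if (i < s)%N then -1 else 1) * u 0 i.
Proof.
rewrite /ip (bigD1 i) //= big1 ?addr0 => [|j /negPf nj].
  by rewrite mxE !eqxx mulr1.
by rewrite mxE nj andbF mulr0.
Qed.

Lemma orthogonal_mul (T T' : 'M[R]_N) :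
  orthogonal_mx s T -> orthogonal_mx s T' -> orthogonal_mx s (T *m T').
Proof. by move=> oT oT' X X'; rewrite !mulmxA oT' oT. Qed.

Lemma reflection_mx (a : 'rV[R]_N) : ip s a a != 0 ->
  exists2 T : 'M[R]_N, orthogonal_mx s T &
    forall v, v *m T = v - (2 / ip s a a * ip s v a) *: a.
Proof.
move=> na; pose k := 2 / ip s a a.
pose T : 'M[R]_N := 1%:M - k *: ((a *m ip_mx)^T *m a).
have TE v : v *m T = v - (k * ip s v a) *: a.
  rewrite mulmxBr mulmx1 -scalemxAr mulmxA -scalerA; congr (_ - _ *: _).
  have -> : v *m (a *m ip_mx)^T = (ip s v a)%:M.
    apply/matrixP => i j; rewrite !ord1 [RHS]mxE eqxx mulr1n ipE trmx_mul.
    by rewrite mulmxA tr_diag_mx.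
  by rewrite mul_scalar_mx.
exists T => [v w|//].
rewrite !TE !(ipBl, ipBr, ipZl, ipZr) (ipC a w) /k; field.
exact: na.
Qed.

(** Equal norms give <c - c', c - c'> = 2 <c, c - c'>, so the reflection along c - c' sends c to
    c'. *)
Lemma reflection (c c' : 'rV[R]_N) : ip s c c = ip s c' c' ->
  ip s (c - c') (c - c') != 0 ->
  exists2 T : 'M[R]_N, orthogonal_mx s T & c *m T = c'.
Proof.
move=> cc na; have [T oT TE] := reflection_mx na; exists T => //; rewrite TE.
have -> : 2 / ip s (c - c') (c - c') * ip s c (c - c') = 1.
  have E : ip s (c - c') (c - c') = 2 * ip s c (c - c').
    by rewrite !(ipBl, ipBr) (ipC c' c) -cc; ring.
  move: na; rewrite E => na; field.
  by move: na; rewrite mulf_eq0 negb_or => /andP[].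
by rewrite scale1r opprB addrC subrK.
Qed.

Lemma reflection_null (c c' : 'rV[R]_N) : ip s c c = 0 -> ip s c' c' = 0 ->
  ip s c c' != 0 -> exists2 T : 'M[R]_N, orthogonal_mx s T & c *m T = c'.
Proof.
move=> cc cc' ne; apply: reflection; first by rewrite cc cc'.
have -> : ip s (c - c') (c - c') = - 2 * ip s c c'.
  by rewrite !(ipBl, ipBr) (ipC c' c) cc cc'; ring.
by rewrite mulf_neq0 // oppr_eq0 pnatr_eq0.
Qed.

(** By the parallelogram law c - c' and c + c' are not both null when c is not. So a reflection
    sends c to c' or to -c', and in the second case composing with -1 corrects the sign. *)
Lemma witt_nonnull (c c' : 'rV[R]_N) : ip s c c = ip s c' c' ->
  ip s c c != 0 -> exists2 T : 'M[R]_N, orthogonal_mx s T & c *m T = c'.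
Proof.
move=> cc nc.
have [D0|D1] := eqVneq (ip s (c - c') (c - c')) 0; last exact: reflection.
have [||T oT TE] := @reflection c (- c').
- by rewrite ipNl ipNr opprK.
- apply: contra nc => /eqP D2.
  have E : ip s (c - c') (c - c') + ip s (c - - c') (c - - c') = 4 * ip s c c.
    by rewrite opprK !(ipBl, ipBr, ipDl, ipDr) (ipC c' c) -cc; ring.
  by move/eqP: E; rewrite D0 D2 addr0 eq_sym mulf_eq0 pnatr_eq0.
exists (T *m - 1%:M); last by rewrite mulmxA TE mulmxN mulmx1 opprK.
apply: orthogonal_mul => // v w.
by rewrite !mulmxN !mulmx1 ipNl ipNr opprK.
Qed.

End InnerProduct.

Section Models.
Variables (R : realType) (m s : nat).
Implicit Types (c v w y : 'rV[R]_m.+3).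

Lemma lightcone_time N k (c : 'rV[R]_N) : ip k c c = 0 -> c != 0 ->
  exists2 i : 'I_N, (i < k)%N & c 0 i != 0.
Proof.
move=> cc nc; apply/exists_inP; apply: contraT; rewrite negb_exists_in.
move=> /forall_inP c0; case/eqP: nc; apply/rowP => i; rewrite mxE.
have {}c0 (j : 'I_N) : (j < k)%N -> c 0 j = 0 by move=> js; apply/eqP/negPn/c0.
have [/c0 //|nis] := boolP (i < k)%N.
apply/eqP; rewrite -sqrf_eq0; apply/eqP.
have pos (j : 'I_N) : true -> 0 <= (if (j < k)%N then -1 else 1) * c 0 j * c 0 j.
  by case: ifP => [/c0 ->|_ _]; rewrite ?mulr0 // mul1r -expr2 sqr_ge0.
have /eqP := cc; rewrite /ip psumr_eq0 // => /allP/(_ i).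
by rewrite mem_index_enum (negPf nis) mul1r -expr2 => /(_ isT)/eqP.
Qed.

(** Otherwise the form would be negative definite. This extracts the bound on s from the mere
    existence of a point of the hypersurface. *)
Lemma lightcone_space N k (c : 'rV[R]_N) : ip k c c = 0 -> c != 0 -> (k < N)%N.
Proof.
move=> cc nc; rewrite ltnNge; apply: contra nc => Ns; apply/eqP/rowP => i.
rewrite mxE; apply/eqP; rewrite -sqrf_eq0.
have E : \sum_(j < N) c 0 j ^+ 2 = - ip k c c.
  rewrite /ip -sumrN; apply: eq_bigr => j _.
  by rewrite (leq_trans (ltn_ord j) Ns) mulN1r mulNr opprK expr2.
move/eqP: E; rewrite cc oppr0.
rewrite psumr_eq0 => [|j _]; last exact: sqr_ge0.
by move=> /allP/(_ i); rewrite mem_index_enum; apply.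
Qed.

(** Pairing with the target vector is coordinate 0 minus the last one, which is 1 on the standard
    embedding of flat space. Two null vectors are exchanged by a reflection only if their pairing is
    nonzero, hence the preliminary moves. *)
Lemma witt_null c : (s.+1 < m.+3)%N -> ip s.+1 c c = 0 -> c != 0 ->
  exists2 T : 'M[R]_m.+3, orthogonal_mx s.+1 T &
    c *m T = - delta_mx 0 ord0 - delta_mx 0 ord_max.
Proof.
move=> sm cc nc; have [i ilt ci] := lightcone_time cc nc.
(* A transposition of two coordinates of negative sign is orthogonal; it makes coordinate 0
   nonzero. *)
pose T1 : 'M[R]_m.+3 := tperm_mx ord0 i.
have T1E v j : (v *m T1) 0 j = v 0 (tperm ord0 i j).
  rewrite /T1 /tperm_mx -[v in LHS]trmxK -[perm_mx _]trmxK -trmx_mul tr_perm_mx.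
  by rewrite tpermV -row_permE !mxE.
have sg (j : 'I_m.+3) : (tperm ord0 i j < s.+1)%N = (j < s.+1)%N.
  by case: tpermP => [->|->|//]; rewrite ?ilt.
have oT1 : orthogonal_mx s.+1 T1.
  move=> v w; rewrite /ip [RHS](reindex_inj (@perm_inj _ (tperm ord0 i))) /=.
  by apply: eq_bigr => j _; rewrite !T1E sg.
set c1 := c *m T1.
have c10 : c1 0 ord0 != 0 by rewrite T1E tpermL.
have cc1 : ip s.+1 c1 c1 = 0 by rewrite oT1.
pose e0 : 'rV[R]_m.+3 := delta_mx 0 ord0.
pose e1 : 'rV[R]_m.+3 := delta_mx 0 ord_max.
have lastF : ((ord_max : 'I_m.+3) < s.+1)%N = false by rewrite ltnNge -ltnS sm.
have i00 : ip s.+1 e0 e0 = -1 by rewrite ip_delta mxE mulr1.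
have i11 : ip s.+1 e1 e1 = 1 by rewrite ip_delta lastF mxE !eqxx mulr1.
have i01 : ip s.+1 e0 e1 = 0 by rewrite ip_delta mxE mulr0.
have i10 : ip s.+1 e1 e0 = 0 by rewrite ipC.
have c1e0 : ip s.+1 c1 e0 = - c1 0 ord0 by rewrite ip_delta mulN1r.
have c1e1 : ip s.+1 c1 e1 = c1 0 ord_max by rewrite ip_delta lastF mul1r.
suff [T oT TE] : exists2 T : 'M[R]_m.+3, orthogonal_mx s.+1 T & c1 *m T = - e0 - e1.
  by exists (T1 *m T); [apply: orthogonal_mul|rewrite mulmxA].
have null (a : R) : a ^+ 2 = 1 -> ip s.+1 (- e0 - a *: e1) (- e0 - a *: e1) = 0.
  move=> a1; rewrite !(ipBl, ipBr, ipNl, ipNr, ipZl, ipZr) i00 i11 i01 i10.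
  by transitivity (a ^+ 2 - 1); [ring|rewrite a1 subrr].
have step (a : R) : a ^+ 2 = 1 -> c1 0 ord0 - a * c1 0 ord_max != 0 ->
    exists2 T : 'M[R]_m.+3, orthogonal_mx s.+1 T & c1 *m T = - e0 - a *: e1.
  move=> a1 na; apply: reflection_null => //; first exact: null.
  by rewrite ipBr ipNr ipZr c1e0 c1e1 opprK.
(* The pairings for a = 1 and a = -1 cannot both vanish, because coordinate 0 of [c1] is nonzero. If
   only a = -1 is possible, the target is reached through - e0 + e1. *)
have [E0|n1] := eqVneq (c1 0 ord0 - 1 * c1 0 ord_max) 0; last first.
  by have [|T oT TE] := step 1 _ n1; [rewrite expr1n|exists T => //; rewrite TE scale1r].
have [||T oT TE] := step (-1); first by rewrite sqrrN expr1n.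
  move: E0; rewrite mul1r => /eqP; rewrite subr_eq0 => /eqP <-.
  by rewrite mulN1r opprK -mulr2n mulrn_eq0.
(* The two vectors differ by 2 e1, so this reflection changes the sign of the last coordinate. *)
have [||T' oT' TE'] := @reflection R m.+3 s.+1 (- e0 - -1 *: e1) (- e0 - 1 *: e1).
- by rewrite !null // ?sqrrN expr1n.
- have -> : - e0 - -1 *: e1 - (- e0 - 1 *: e1) = 2 *: e1.
    by apply/rowP => j; rewrite !mxE; ring.
  by rewrite ipZl ipZr i11 mulr1 mulf_neq0 // pnatr_eq0.
exists (T *m T'); first exact: orthogonal_mul.
by rewrite mulmxA TE TE' scale1r.
Qed.

Lemma mulmx_col' n k (B : 'M[R]_(n, k.+1)) (v : 'rV[R]_n) j0 :
  v *m col' j0 B = \row_j (v *m B) 0 (lift j0 j).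
Proof.
by apply/rowP => j; rewrite !mxE; apply: eq_bigr => i _; rewrite !mxE.
Qed.

Lemma ip_lift0 n k (v w : 'rV[R]_n.+1) :
  ip k.+1 v w = - (v 0 ord0 * w 0 ord0) +
    ip k (\row_j v 0 (lift ord0 j)) (\row_j w 0 (lift ord0 j)).
Proof.
rewrite /ip big_ord_recl /= mulN1r mulNr; congr (_ + _).
by apply: eq_bigr => j _; rewrite !mxE.
Qed.

Lemma ip_liftmax n k (v w : 'rV[R]_n.+1) : (k <= n)%N ->
  ip k v w = ip k (\row_j v 0 (lift ord_max j)) (\row_j w 0 (lift ord_max j))
    + v 0 ord_max * w 0 ord_max.
Proof.
move=> kn; rewrite /ip big_ord_recr /= ltnNge kn /= mul1r; congr (_ + _).
apply: eq_bigr => j _; rewrite !mxE.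
have E : widen_ord (leqnSn n) j = lift ord_max j.
  by apply: val_inj; rewrite [RHS]lift_max.
by rewrite E ?lift_max.
Qed.

(** A common interface to the three space forms. T is the conformal motion that brings c to standard
    position; P applies T, rescales by r and deletes the coordinates that <y, c> = 1 determines. On
    the complement of c it is a homothety of ratio r. *)
Definition model (S : space_form R m) c (r : R) (T : 'M[R]_m.+3)
    (P : 'M[R]_(m.+3, sf_dim S)) : Prop :=
  [/\ orthogonal_mx s.+1 T, r != 0,
      (forall v w, ip s.+1 v c = 0 -> ip s.+1 w c = 0 ->
         ip (sf_index S) (v *m P) (w *m P) = r ^+ 2 * ip s.+1 v w),
      (forall y, ip s.+1 y y = 0 -> ip s.+1 y c = 1 ->
         sf_carrier (y *m P) /\ sf_embed (y *m P) = r *: (y *m T)) &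
      (forall y v, ip s.+1 y y = 0 -> ip s.+1 y c = 1 ->
         ip s.+1 v c = 0 -> ip s.+1 y v = 0 ->
         sf_tangent (y *m P) (v *m P))].

Lemma sphere_model c : ip s.+1 c c < 0 ->
  exists r T P, @model (sphere_form R m s) c r T P.
Proof.
move=> cneg; pose r := Num.sqrt (- ip s.+1 c c).
have r2 : r ^+ 2 = - ip s.+1 c c by rewrite sqr_sqrtr // oppr_ge0 ltW.
have r0 : r != 0 by rewrite gt_eqF // sqrtr_gt0 oppr_gt0.
(* The minus sign compensates the negative sign of coordinate 0: <v, c> becomes r times coordinate 0
   of v T, so <y, c> = 1 says that r y T has the form (1, u). *)
have [||T oT TE] := @witt_nonnull R m.+3 s.+1 c (- r *: delta_mx 0 ord0).
- by rewrite ipZl ipZr ip_delta !mxE /= -[LHS]opprK -r2; ring.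
- by rewrite lt_eqF.
have hc v : ip s.+1 v c = r * (v *m T) 0 ord0.
  by rewrite -oT TE ipZr ip_delta /=; ring.
pose P : 'M[R]_(m.+3, m.+2) := r *: (T *m col' ord0 1%:M).
have PE v : v *m P = r *: \row_j (v *m T) 0 (lift ord0 j).
  by rewrite -scalemxAr mulmxA mulmx_col' mulmx1.
have ipP v w : ip s (v *m P) (w *m P) = r ^+ 2 * ip s.+1 v w + ip s.+1 v c * ip s.+1 w c.
  rewrite !PE ipZl ipZr -[ip s.+1 v w]oT (ip_lift0 s (v *m T)) !hc; ring.
exists r, T, P; split=> //=.
- by move=> v w v0 w0; rewrite ipP v0 mul0r addr0.
- move=> y yy y1; rewrite ipP yy y1 mulr0 add0r mulr1; split=> //.
  apply/rowP => j; rewrite [LHS]mxE [RHS]mxE; case: unliftP => [k ->|->].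
    by rewrite PE [LHS]mxE; congr (_ * _); rewrite [LHS]mxE.
  by rewrite -hc y1.
- by move=> y v yy y1 v0 yv; rewrite ipP yv v0 !mulr0 addr0.
Qed.

Lemma hyperbolic_model c : (s < m.+2)%N -> 0 < ip s.+1 c c ->
  exists r T P, @model (hyperbolic_form R m s) c r T P.
Proof.
move=> sm cpos; pose r := Num.sqrt (ip s.+1 c c).
have r2 : r ^+ 2 = ip s.+1 c c by rewrite sqr_sqrtr // ltW.
have r0 : r != 0 by rewrite gt_eqF // sqrtr_gt0.
have lastF : ((ord_max : 'I_m.+3) < s.+1)%N = false by rewrite ltnNge sm.
have [||T oT TE] := @witt_nonnull R m.+3 s.+1 c (r *: delta_mx 0 ord_max).
- by rewrite ipZl ipZr ip_delta lastF !mxE !eqxx mul1r mulr1 -expr2 r2.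
- by rewrite gt_eqF.
have hc v : ip s.+1 v c = r * (v *m T) 0 ord_max.
  by rewrite -oT TE ipZr ip_delta lastF mul1r.
pose P : 'M[R]_(m.+3, m.+2) := r *: (T *m col' ord_max 1%:M).
have PE v : v *m P = r *: \row_j (v *m T) 0 (lift ord_max j).
  by rewrite -scalemxAr mulmxA mulmx_col' mulmx1.
have ipP v w : ip s.+1 (v *m P) (w *m P) =
    r ^+ 2 * ip s.+1 v w - ip s.+1 v c * ip s.+1 w c.
  by rewrite !PE ipZl ipZr -[ip s.+1 v w]oT (ip_liftmax (v *m T)) // !hc; ring.
exists r, T, P; split=> //=.
- by move=> v w v0 w0; rewrite ipP v0 mul0r subr0.
- move=> y yy y1; rewrite ipP yy y1 mulr0 add0r mulr1; split=> //.
  apply/rowP => j; rewrite [LHS]mxE [RHS]mxE; case: unliftP => [k ->|->].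
    by rewrite PE [LHS]mxE; congr (_ * _); rewrite [LHS]mxE.
  by rewrite -hc y1.
- by move=> y v yy y1 v0 yv; rewrite ipP yv v0 !mulr0 subr0.
Qed.

Lemma flat_model c : (s < m.+2)%N -> c != 0 -> ip s.+1 c c = 0 ->
  exists r T P, @model (flat_form R m s) c r T P.
Proof.
move=> sm nc cc; have [T oT TE] := witt_null sm cc nc.
have lastF : ((ord_max : 'I_m.+3) < s.+1)%N = false by rewrite ltnNge sm.
have hc v : ip s.+1 v c = (v *m T) 0 ord0 - (v *m T) 0 ord_max.
  by rewrite -oT TE ipBr ipNr !ip_delta lastF /=; ring.
pose P : 'M[R]_(m.+3, m.+1) := T *m col' ord_max (col' ord0 1%:M).
pose mid v : 'rV[R]_m.+1 := \row_j (v *m T) 0 (lift ord0 (lift ord_max j)).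
have PE v : v *m P = mid v.
  by rewrite mulmxA mulmx_col'; apply/rowP => j;
     rewrite [LHS]mxE mulmx_col' [LHS]mxE mulmx1 [RHS]mxE.
have LE : lift ord0 ord_max = ord_max :> 'I_m.+3 by apply: val_inj.
have ipP v w : ip s (v *m P) (w *m P) = ip s.+1 v w
    + (v *m T) 0 ord0 * (w *m T) 0 ord0 - (v *m T) 0 ord_max * (w *m T) 0 ord_max.
  pose tail (u : 'rV[R]_m.+3) : 'rV[R]_m.+2 := \row_j (u *m T) 0 (lift ord0 j).
  have tmid u : \row_j tail u 0 (lift ord_max j) = mid u.
    by apply/rowP => j; rewrite 2![LHS]mxE [RHS]mxE.
  have tlast u : tail u 0 ord_max = (u *m T) 0 ord_max.
    by rewrite [LHS]mxE LE.
  have E0 : ip s.+1 v w = - ((v *m T) 0 ord0 * (w *m T) 0 ord0) +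
      ip s (tail v) (tail w) by rewrite -oT; apply: ip_lift0.
  have E1 : ip s (tail v) (tail w) =
      ip s (mid v) (mid w) + (v *m T) 0 ord_max * (w *m T) 0 ord_max.
    by rewrite -!tmid -!tlast; apply: ip_liftmax.
  by rewrite !PE E0 E1; ring.
exists 1, T, P; split=> //=.
- move=> v w /eqP; rewrite hc subr_eq0 => /eqP v0 /eqP; rewrite hc subr_eq0 => /eqP w0.
  by rewrite ipP v0 w0 expr1n mul1r addrK.
- move=> y yy /eqP; rewrite hc subr_eq => /eqP y1; split=> //.
  (* Coordinate 0 of y T is b + 1, so nullity gives <u, u> = (b + 1)^2 - b^2 = 2 b + 1. This
     recovers both outer coordinates of the embedding. *)
  rewrite scale1r ipP yy add0r y1.
  set b := (y *m T) 0 ord_max.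
  apply/rowP => j; rewrite [LHS]mxE; case: unliftP => [k ->|->]; last first.
    by rewrite y1 -/b; field.
  rewrite [LHS]mxE; case: unliftP => [l ->|->]; first by rewrite PE [LHS]mxE.
  by rewrite LE -/b; field.
Qed.

Lemma exists_model c : (s < m.+2)%N -> c != 0 ->
  exists r T,
    (exists P, @model (flat_form R m s) c r T P) \/
    (exists P, @model (sphere_form R m s) c r T P) \/
    (exists P, @model (hyperbolic_form R m s) c r T P).
Proof.
move=> sm nc; have [c0|c0|c0] := ltgtP (ip s.+1 c c) 0.
- by have [r [T [P h]]] := sphere_model c0; exists r, T; right; left; exists P.
- by have [r [T [P h]]] := hyperbolic_model sm c0; exists r, T; right; right; exists P.
- by have [r [T [P h]]] := flat_model sm nc c0; exists r, T; left; exists P.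
Qed.

End Models.

(** * Derivatives of products and inverses *)

Section Derivatives.
Variables (R : realType) (m : nat).
Implicit Types (D : set 'rV[R]_m).

Lemma smooth_ip D N s (F G : 'rV[R]_m -> 'rV[R]_N) : open D ->
  smooth_on D F -> smooth_on D G -> smooth_on D (fun y => ip s (F y) (G y)).
Proof.
move=> oD sF sG; apply: smooth_sum => // i _.
apply: smoothM => //; last exact: smooth_coord.
by apply: smoothM => //; [apply: smooth_cst|apply: smooth_coord].
Qed.

Lemma pd_ip N s (F G : 'rV[R]_m -> 'rV[R]_N) i z :
  differentiable F z -> differentiable G z ->
  pd i (fun y => ip s (F y) (G y)) z =
  ip s (pd i F z) (G z) + ip s (F z) (pd i G z).
Proof.
move=> dF dG; rewrite -big_split /=.
have dc (k : 'I_N) : differentiable (fun y => (if (k < s)%N then -1 else 1) * F y 0 k) z.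
  apply: (@differentiableM _ _ (fun=> (if (k < s)%N then -1 else 1))
    (fun y => F y 0 k)); last exact: diff_coord.
  exact: differentiable_cst.
rewrite pd_sum => [|k]; last first.
  apply: (@differentiableM _ _ (fun y => (if (k < s)%N then -1 else 1) * F y 0 k)
    (fun y => G y 0 k)); [exact: dc | exact: diff_coord].
apply: eq_bigr => k _.
rewrite pdM; [|exact: dc|exact: diff_coord].
rewrite (@pdM _ _ (fun=> (if (k < s)%N then -1 else 1)) (fun y => F y 0 k));
  [|exact: differentiable_cst|exact: diff_coord].
by rewrite pd_cst mul0r add0r !pd_coord.
Qed.

Lemma pd_ipl N s (F : 'rV[R]_m -> 'rV[R]_N) w i z :
  differentiable F z ->
  pd i (fun y => ip s (F y) w) z = ip s (pd i F z) w.
Proof.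
move=> dF; rewrite (@pd_ip N s F (fun=> w)) // ?pd_cst ?ip0r ?addr0 //.
Qed.

Lemma smooth_det D n (A : 'rV[R]_m -> 'M[R]_n) : open D ->
  (forall i j, smooth_on D (fun z => A z i j)) ->
  smooth_on D (fun z => \det (A z)).
Proof.
move=> oD sA; apply: smooth_sum => // p _; apply: smoothM => //.
  exact: smooth_cst.
by apply: smooth_prod.
Qed.

Lemma smooth_invmx D n (A : 'rV[R]_m -> 'M[R]_n) : open D ->
  (forall z, D z -> A z \in unitmx) ->
  (forall i j, smooth_on D (fun z => A z i j)) ->
  forall i j, smooth_on D (fun z => invmx (A z) i j).
Proof.
move=> oD uA sA i j.
(* Cramer's formula makes each entry a quotient of polynomials in smooth functions. *)
have E z : D z -> (\det (A z))^-1 * cofactor (A z) j i = invmx (A z) i j.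
  by move=> Dz; rewrite /invmx uA // !mxE.
apply: (smooth_eq oD E); apply: smoothM => //.
  apply: smoothV => // [z Dz|]; last exact: smooth_det.
  by rewrite -unitfE -unitmxE uA.
apply: smoothM => //; first exact: smooth_cst.
apply: smooth_det => // k l.
by have -> : (fun z => row' j (col' i (A z)) k l) =
  (fun z => A z (lift j k) (lift i l)) by apply/funext => z; rewrite !mxE.
Qed.

End Derivatives.

Section Frame.
Variables (R : realType) (m s : nat).

(** Pairing a linear relation with N, F, X and the E_j kills its coefficients one after the other,
    so these m + 3 vectors form a basis; only 0 is orthogonal to a basis. Vector identities are
    checked below by pairing with this frame. *)
Lemma frame_complete (F N X : 'rV[R]_m.+3) (E : 'I_m -> 'rV[R]_m.+3) (G : 'M[R]_m) :
  ip s F F = 0 -> ip s F N = 1 -> ip s N N = 0 -> ip s X F = 0 ->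
  ip s X N = 0 -> ip s X X != 0 -> (forall i, ip s F (E i) = 0) ->
  (forall i, ip s N (E i) = 0) -> (forall i, ip s X (E i) = 0) ->
  (forall i j, ip s (E i) (E j) = G i j) -> G \in unitmx ->
  forall w, ip s w F = 0 -> ip s w N = 0 -> ip s w X = 0 ->
    (forall i, ip s w (E i) = 0) -> w = 0.
Proof.
move=> FF FN confN_null normal_lift normal_confN XX FE NE XE EE uG w wF wN wX wE.
pose P : 'M[R]_(1 + (1 + (1 + m)), m.+3) :=
  col_mx F (col_mx N (col_mx X (\matrix_i E i))).
have ipsE (v : 'rV[R]_m) u : ip s (v *m \matrix_i E i) u = \sum_i v 0 i * ip s (E i) u.
  rewrite mulmx_sum_row ip_suml; apply: eq_bigr => i _.
  by rewrite rowK ipZl.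
have uP : (P : 'M[R]_m.+3) \in unitmx.
  rewrite -row_free_unit; apply: inj_row_free.
  suff : forall v : 'rV[R]_(1 + (1 + (1 + m))), v *m P = 0 -> v = 0 by apply.
  move=> v; rewrite -[v]hsubmxK -[rsubmx v]hsubmxK -[rsubmx (rsubmx v)]hsubmxK.
  set a := lsubmx v; set b := lsubmx (rsubmx v).
  set c := lsubmx (rsubmx (rsubmx v)); set d := rsubmx (rsubmx (rsubmx v)).
  rewrite !mul_row_col (mx11_scalar a) (mx11_scalar b) (mx11_scalar c).
  rewrite !mul_scalar_mx => E0.
  have EW u : a 0 0 * ip s F u + b 0 0 * ip s N u + c 0 0 * ip s X u +
      \sum_i d 0 i * ip s (E i) u = 0.
    by rewrite -ipsE -!ipZl -!ipDl -!addrA E0 ip0l.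
  have sum0 u : (forall i, ip s u (E i) = 0) -> \sum_i d 0 i * ip s (E i) u = 0.
    by move=> uE; rewrite big1 // => i _; rewrite ipC uE mulr0.
  have a0 : a 0 0 = 0.
    by have := EW N; rewrite FN confN_null normal_confN sum0 // !mulr0 mulr1 !addr0.
  have b0 : b 0 0 = 0.
    by have := EW F; rewrite FF (ipC s N) FN normal_lift sum0 // !mulr0 mulr1 !addr0 add0r.
  have c0 : c 0 0 = 0.
    have /eqP := EW X; rewrite (ipC s F) normal_lift (ipC s N) normal_confN sum0 // !mulr0 !addr0 !add0r.
    by rewrite mulf_eq0 (negPf XX) orbF => /eqP.
  have d0 : d = 0.
    apply: (can_inj (mulmxK uG)); rewrite mul0mx; apply/rowP => j; rewrite [RHS]mxE.
    have := EW (E j); rewrite FE NE XE !mulr0 !add0r => E1.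
    by rewrite mxE -[RHS]E1; apply: eq_bigr => i _; rewrite EE.
  have z1 : 0%:M = 0 :> 'M[R]_1 by rewrite -scalemx1 scale0r.
  by rewrite a0 b0 c0 d0 z1 !row_mx0.
have wP : P *m (ip_mx R m.+3 s *m w^T) = 0.
  have ip0 (u : 'rV[R]_m.+3) : ip s w u = 0 -> u *m (ip_mx R m.+3 s *m w^T) = 0.
    rewrite ipC ipE -mulmxA => u0; apply/matrixP => i j.
    by rewrite !ord1 u0 mxE.
  rewrite /P !mul_col_mx !ip0 //.
  suff -> : (\matrix_i E i) *m (ip_mx R m.+3 s *m w^T) = 0 by rewrite !col_mx0.
  by apply/row_matrixP => i; rewrite row_mul rowK ip0 // row0.
apply: trmx_inj; rewrite trmx0 -[w^T]mul1mx -(ip_mx_sq R m.+3 s) -mulmxA.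
by rewrite -[_ *m w^T](mulKmx uP) wP !mulmx0.
Qed.

End Frame.

(** * Sealed derivatives *)

(* Sealed copies of [pd] and [smooth_on]: otherwise unification unfolds the limit
   in the derivative and the tower of normed module structures. *)
HB.lock Definition ds (R : realType) m (i : 'I_m) (f : 'rV[R]_m -> R)
  (z : 'rV[R]_m) : R := pd i f z.
HB.lock Definition dv (R : realType) m n (i : 'I_m) (F : 'rV[R]_m -> 'rV[R]_n)
  (z : 'rV[R]_m) : 'rV[R]_n := pd i F z.
HB.lock Definition sms (R : realType) m (D : set 'rV[R]_m) (f : 'rV[R]_m -> R) : Prop :=
  smooth_on D f.
HB.lock Definition smv (R : realType) m n (D : set 'rV[R]_m)
  (F : 'rV[R]_m -> 'rV[R]_n) : Prop := smooth_on D F.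

Local Ltac unseal := rewrite ?dv.unlock ?ds.unlock ?sms.unlock ?smv.unlock.

Section PlainDerivatives.
Variables (R : realType) (m : nat).
Variables (D : set 'rV[R]_m) (oD : open D).

Lemma ds_on (f h : 'rV[R]_m -> R) i z : D z ->
  (forall y, D y -> f y = h y) -> ds i f z = ds i h z.
Proof. unseal; exact: pd_on. Qed.

Lemma dv_on n (f h : 'rV[R]_m -> 'rV[R]_n) i z : D z ->
  (forall y, D y -> f y = h y) -> dv i f z = dv i h z.
Proof. unseal; exact: pd_on. Qed.

Lemma sms_eq (f h : 'rV[R]_m -> R) : (forall y, D y -> f y = h y) -> sms D f -> sms D h.
Proof. unseal; exact: smooth_eq. Qed.

Lemma sms_sub D' (f : 'rV[R]_m -> R) : D' `<=` D -> sms D f -> sms D' f.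
Proof. unseal; exact: smooth_sub. Qed.

Lemma sms_cont (f : 'rV[R]_m -> R) y : sms D f -> D y -> {for y, continuous f}.
Proof.
unseal => sf Dy.
by apply: differentiable_continuous; exact: smooth_diff sf Dy.
Qed.

Lemma open_neq0 (f : 'rV[R]_m -> R) : sms D f -> open [set y | D y /\ f y != 0].
Proof.
move=> sf; rewrite openE => y [Dy fy]; rewrite /interior.
have n1 := open_near oD Dy.
have /cvgrPdist_lt/(_ `|f y|) := sms_cont sf Dy.
rewrite normr_gt0 => /(_ fy) n2; apply: filterS2 n1 n2 => w /= Dw fw; split=> //.
by apply: contraTneq fw => ->; rewrite subr0 ltxx.
Qed.

Lemma sms_cst (c : R) : sms D (fun=> c). Proof. unseal; exact: smooth_cst. Qed.
Lemma smsD (f h : 'rV[R]_m -> R) : sms D f -> sms D h -> sms D (fun y => f y + h y).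
Proof. unseal; exact: smoothD. Qed.
Lemma smsN (f : 'rV[R]_m -> R) : sms D f -> sms D (fun y => - f y).
Proof. unseal; exact: smoothN. Qed.
Lemma smsB (f h : 'rV[R]_m -> R) : sms D f -> sms D h -> sms D (fun y => f y - h y).
Proof. unseal; exact: smoothB. Qed.
Lemma smsM (f h : 'rV[R]_m -> R) : sms D f -> sms D h -> sms D (fun y => f y * h y).
Proof. unseal; exact: smoothM. Qed.
Lemma smsV (f : 'rV[R]_m -> R) : (forall z, D z -> f z != 0) ->
  sms D f -> sms D (fun y => (f y)^-1).
Proof. unseal; exact: smoothV. Qed.
Lemma sms_sum n (f : 'I_n -> 'rV[R]_m -> R) : (forall k, sms D (f k)) ->
  sms D (fun y => \sum_k f k y).
Proof. unseal; by move=> sf; exact: (@smooth_sum _ _ D _ _ (index_enum _) xpredT f oD (fun k _ => sf k)). Qed.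
Lemma sms_ds f i : sms D f -> sms D (ds i f). Proof. unseal; exact: smooth_pd. Qed.

Lemma smv_cst n (c : 'rV[R]_n) : smv D (fun=> c). Proof. unseal; exact: smooth_cst. Qed.
Lemma smvN n (f : 'rV[R]_m -> 'rV[R]_n) : smv D f -> smv D (fun y => - f y).
Proof. unseal; exact: smoothN. Qed.
Lemma smvD n (f h : 'rV[R]_m -> 'rV[R]_n) : smv D f -> smv D h -> smv D (fun y => f y + h y).
Proof. unseal; exact: smoothD. Qed.
Lemma smvB n (f h : 'rV[R]_m -> 'rV[R]_n) : smv D f -> smv D h -> smv D (fun y => f y - h y).
Proof. unseal; exact: smoothB. Qed.
Lemma smvZ n (f : 'rV[R]_m -> R) (h : 'rV[R]_m -> 'rV[R]_n) :
  sms D f -> smv D h -> smv D (fun y => f y *: h y).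
Proof. unseal; exact: smoothZ. Qed.
Lemma smv_sum n k (f : 'I_k -> 'rV[R]_m -> 'rV[R]_n) : (forall i, smv D (f i)) ->
  smv D (fun y => \sum_i f i y).
Proof. unseal; by move=> sf; exact: (@smooth_sum _ _ D _ _ (index_enum _) xpredT f oD (fun k _ => sf k)). Qed.
Lemma smv_dv n (f : 'rV[R]_m -> 'rV[R]_n) i : smv D f -> smv D (dv i f). Proof. unseal; exact: smooth_pd. Qed.
Lemma smv_mulmx n n' (f : 'rV[R]_m -> 'rV[R]_n) (P : 'M[R]_(n, n')) :
  smv D f -> smv D (fun y => f y *m P).
Proof. unseal; exact: smooth_mulmx. Qed.
Lemma sms_ip n s (f h : 'rV[R]_m -> 'rV[R]_n) :
  smv D f -> smv D h -> sms D (fun y => ip s (f y) (h y)).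
Proof. unseal; exact: smooth_ip. Qed.

Variables (z : 'rV[R]_m) (Dz : D z).

Lemma ds_cst (c : R) i : ds i (fun=> c) z = 0.
Proof. unseal; exact: pd_cst. Qed.

Lemma dsD (f h : 'rV[R]_m -> R) i : sms D f -> sms D h ->
  ds i (fun y => f y + h y) z = ds i f z + ds i h z.
Proof.
unseal; by move=> sf sh; apply: pdD; [exact: smooth_diff sf Dz|exact: smooth_diff sh Dz].
Qed.

Lemma dsB (f h : 'rV[R]_m -> R) i : sms D f -> sms D h ->
  ds i (fun y => f y - h y) z = ds i f z - ds i h z.
Proof.
unseal; by move=> sf sh; apply: pdB; [exact: smooth_diff sf Dz|exact: smooth_diff sh Dz].
Qed.

Lemma dsM (f h : 'rV[R]_m -> R) i : sms D f -> sms D h ->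
  ds i (fun y => f y * h y) z = ds i f z * h z + f z * ds i h z.
Proof.
unseal; by move=> sf sh; apply: pdM; [exact: smooth_diff sf Dz|exact: smooth_diff sh Dz].
Qed.

Lemma ds_sum n (f : 'I_n -> 'rV[R]_m -> R) i : (forall k, sms D (f k)) ->
  ds i (fun y => \sum_k f k y) z = \sum_k ds i (f k) z.
Proof. unseal; by move=> sf; apply: pd_sum => k; exact: smooth_diff (sf k) Dz. Qed.

Lemma ds_ip n s (f h : 'rV[R]_m -> 'rV[R]_n) i : smv D f -> smv D h ->
  ds i (fun y => ip s (f y) (h y)) z = ip s (dv i f z) (h z) + ip s (f z) (dv i h z).
Proof.
unseal; by move=> sf sh; apply: pd_ip; [exact: smooth_diff sf Dz|exact: smooth_diff sh Dz].
Qed.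

Lemma ds_ipl n s (f : 'rV[R]_m -> 'rV[R]_n) w i : smv D f ->
  ds i (fun y => ip s (f y) w) z = ip s (dv i f z) w.
Proof. unseal; by move=> sf; apply: pd_ipl; exact: smooth_diff sf Dz. Qed.

Lemma dv_coord n (f : 'rV[R]_m -> 'rV[R]_n) i k : smv D f ->
  ds i (fun y => f y 0 k) z = dv i f z 0 k.
Proof. unseal; by move=> sf; apply: pd_coord; exact: smooth_diff sf Dz. Qed.

(** Since 2 f df = dt. It serves for the functions that are known only through their squares: [e],
    [tau] and [b]. *)
Lemma ds_sqr0 (f t : 'rV[R]_m -> R) i : sms D f -> f z != 0 ->
  (forall y, D y -> f y * f y = t y) -> ds i t z = 0 -> ds i f z = 0.
Proof.
move=> sf nz E t0; apply: (mulfI nz); rewrite mulr0.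
have := ds_on i Dz E; rewrite dsM // t0 [X in X + _]mulrC; lra.
Qed.

Lemma sms_coord n (f : 'rV[R]_m -> 'rV[R]_n) k : smv D f -> sms D (fun y => f y 0 k).
Proof. unseal; exact: smooth_coord. Qed.

Lemma smv_row n (f : 'rV[R]_m -> 'rV[R]_n) : (forall k, sms D (fun y => f y 0 k)) -> smv D f.
Proof. unseal; exact: smooth_row. Qed.

Lemma ds_schwarz (f : 'rV[R]_m -> R) i j : sms D f ->
  ds i (ds j f) z = ds j (ds i f) z.
Proof. unseal; by move=> sf; exact: (schwarz i j oD sf Dz). Qed.

Lemma dvD n (f h : 'rV[R]_m -> 'rV[R]_n) i : smv D f -> smv D h ->
  dv i (fun y => f y + h y) z = dv i f z + dv i h z.
Proof.
unseal; by move=> sf sh; apply: pdD; [exact: smooth_diff sf Dz|exact: smooth_diff sh Dz].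
Qed.

Lemma dvB n (f h : 'rV[R]_m -> 'rV[R]_n) i : smv D f -> smv D h ->
  dv i (fun y => f y - h y) z = dv i f z - dv i h z.
Proof.
unseal; by move=> sf sh; apply: pdB; [exact: smooth_diff sf Dz|exact: smooth_diff sh Dz].
Qed.

End PlainDerivatives.

Section Unfolding.
Variables (R : realType) (m s : nat) (F X : 'rV[R]_m -> 'rV[R]_m.+3).
Variables (G : 'rV[R]_m -> 'M[R]_m).

Lemma lift_gramE z i j : lift_gram s F z i j = ip s.+1 (dv i F z) (dv j F z).
Proof. unseal; by rewrite mxE. Qed.

Lemma christoffel_ds k i j z : christoffel G k i j z =
  2^-1 * \sum_l invmx (G z) k l *
   (ds i (gentry G j l) z + ds j (gentry G i l) z - ds l (gentry G i j) z).
Proof. unseal; exact: erefl. Qed.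

Lemma riemann_ds q k i j z : riemann G q k i j z =
  ds i (christoffel G q j k) z - ds j (christoffel G q i k) z
  + \sum_p (christoffel G q i p z * christoffel G p j k z
            - christoffel G q j p z * christoffel G p i k z).
Proof. unseal; exact: erefl. Qed.

Lemma lift_laplacian_dv z : lift_laplacian s F z =
  \sum_i \sum_j invmx (lift_gram s F z) i j *:
    (dv i (dv j F) z - \sum_k christoffel (lift_gram s F) k i j z *: dv k F z).
Proof. unseal; exact: erefl. Qed.

Lemma is_unit_normal_dv z : is_unit_normal s F X z ->
  [/\ ip s.+1 (X z) (X z) = 1 \/ ip s.+1 (X z) (X z) = -1,
      ip s.+1 (X z) (F z) = 0, ip s.+1 (X z) (conf_N s F z) = 0 &
      forall i, ip s.+1 (X z) (dv i F z) = 0].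
Proof. unseal; exact: id. Qed.

Lemma conf_A_dv z : conf_A s F z = invmx (lift_gram s F z) *m
  \matrix_(i, j) ip s.+1 (dv j (conf_N s F) z) (dv i F z).
Proof. unseal; exact: erefl. Qed.

Lemma conf_B_dv z : conf_B s F X z = invmx (lift_gram s F z) *m
  \matrix_(i, j) (ip s.+1 (X z) (X z) * ip s.+1 (dv j (dv i F) z) (X z)).
Proof. unseal; exact: erefl. Qed.

Lemma conf_C_dv i z : conf_C s F X i z =
  ip s.+1 (X z) (X z) * ip s.+1 (dv i (conf_N s F) z) (X z).
Proof. unseal; exact: erefl. Qed.

Lemma sms_gram (D : set 'rV[R]_m) : open D ->
  (forall z, D z -> G z \in unitmx) -> (forall i j, sms D (fun y => G y i j)) ->
  forall i j, sms D (fun y => invmx (G y) i j).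
Proof. unseal; exact: smooth_invmx. Qed.

End Unfolding.

Section PlainRows.
Variables (R : realType) (m n : nat) (D : set 'rV[R]_m) (oD : open D).
Variables (z : 'rV[R]_m) (Dz : D z).

Lemma dv_schwarz (H : 'rV[R]_m -> 'rV[R]_n) i j : smv D H ->
  dv i (dv j H) z = dv j (dv i H) z.
Proof.
move=> sH; apply/rowP => k.
have E a b : dv a (dv b H) z 0 k = ds a (ds b (fun y => H y 0 k)) z.
  rewrite -(dv_coord Dz _ _ (smv_dv b sH)).
  by apply: (ds_on oD) => // y Dy; rewrite (dv_coord Dy).
exact: etrans (E i j) (etrans (ds_schwarz oD Dz i j (sms_coord oD k sH)) (esym (E j i))).
Qed.

Lemma dvZ (f : 'rV[R]_m -> R) (H : 'rV[R]_m -> 'rV[R]_n) i : sms D f -> smv D H ->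
  dv i (fun y => f y *: H y) z = ds i f z *: H z + f z *: dv i H z.
Proof.
move=> sf sH; apply/rowP => k.
rewrite -(dv_coord Dz); last exact: smvZ.
rewrite !mxE -(dv_coord Dz) // -(dsM Dz) //; last exact: sms_coord.
by congr (ds i _ z); apply/funext => y; rewrite mxE.
Qed.

Lemma dv_mulmx n' (P : 'M[R]_(n, n')) (H : 'rV[R]_m -> 'rV[R]_n) i : smv D H ->
  dv i (fun y => H y *m P) z = dv i H z *m P.
Proof.
move=> sH; apply/rowP => k.
rewrite -(dv_coord Dz); last exact: smv_mulmx.
have -> : (fun y => (H y *m P) 0 k) = (fun y => \sum_j H y 0 j * P j k).
  by apply/funext => y; rewrite mxE.
have s1 j : sms D (fun y => H y 0 j) by exact: sms_coord.
have s2 (j : 'I_n) : sms D (fun=> P j k) by exact: sms_cst.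
rewrite (ds_sum Dz) => [|j]; last exact: smsM.
rewrite mxE; apply: eq_bigr => j _.
by rewrite (dsM Dz) // ds_cst mulr0 addr0 (dv_coord Dz).
Qed.

End PlainRows.

(** * Linear algebra of the shape operator *)

Section MatrixDerivative.
Variables (R : realType) (m : nat) (D : set 'rV[R]_m) (oD : open D).

Definition mpd n k (i : 'I_m) (A : 'rV[R]_m -> 'M[R]_(n, k)) z : 'M[R]_(n, k) :=
  \matrix_(p, q) ds i (fun y => A y p q) z.

Definition msm n k (A : 'rV[R]_m -> 'M[R]_(n, k)) : Prop :=
  forall p q, sms D (fun y => A y p q).

Lemma mpdE n k i (A : 'rV[R]_m -> 'M[R]_(n, k)) z p q :
  mpd i A z p q = ds i (fun y => A y p q) z.
Proof. by rewrite mxE. Qed.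

Lemma msm_mul n k l (A : 'rV[R]_m -> 'M[R]_(n, k)) (B : 'rV[R]_m -> 'M[R]_(k, l)) :
  msm A -> msm B -> msm (fun y => A y *m B y).
Proof.
move=> sA sB p q.
have -> : (fun y => (A y *m B y) p q) = (fun y => \sum_r A y p r * B y r q).
  by apply/funext => y; rewrite mxE.
by apply: (sms_sum oD) => r; apply: (smsM oD).
Qed.

Lemma msmD n k (A B : 'rV[R]_m -> 'M[R]_(n, k)) :
  msm A -> msm B -> msm (fun y => A y + B y).
Proof.
move=> sA sB p q.
have -> : (fun y => (A y + B y) p q) = (fun y => A y p q + B y p q).
  by apply/funext => y; rewrite mxE.
exact: (smsD oD).
Qed.

Lemma msmZ n k (f : 'rV[R]_m -> R) (A : 'rV[R]_m -> 'M[R]_(n, k)) :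
  sms D f -> msm A -> msm (fun y => f y *: A y).
Proof.
move=> sf sA p q.
have -> : (fun y => (f y *: A y) p q) = (fun y => f y * A y p q).
  by apply/funext => y; rewrite mxE.
exact: (smsM oD).
Qed.

Lemma msm_tr n k (A : 'rV[R]_m -> 'M[R]_(n, k)) :
  msm A -> msm (fun y => (A y)^T).
Proof.
move=> sA p q; have -> : (fun y => (A y)^T p q) = (fun y => A y q p).
  by apply/funext => y; rewrite mxE.
exact: sA.
Qed.

Lemma sms_mxtrace n (A : 'rV[R]_m -> 'M[R]_n) : msm A -> sms D (fun y => mxtrace (A y)).
Proof. by move=> sA; apply: (sms_sum oD) => i; exact: sA. Qed.

Variables (z : 'rV[R]_m) (Dz : D z).

Lemma mpd_on n k (A B : 'rV[R]_m -> 'M[R]_(n, k)) i :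
  (forall y, D y -> A y = B y) -> mpd i A z = mpd i B z.
Proof.
move=> AB; apply/matrixP => p q; rewrite !mpdE.
by apply: (ds_on oD) => // y Dy; rewrite AB.
Qed.

Lemma mpd_mul n k l (A : 'rV[R]_m -> 'M[R]_(n, k)) (B : 'rV[R]_m -> 'M[R]_(k, l)) i :
  msm A -> msm B ->
  mpd i (fun y => A y *m B y) z = mpd i A z *m B z + A z *m mpd i B z.
Proof.
move=> sA sB; apply/matrixP => p q; rewrite mpdE.
have -> : (fun y => (A y *m B y) p q) = (fun y => \sum_r A y p r * B y r q).
  by apply/funext => y; rewrite mxE.
rewrite (ds_sum Dz) => [|r]; last by apply: (smsM oD).
rewrite [RHS]mxE [X in _ = X + _]mxE [X in _ = _ + X]mxE -big_split /=.
by apply: eq_bigr => r _; rewrite (dsM Dz) // !mpdE.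
Qed.

Lemma mpdD n k (A B : 'rV[R]_m -> 'M[R]_(n, k)) i : msm A -> msm B ->
  mpd i (fun y => A y + B y) z = mpd i A z + mpd i B z.
Proof.
move=> sA sB; apply/matrixP => p q; rewrite [RHS]mxE !mpdE.
have -> : (fun y => (A y + B y) p q) = (fun y => A y p q + B y p q).
  by apply/funext => y; rewrite mxE.
by rewrite (dsD Dz).
Qed.

Lemma mpdZ n k (f : 'rV[R]_m -> R) (A : 'rV[R]_m -> 'M[R]_(n, k)) i :
  sms D f -> msm A ->
  mpd i (fun y => f y *: A y) z = ds i f z *: A z + f z *: mpd i A z.
Proof.
move=> sf sA; apply/matrixP => p q; rewrite mpdE [RHS]mxE.
have -> : (fun y => (f y *: A y) p q) = (fun y => f y * A y p q).
  by apply/funext => y; rewrite mxE.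
by rewrite (dsM Dz) // [X in _ = X + _]mxE [X in _ = _ + X]mxE mpdE.
Qed.

Lemma mpd_tr n k (A : 'rV[R]_m -> 'M[R]_(n, k)) i :
  mpd i (fun y => (A y)^T) z = (mpd i A z)^T.
Proof.
apply/matrixP => p q; rewrite [RHS]mxE !mpdE.
by have -> : (fun y => (A y)^T p q) = (fun y => A y q p)
  by apply/funext => y; rewrite mxE.
Qed.

Lemma mpd_schwarz n k (A : 'rV[R]_m -> 'M[R]_(n, k)) i j : msm A ->
  mpd i (mpd j A) z = mpd j (mpd i A) z.
Proof.
move=> sA; apply/matrixP => p q; rewrite !mpdE.
have E l : (fun y => mpd l A y p q) = ds l (fun y => A y p q).
  by apply/funext => y; rewrite mpdE.
by rewrite !E; apply: (ds_schwarz oD Dz); exact: sA.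
Qed.

End MatrixDerivative.

Section Algebra.
Variables (R : realType) (m : nat).

(* With S totally symmetric, moving K across any two of the three slots changes
   the sign, which is impossible for three slots unless S vanishes. *)
Lemma symmetric_anticommuting_eq0 (S : 'I_m -> 'M[R]_m) (K : 'M[R]_m) :
  (forall i j k, S i j k = S j i k) -> (forall i j k, S i j k = S i k j) ->
  (forall i, S i *m K + K^T *m S i = 0) -> K \in unitmx -> forall i, S i = 0.
Proof.
move=> s12 s23 anti uK i.
pose t2 i j k := \sum_q K q j * S i q k.
pose t3 i j k := \sum_q K q k * S i j q.
have t23 a b c : t2 a b c = - t3 a b c.
  have /matrixP/(_ b c) := anti a; rewrite mxE [RHS]mxE => /eqP.
  rewrite addrC addr_eq0 => /eqP; rewrite /t2 /t3 [X in X = _]mxE [X in _ = - X]mxE.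
  have -> : \sum_j K^T b j * S a j c = \sum_q K q b * S a q c.
    by apply: eq_bigr => q _; rewrite mxE.
  move=> ->; congr (- _); by apply: eq_bigr => q _; rewrite mulrC.
have K0 : K^T *m S i = 0.
  apply/matrixP => j k; rewrite [RHS]mxE [LHS]mxE.
  have -> : \sum_q K^T j q * S i q k = t2 i j k.
    by apply: eq_bigr => q _; rewrite mxE.
  pose t1 := \sum_q K q i * S q j k.
  have e1 : t1 = - t2 i j k.
    have -> : t1 = t2 k i j.
      by apply: eq_bigr => q _; rewrite s23 s12 s23 s12 s23 s12.
    rewrite t23; congr (- _); apply: eq_bigr => q _.
    by rewrite s12 s23 s12 s23 s12 s23.
  have e2 : t1 = - t3 i j k.
    have -> : t1 = t2 j i k by apply: eq_bigr => q _; rewrite s12.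
    rewrite t23; congr (- _); apply: eq_bigr => q _; by rewrite s12.
  have := t23 i j k; lra.
have uKt : K^T \in unitmx by rewrite unitmx_tr.
by rewrite -[S i](mulKmx uKt) K0 mulmx0.
Qed.

(** By Cayley-Hamilton Q^2 = - det Q I; the trace identifies - det Q. *)
Lemma traceless2_sq n (Q : 'M[R]_n) : n = 2 -> mxtrace Q = 0 ->
  Q *m Q = (mxtrace (Q *m Q) / 2)%:M.
Proof.
move=> n2; subst n; rewrite /mxtrace !big_ord_recl !big_ord0 => tr0.
set i0 : 'I_2 := ord0 in tr0 *; set i1 : 'I_2 := lift ord0 ord0 in tr0 *.
have E : Q i1 i1 = - Q i0 i0 by lra.
have QE a b : (Q *m Q) a b = Q a i0 * Q i0 b + Q a i1 * Q i1 b.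
  by rewrite mxE !big_ord_recl big_ord0 addr0.
have cases (P : 'I_2 -> Prop) : P i0 -> P i1 -> forall a, P a.
  move=> P0 P1 a; case: (unliftP ord0 a) => [b ->|-> //].
  by rewrite (ord1 b).
apply/matrixP => a b; move: a; apply: (cases); move: b; apply: (cases);
  by rewrite [RHS]mxE !QE E /=; field.
Qed.

(** Contract the relation over i = q. *)
Lemma trace_relation (Q : 'M[R]_m) (la mu : 'cV[R]_m) (e : R) :
  mxtrace Q = 0 ->
  (forall i j q, la j 0 * (i == q)%:R + e * mu j 0 * Q i q =
                 la i 0 * (j == q)%:R + e * mu i 0 * Q j q) ->
  (m%:R - 1) *: la = e *: (Q *m mu).
Proof.
move=> trQ T; apply/matrixP => j k; rewrite ord1 !mxE.
have : \sum_i (la j 0 * (i == i)%:R + e * mu j 0 * Q i i) =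
       \sum_i (la i 0 * (j == i)%:R + e * mu i 0 * Q j i).
  by apply: eq_bigr => i _; apply: T.
rewrite !big_split /= -!mulr_sumr.
have -> : \sum_i Q i i = 0 by [].
have -> : \sum_(i : 'I_m) ((i == i)%:R : R) = m%:R.
  under eq_bigr do rewrite eqxx.
  by rewrite sumr_const card_ord.
have -> : \sum_i la i 0 * (j == i)%:R = la j 0.
  rewrite (bigD1 j) //= eqxx mulr1 big1 ?addr0 // => i ij.
  by rewrite eq_sym (negPf ij) mulr0.
have -> : \sum_i e * mu i 0 * Q j i = e * \sum_i Q j i * mu i 0.
  by rewrite mulr_sumr; apply: eq_bigr => i _; rewrite -mulrA [mu i 0 * _]mulrC.
lra.
Qed.

(* The relation for j = j0 writes Q as b I plus a matrix of rank at most two; applied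
   to mu it shows that la and mu are proportional when m > 2, so the rank is one. *)
Lemma rank_one_algebra (Q : 'M[R]_m) (la mu : 'cV[R]_m) (e : R) j0 :
  (1 < m)%N -> e ^+ 2 = 1 -> mxtrace Q = 0 ->
  (forall i j q, la j 0 * (i == q)%:R + e * mu j 0 * Q i q =
                 la i 0 * (j == q)%:R + e * mu i 0 * Q j q) ->
  mu j0 0 != 0 ->
  let b := - (e * la j0 0 / mu j0 0) in
  let d := (m%:R - 2) / 2 * b in
  [/\ (Q + d%:M) *m (Q + d%:M) = (m%:R * mxtrace (Q *m Q) / (4 * (m%:R - 1)))%:M,
      (2 < m)%N -> mxtrace (Q *m Q) = m%:R * (m%:R - 1) * b ^+ 2 &
      (2 < m)%N -> la = - (e * b) *: mu].
Proof.
move=> m1 e2 trQ T nz b d.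
have e0 : e != 0 by apply: contra_eq_neq e2 => ->; rewrite expr0n eq_sym oner_neq0.
have m0 : m%:R - 1 != 0 :> R by rewrite subr_eq0 pnatr_eq1 gtn_eqF.
have mm0 : m%:R != 0 :> R by rewrite pnatr_eq0 -lt0n ltnW.
have tr := trace_relation trQ T.
pose x : 'rV[R]_m := (e / mu j0 0) *: delta_mx 0 j0.
pose y : 'rV[R]_m := (mu j0 0)^-1 *: row j0 Q.
have QE : Q = b%:M + la *m x + mu *m y.
  have solve (q0 q1 A B l0 l1 n0 n1 : R) : n0 != 0 ->
      l0 * A + e * n0 * q0 = l1 * B + e * n1 * q1 ->
      q0 = - (e * l0 / n0) * A + l1 * (e / n0 * B) + n1 * (n0^-1 * q1).
    move=> n00 E.
    have -> : q0 = e / n0 * (e * n0 * q0).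
      by transitivity (e ^+ 2 * q0); [rewrite e2 mul1r|field].
    have -> : e * n0 * q0 = l1 * B + e * n1 * q1 - l0 * A by rewrite -E; ring.
    have -> : n0^-1 * q1 = e ^+ 2 * n0^-1 * q1 by rewrite e2 mul1r.
    by field.
  apply/matrixP => i q; rewrite [RHS]mxE [X in _ = X + _]mxE.
  rewrite [X in _ = X + _ + _]mxE [X in _ = _ + X + _]mxE [X in _ = _ + _ + X]mxE.
  rewrite !big_ord1 -mulr_natr !mxE eqxx /= [q == j0]eq_sym.
  exact: solve nz (T i j0 q).
have xmu : x *m mu = e%:M.
  apply/matrixP => i k; rewrite !ord1 -scalemxAl [RHS]mxE [LHS]mxE -rowE.
  by rewrite [X in _ * X]mxE /= mulr1n divfK.
have xla : x *m la = (- b)%:M.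
  apply/matrixP => i k; rewrite !ord1 -scalemxAl [RHS]mxE [LHS]mxE -rowE.
  by rewrite [X in _ * X]mxE /= mulr1n /b opprK; field.
have laE : (m%:R - 1) * la j0 0 = e * (Q *m mu) j0 0.
  by have /matrixP/(_ j0 0) := tr; rewrite mxE [RHS]mxE.
have ymu : y *m mu = (- (m%:R - 1) * b)%:M.
  apply/matrixP => i k; rewrite !ord1 -scalemxAl [RHS]mxE [LHS]mxE -row_mul.
  rewrite [X in _ * X]mxE /= mulr1n.
  have -> : (Q *m mu) j0 0 = e * ((m%:R - 1) * la j0 0).
    by rewrite laE mulrA -expr2 e2 mul1r.
  by rewrite /b; field.
clearbody x y.
(* Q mu is computed twice, from [tr] and from [QE]. The factor m - 2 is the reason why m = 2 is
   treated separately. *)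
have key : (m%:R - 2) *: (e *: la + b *: mu) = 0.
  have H : (m%:R - 1) *: (e *: la) = b *: mu + e *: la + (- (m%:R - 1) * b) *: mu.
    rewrite [LHS]scalerA [_ * e]mulrC -[LHS]scalerA tr scalerA -expr2 e2 scale1r {1}QE.
    rewrite !mulmxDl mul_scalar_mx -!mulmxA xmu ymu.
    by rewrite !mul_mx_scalar.
  apply/matrixP => i k; move/matrixP: H => /(_ i k); rewrite !mxE; lra.
have trl : mxtrace (la *m x) = - b.
  by rewrite mxtrace_mulC xla /mxtrace big_ord1 mxE eqxx.
have lin : (2 < m)%N -> la = - (e * b) *: mu.
  move=> m2; have /eqP := key; rewrite scaler_eq0 => /orP[|/eqP E].
    by rewrite subr_eq0 eqr_nat gtn_eqF.
  have : e *: (e *: la + b *: mu) = 0 by rewrite E scaler0.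
  rewrite scalerDr !scalerA -expr2 e2 scale1r => /eqP; rewrite addr_eq0 => /eqP ->.
  by rewrite scaleNr.
(* Now Q = b I + mu w with w mu = - m b, so Q is a root of the quadratic polynomial with roots b and
   (1 - m) b. *)
have sq3 : (2 < m)%N -> Q *m Q = ((2 - m%:R) * b) *: Q + ((m%:R - 1) * b ^+ 2)%:M.
  move=> m2; pose w := y - (e * b) *: x.
  have QE' : Q = b%:M + mu *m w.
    have lx : la *m x = - ((e * b) *: (mu *m x)).
      by rewrite {1}(lin m2) -scalemxAl scaleNr.
    rewrite {1}QE -addrA lx /w mulmxBr -scalemxAr.
    by rewrite [- _ + _]addrC.
  have wmu : w *m mu = (- (m%:R * b))%:M.
    rewrite /w mulmxBl -scalemxAl xmu ymu; apply/matrixP => i k; rewrite !ord1 !mxE.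
    by rewrite !eqxx !mulr1n -[e * b * e]mulrAC -expr2 e2; ring.
  clearbody w.
  have E2 : mu *m w *m (mu *m w) = - (m%:R * b) *: (mu *m w).
    by rewrite mulmxA -[mu *m w *m mu]mulmxA wmu mul_mx_scalar -scalemxAl.
  rewrite {1 2}QE' mulmxDl !mulmxDr E2 !mul_scalar_mx !mul_mx_scalar.
  have -> : mu *m w = Q - b%:M by rewrite QE' addrC addKr.
  apply/matrixP => i k; rewrite !mxE; case: (i == k); rewrite ?mulr1n ?mulr0n; ring.
have tr3 : (2 < m)%N -> mxtrace (Q *m Q) = m%:R * (m%:R - 1) * b ^+ 2.
  move=> m2; rewrite sq3 // mxtraceD mxtraceZ trQ mxtrace_scalar mulr0 add0r.
  by rewrite -mulr_natr; ring.
have expand : (Q + d%:M) *m (Q + d%:M) = Q *m Q + (2 * d) *: Q + (d ^+ 2)%:M.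
  rewrite mulmxDl !mulmxDr !mul_scalar_mx !mul_mx_scalar.
  by apply/matrixP => i k; rewrite !mxE; case: (i == k); rewrite ?mulr1n ?mulr0n; ring.
split=> //; rewrite expand.
move: m1; rewrite leq_eqVlt => /orP[/eqP m2|m2].
  have mR : m%:R = 2 :> R by rewrite -m2.
  have d0 : d = 0 by rewrite /d mR subrr !mul0r.
  rewrite d0 mulr0 scale0r expr0n /= addr0 raddf0 addr0.
  rewrite (traceless2_sq (esym m2) trQ) mxtrace_scalar mR -(mulr_natr _ m) mR.
  by congr (_%:M); field.
rewrite tr3 // sq3 //; apply/matrixP => i k.
by rewrite !mxE; case: (i == k); rewrite ?mulr1n ?mulr0n /d; field.
Qed.

(** Column i of A times row j of B, antisymmetrized in i and j: the shape of each term of the Gauss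
    equation. Left products act on A alone and right products on B alone. *)
Definition wedge (i j : 'I_m) (A B : 'M[R]_m) : 'M[R]_m :=
  \matrix_(q, r) (A q i * B j r - A q j * B i r).

Lemma wedgeE i j A B q r :
  wedge i j A B q r = A q i * B j r - A q j * B i r.
Proof. by rewrite mxE. Qed.

Lemma wedgeZl i j c A B : wedge i j (c *: A) B = c *: wedge i j A B.
Proof. by apply/matrixP => q r; rewrite [RHS]mxE !wedgeE !mxE; ring. Qed.

Lemma wedgeZr i j c A B : wedge i j A (c *: B) = c *: wedge i j A B.
Proof. by apply/matrixP => q r; rewrite [RHS]mxE !wedgeE !mxE; ring. Qed.

Lemma mulmx_wedge i j P A B : P *m wedge i j A B = wedge i j (P *m A) B.
Proof.
apply/matrixP => q r; rewrite wedgeE !mxE !mulr_suml -sumrB.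
by apply: eq_bigr => p _; rewrite wedgeE; ring.
Qed.

Lemma wedge_mulmx i j P A B : wedge i j A B *m P = wedge i j A (B *m P).
Proof.
apply/matrixP => q r; rewrite wedgeE !mxE !mulr_sumr -sumrB.
by apply: eq_bigr => p _; rewrite wedgeE; ring.
Qed.

(** Rewrites the right-hand side of the Gauss equation in terms of k = h + d g, whose square with
    respect to g is a multiple of g. *)
Lemma wedge_gauss i j (g k a h : 'M[R]_m) (l u e d : R) :
  a = (l - u * e * d) *: g + (u * e) *: k -> h = k - d *: g ->
  wedge i j g a + wedge i j a g + e *: wedge i j h h =
  (2 * (l - u * e * d) + e * d ^+ 2) *: wedge i j g g +
  (u * e - e * d) *: (wedge i j g k + wedge i j k g) + e *: wedge i j k k.
Proof. by move=> -> ->; apply/matrixP => p q; rewrite !mxE; ring. Qed.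

(** In k R + R^T k the terms with c2 cancel, and the square of k turns the term in k, k into one in
    g, g. There remains (c1 - e kap) times the difference of the wedges of (k, g) and (g, k); raise
    indices and contract. *)
Lemma parallel_curvature (g k : 'M[R]_m) (Rm : 'I_m -> 'I_m -> 'M[R]_m)
    (c1 c2 e kap : R) :
  g^T = g -> k^T = k -> g \in unitmx -> k *m invmx g *m k = kap *: g ->
  (forall i j, g *m Rm i j = c1 *: wedge i j g g +
     c2 *: (wedge i j g k + wedge i j k g) + e *: wedge i j k k) ->
  (forall i j, k *m Rm i j + (Rm i j)^T *m k = 0) ->
  (c1 - e * kap) *: (m%:R *: (invmx g *m k) - (mxtrace (invmx g *m k))%:M) = 0.
Proof.
move=> gT kT ug kk gR par; set K := invmx g *m k; set c := c1 - e * kap.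
have giT : (invmx g)^T = invmx g by rewrite trmx_inv gT.
have KT : K^T = k *m invmx g by rewrite /K trmx_mul kT giT.
have gK : g *m K = k by rewrite /K mulKVmx.
have kK : k *m K = kap *: g by rewrite /K mulmxA.
have KTg : K^T *m g = k by rewrite KT mulmxKV.
have KTk : K^T *m k = kap *: g by rewrite KT.
have comm i j : c *: wedge i j K 1%:M = c *: wedge i j 1%:M K^T.
  have kR : k *m Rm i j = c1 *: wedge i j k g +
      c2 *: (wedge i j k k + kap *: wedge i j g g) + (e * kap) *: wedge i j g k.
    have -> : k *m Rm i j = K^T *m (g *m Rm i j) by rewrite mulmxA KTg.
    rewrite gR !mulmxDr -!scalemxAr !mulmxDr !mulmx_wedge KTg KTk !wedgeZl.
    by rewrite scalerA.
  have gRT : (g *m Rm i j)^T = - (c1 *: wedge i j g g +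
      c2 *: (wedge i j k g + wedge i j g k) + e *: wedge i j k k).
    have gE a b : g a b = g b a by rewrite -{1}gT mxE.
    have kE a b : k a b = k b a by rewrite -{1}kT mxE.
    apply/matrixP => a b; rewrite gR !mxE.
    by rewrite (gE b) (gE b j) (kE b) (kE b j) (gE a) (gE a j) (kE a) (kE a j); ring.
  have RTk : (Rm i j)^T *m k = - (c1 *: wedge i j g k +
      c2 *: (wedge i j k k + kap *: wedge i j g g) + (e * kap) *: wedge i j k g).
    have -> : (Rm i j)^T *m k = (g *m Rm i j)^T *m K by rewrite trmx_mul gT -mulmxA gK.
    rewrite gRT mulNmx !mulmxDl -!scalemxAl !mulmxDl !wedge_mulmx gK kK !wedgeZr.
    by rewrite scalerA.
  have {}E : c *: wedge i j k g = c *: wedge i j g k.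
    have := par i j; rewrite kR RTk => /matrixP E; apply/matrixP => a b.
    by have := E a b; rewrite !mxE /c; lra.
  have -> : wedge i j K 1%:M = invmx g *m wedge i j k g *m invmx g.
    by rewrite mulmx_wedge wedge_mulmx mulmxV.
  have -> : wedge i j 1%:M K^T = invmx g *m wedge i j g k *m invmx g.
    by rewrite mulmx_wedge wedge_mulmx mulVmx // KT.
  have : invmx g *m (c *: wedge i j k g) *m invmx g =
         invmx g *m (c *: wedge i j g k) *m invmx g by rewrite E.
  by rewrite -!scalemxAr -!scalemxAl.
clearbody K c; apply/matrixP => r j; rewrite [RHS]mxE.
(* The contraction: the row index is set equal to i and summed. *)
have : \sum_i (c *: wedge i j K 1%:M) i r = \sum_i (c *: wedge i j 1%:M K^T) i r.
  by apply: eq_bigr => i _; rewrite comm.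
under eq_bigr do rewrite mxE wedgeE.
under [in RHS]eq_bigr do rewrite mxE wedgeE.
rewrite -!mulr_sumr !sumrB.
have -> : \sum_i K i i * 1%:M j r = mxtrace K * (j == r)%:R.
  by rewrite -mulr_suml; congr (_ * _); rewrite mxE.
have -> : \sum_i K i j * (1%:M : 'M[R]_m) i r = K r j.
  rewrite (bigD1 r) //= mxE eqxx mulr1 big1 ?addr0 // => i ir.
  by rewrite mxE (negPf ir) mulr0.
have -> : \sum_i (1%:M : 'M[R]_m) i i * K^T j r = m%:R * K r j.
  rewrite -mulr_suml mxE; congr (_ * _).
  under eq_bigr do rewrite mxE eqxx.
  by rewrite sumr_const card_ord.
have -> : \sum_i (1%:M : 'M[R]_m) i j * K^T i r = K r j.
  rewrite (bigD1 j) //= [1%:M _ _]mxE eqxx mul1r mxE big1 ?addr0 // => i ij.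
  by rewrite mxE (negPf ij) mul0r.
rewrite !mxE -[mxtrace K *+ _]mulr_natr [r == j]eq_sym => E.
lra.
Qed.

End Algebra.

(** * Codazzi tensors with a constant square *)

Section ParallelTensor.
Variables (R : realType) (m : nat) (D : set 'rV[R]_m) (oD : open D).
Variables (g k : 'rV[R]_m -> 'M[R]_m) (Gam : 'I_m -> 'rV[R]_m -> 'M[R]_m).
Variable kap : 'rV[R]_m -> R.
Hypotheses (sg : msm D g) (sk : msm D k) (sG : forall i, msm D (Gam i)).
Hypothesis skap : sms D kap.
Hypothesis ug : forall z, D z -> g z \in unitmx.
Hypotheses (gT : forall z, D z -> (g z)^T = g z) (kT : forall z, D z -> (k z)^T = k z).
Hypothesis dg : forall i z, D z -> mpd i g z = (Gam i z)^T *m g z + g z *m Gam i z.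

(** The covariant derivative of k along coordinate i; the columns of [Gam i] hold the Christoffel
    symbols, and [dg] says that g is parallel. *)
Let S i z := mpd i k z - ((Gam i z)^T *m k z + k z *m Gam i z).

Hypothesis S12 : forall i j p z, D z -> S i z j p = S j z i p.
Hypothesis kk : forall z, D z -> k z *m invmx (g z) *m k z = kap z *: g z.
Hypothesis dkap : forall i z, D z -> ds i kap z = 0.
Hypothesis kap0 : forall z, D z -> kap z != 0.

Let K z := invmx (g z) *m k z.

Lemma msm_K : msm D K.
Proof.
apply: (msm_mul oD) => //; move=> i j; apply: sms_gram => //.
Qed.

Lemma S_sym i z : D z -> (S i z)^T = S i z.
Proof.
move=> Dz; rewrite /S linearB linearD /= !trmx_mul trmxK (kT Dz) [k z *m _ + _]addrC.
congr (_ - _); rewrite -(mpd_tr z k i); apply: (mpd_on oD Dz) => y Dy; exact: kT.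
Qed.

(** The covariant derivative of k K = kap g, where K = g^-1 k, is S K + K^T S = 0. With the total
    symmetry of S this forces S = 0. *)
Lemma parallel i z : D z -> mpd i k z = (Gam i z)^T *m k z + k z *m Gam i z.
Proof.
move=> Dz; suff : S i z = 0 by move/eqP; rewrite subr_eq0 => /eqP.
have gK y : D y -> g y *m K y = k y by move=> Dy; rewrite mulKVmx ?ug.
have kK y : D y -> k y *m K y = kap y *: g y by move=> Dy; rewrite mulmxA kk.
have KTg y : D y -> (K y)^T *m g y = k y.
  by move=> Dy; rewrite trmx_mul trmx_inv (gT Dy) (kT Dy) mulmxKV ?ug.
have KTk y : D y -> (K y)^T *m k y = kap y *: g y.
  by move=> Dy; rewrite trmx_mul trmx_inv (gT Dy) (kT Dy) kk.
have uK : K z \in unitmx.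
  have : kap z *: g z \in unitmx by rewrite unitmxZ ?ug // unitfE kap0.
  by rewrite -(kK _ Dz) unitmx_mul => /andP[].
apply: (symmetric_anticommuting_eq0 (K := K z) (S := fun i => S i z)) => //.
- by move=> a b c; exact: S12.
- by move=> a b c; rewrite -{1}(S_sym a Dz) mxE.
move=> {}i.
have sK := msm_K.
(* Differentiate k K = kap g and g K = k, then eliminate the derivative of K. *)
have E1 : mpd i k z *m K z + k z *m mpd i K z = kap z *: mpd i g z.
  rewrite -(mpd_mul oD Dz i sk sK) (mpd_on oD Dz i kK) (mpdZ Dz) //.
  by rewrite dkap // scale0r add0r.
have E2 : mpd i g z *m K z + g z *m mpd i K z = mpd i k z.
  by rewrite -(mpd_mul oD Dz i sg sK) (mpd_on oD Dz i gK).
have E3 : k z *m mpd i K z = (K z)^T *m (mpd i k z - mpd i g z *m K z).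
  by rewrite -E2 addrAC subrr add0r mulmxA KTg.
have E4 : mpd i k z *m K z + (K z)^T *m mpd i k z =
    (K z)^T *m (Gam i z)^T *m k z + k z *m Gam i z *m K z + kap z *: mpd i g z.
  have -> : (K z)^T *m (Gam i z)^T *m k z + k z *m Gam i z *m K z =
      (K z)^T *m (mpd i g z *m K z).
    rewrite dg // mulmxDl mulmxDr -!mulmxA gK // !mulmxA KTg //.
  rewrite -E1 E3 mulmxBr; apply/matrixP => p q; rewrite !mxE; lra.
have E5 : S i z *m K z + (K z)^T *m S i z = mpd i k z *m K z + (K z)^T *m mpd i k z
    - ((K z)^T *m (Gam i z)^T *m k z + k z *m Gam i z *m K z + kap z *: mpd i g z).
  have F1 : S i z *m K z = mpd i k z *m K z -
      (kap z *: ((Gam i z)^T *m g z) + k z *m Gam i z *m K z).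
    by rewrite mulmxBl mulmxDl -[_ *m k z *m _]mulmxA kK // -scalemxAr.
  have F2 : (K z)^T *m S i z = (K z)^T *m mpd i k z -
      ((K z)^T *m (Gam i z)^T *m k z + kap z *: (g z *m Gam i z)).
    by rewrite mulmxBr mulmxDr !mulmxA KTk // -scalemxAl.
  rewrite F1 F2 dg // scalerDr.
  move: (mpd i k z *m K z) ((K z)^T *m mpd i k z) => M1 M2.
  move: (kap z *: _) (k z *m _ *m K z) (_ *m k z) (kap z *: _) => M3 M4 M5 M6.
  by apply/matrixP => p q; rewrite !mxE; lra.
by rewrite E5 E4 subrr.
Qed.

(** Differentiate the equation of parallelism once more and compare the mixed second derivatives of
    k; what survives is the Ricci identity. *)
Lemma parallel_curv i j z (Rm : 'M[R]_m) : D z ->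
  Rm = mpd i (Gam j) z - mpd j (Gam i) z + (Gam i z *m Gam j z - Gam j z *m Gam i z) ->
  k z *m Rm + Rm^T *m k z = 0.
Proof.
move=> Dz ->.
have E p q : mpd p (mpd q k) z =
    (mpd p (Gam q) z)^T *m k z + (Gam q z)^T *m ((Gam p z)^T *m k z + k z *m Gam p z)
    + (((Gam p z)^T *m k z + k z *m Gam p z) *m Gam q z + k z *m mpd p (Gam q) z).
  have sGT := msm_tr (sG q).
  rewrite (mpd_on oD Dz p (fun y Dy => parallel q Dy)).
  rewrite (mpdD Dz); [|exact: msm_mul|exact: msm_mul].
  by rewrite !(mpd_mul oD Dz) // mpd_tr parallel.
have := mpd_schwarz oD Dz i j sk; rewrite !E.
have trE (A B C E' : 'M[R]_m) : (A - B + (C - E'))^T = A^T - B^T + (C^T - E'^T).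
  by apply/matrixP => p q; rewrite !mxE.
rewrite trE !trmx_mul.
move: (mpd i (Gam j) z) (mpd j (Gam i) z) (Gam i z) (Gam j z) (k z) => A B G1 G2 kz.
rewrite !(mulmxDl, mulmxDr, mulNmx, mulmxN) !mulmxA => /matrixP H.
apply/matrixP => p q; have := H p q.
move: (A^T *m kz) (B^T *m kz) (kz *m A) (kz *m B) => M1 M2 M3 M4.
move: (G2^T *m G1^T *m kz) (G1^T *m G2^T *m kz) => M5 M6.
move: (kz *m G1 *m G2) (kz *m G2 *m G1) => M7 M8.
move: (G1^T *m kz *m G2) (G2^T *m kz *m G1) => M9 M10.
by rewrite !mxE; lra.
Qed.

End ParallelTensor.

(** * The induced metric of a lift *)

Section ChartMetric.
Variables (R : realType) (m s : nat).
Variables (D : set 'rV[R]_m) (F : 'rV[R]_m -> 'rV[R]_m.+3).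
Hypotheses (oD : open D) (sF : smv D F).
Hypothesis uG : forall z, D z -> lift_gram s F z \in unitmx.

Local Notation "<< a , b >>" := (ip s.+1 a b).
Local Notation g := (lift_gram s F).
Local Notation Gam := (christoffel g).

Let gE z i j : g z i j = <<dv i F z, dv j F z>>.
Proof. exact: lift_gramE. Qed.

Lemma smooth_F1 i : smv D (dv i F).
Proof. exact: smv_dv. Qed.

Lemma smooth_F2 i j : smv D (dv i (dv j F)).
Proof. by apply: smv_dv; exact: smv_dv. Qed.

Lemma g_sym z i j : g z i j = g z j i.
Proof. by rewrite (gE z i j) (gE z j i) ipC. Qed.

Lemma tr_g z : (g z)^T = g z.
Proof. by apply/matrixP => i j; rewrite mxE g_sym. Qed.

Lemma tr_invg z : (invmx (g z))^T = invmx (g z).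
Proof. by rewrite trmx_inv tr_g. Qed.

Lemma mul_invg_g z : D z -> forall i j, \sum_k invmx (g z) i k * g z k j = (i == j)%:R.
Proof. by move=> Dz i j; have /matrixP/(_ i j) := mulVmx (uG Dz); rewrite !mxE. Qed.

Lemma mul_g_invg z : D z -> forall i j, \sum_k g z i k * invmx (g z) k j = (i == j)%:R.
Proof. by move=> Dz i j; have /matrixP/(_ i j) := mulmxV (uG Dz); rewrite !mxE. Qed.

Lemma sum_deltal (I : finType) (T : I -> R) i : \sum_k (i == k)%:R * T k = T i.
Proof.
rewrite (bigD1 i) //= eqxx mul1r big1 ?addr0 // => k ki.
by rewrite eq_sym (negPf ki) mul0r.
Qed.

Lemma smooth_g i j : sms D (fun y => g y i j).
Proof.
have -> : (fun y => g y i j) = fun y => <<dv i F y, dv j F y>>.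
  by apply/funext => y; rewrite gE.
by apply: sms_ip => //; exact: smooth_F1.
Qed.

Lemma smooth_invg i j : sms D (fun y => invmx (g y) i j).
Proof. by apply: sms_gram => //; exact: smooth_g. Qed.

Lemma ds_gentry k i j z : D z -> ds k (gentry g i j) z =
  <<dv k (dv i F) z, dv j F z>> + <<dv i F z, dv k (dv j F) z>>.
Proof.
move=> Dz; have -> : gentry g i j = fun y => <<dv i F y, dv j F y>>.
  by apply/funext => y; rewrite /gentry gE.
by rewrite (ds_ip Dz) //; exact: smooth_F1.
Qed.

(** The ambient space is flat, so derivatives of g are pairings of second with first derivatives of
    F. In the Christoffel combination only the tangential part of [dv i (dv j F)] survives. *)
Lemma christoffelE k i j z : D z ->
  Gam k i j z = \sum_q invmx (g z) k q * <<dv i (dv j F) z, dv q F z>>.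
Proof.
move=> Dz; rewrite christoffel_ds mulr_sumr; apply: eq_bigr => q _.
rewrite mulrCA; congr (_ * _); rewrite !ds_gentry //.
rewrite (dv_schwarz oD Dz j i sF) (dv_schwarz oD Dz q i sF) (dv_schwarz oD Dz q j sF).
by rewrite (ipC s.+1 (dv j F z)) !(ipC s.+1 (dv i F z)); field.
Qed.

Lemma christoffel_low i j q z : D z ->
  \sum_k g z q k * Gam k i j z = <<dv i (dv j F) z, dv q F z>>.
Proof.
move=> Dz; under eq_bigr do rewrite christoffelE // mulr_sumr.
rewrite exchange_big /= -[RHS](sum_deltal (fun p => <<dv i (dv j F) z, dv p F z>>)).
apply: eq_bigr => p _; rewrite -(mul_g_invg Dz) mulr_suml.
by apply: eq_bigr => k _; rewrite mulrA.
Qed.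

Lemma christoffel_sym k i j z : D z -> Gam k i j z = Gam k j i z.
Proof.
move=> Dz; rewrite !christoffelE //; apply: eq_bigr => q _.
by rewrite (dv_schwarz oD Dz i j sF).
Qed.

Lemma smooth_christoffel k i j : sms D (Gam k i j).
Proof.
have E z : D z -> \sum_q invmx (g z) k q * <<dv i (dv j F) z, dv q F z>> = Gam k i j z.
  by move=> Dz; rewrite christoffelE.
apply: (sms_eq oD E); apply: (sms_sum oD) => q; apply: (smsM oD).
  exact: smooth_invg.
by apply: (sms_ip oD); [exact: smooth_F2|exact: smooth_F1].
Qed.

Lemma smooth_laplacian : smv D (lift_laplacian s F).
Proof.
have -> : lift_laplacian s F = fun z => \sum_i \sum_j invmx (g z) i j *:
    (dv i (dv j F) z - \sum_k Gam k i j z *: dv k F z).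
  by apply/funext => z; exact: lift_laplacian_dv.
apply: (smv_sum oD) => i; apply: (smv_sum oD) => j.
apply: (smvZ oD); first exact: smooth_invg.
apply: (smvB oD); first exact: smooth_F2.
apply: (smv_sum oD) => k; apply: (smvZ oD); last exact: smooth_F1.
exact: smooth_christoffel.
Qed.

Lemma smooth_N : smv D (conf_N s F).
Proof.
apply: (smvB oD).
  apply: (smvN oD); apply: (smvZ oD); first exact: sms_cst.
  exact: smooth_laplacian.
apply: (smvZ oD) => //; apply: (smsM oD); first exact: sms_cst.
by apply: (sms_ip oD); exact: smooth_laplacian.
Qed.

Hypothesis FF : forall z, D z -> <<F z, F z>> = 0.

Lemma dv_ip_on (A B : 'rV[R]_m -> 'rV[R]_m.+3) (c : R) i z :
  smv D A -> smv D B -> (forall y, D y -> <<A y, B y>> = c) -> D z ->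
  <<dv i A z, B z>> + <<A z, dv i B z>> = 0.
Proof.
by move=> sA sB E Dz; rewrite -(ds_ip Dz) // (ds_on oD i Dz E) ds_cst.
Qed.

Lemma lift_tangent i z : D z -> <<F z, dv i F z>> = 0.
Proof.
move=> Dz; have := dv_ip_on i sF sF FF Dz; rewrite (ipC _ (dv i F z)); lra.
Qed.

Lemma lift_dv2 i j z : D z -> <<dv i (dv j F) z, F z>> = - g z i j.
Proof.
move=> Dz; have := dv_ip_on i sF (smooth_F1 j) (lift_tangent j) Dz.
rewrite -gE (ipC _ (F z)); lra.
Qed.

Lemma laplacian_lift z : D z -> <<lift_laplacian s F z, F z>> = - m%:R.
Proof.
move=> Dz; rewrite lift_laplacian_dv ip_suml.
transitivity (- \sum_(i < m) (\sum_j invmx (g z) i j * g z j i)).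
  rewrite -sumrN; apply: eq_bigr => i _; rewrite ip_suml -sumrN.
  apply: eq_bigr => j _; rewrite ipZl ipBl lift_dv2 // ip_suml big1 => [|k _].
    by rewrite subr0 mulrN (g_sym _ i j).
  by rewrite ipZl ipC lift_tangent // mulr0.
under eq_bigr do rewrite (mul_invg_g Dz) eqxx.
by rewrite sumr_const card_ord.
Qed.

Lemma christoffel_lowr i j q z : D z ->
  \sum_k Gam k i j z * g z k q = <<dv i (dv j F) z, dv q F z>>.
Proof.
move=> Dz; rewrite -christoffel_low //; apply: eq_bigr => k _.
by rewrite mulrC g_sym.
Qed.

(** The Hessian of F has no tangential part, because the Christoffel terms remove it. *)
Lemma laplacian_tangent q z : D z -> <<lift_laplacian s F z, dv q F z>> = 0.
Proof.
move=> Dz; rewrite lift_laplacian_dv ip_suml big1 // => i _.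
rewrite ip_suml big1 // => j _; rewrite ipZl ipBl ip_suml.
under eq_bigr do rewrite ipZl -gE.
by rewrite christoffel_lowr // subrr mulr0.
Qed.

Hypothesis m0 : (0 < m)%N.

Let mR0 : m%:R != 0 :> R.
Proof. by rewrite pnatr_eq0 -lt0n. Qed.

Lemma confN_lift z : D z -> <<conf_N s F z, F z>> = 1.
Proof.
move=> Dz; rewrite /conf_N ipBl ipNl !ipZl laplacian_lift // FF //; field.
exact: mR0.
Qed.

Lemma confN_null z : D z -> <<conf_N s F z, conf_N s F z>> = 0.
Proof.
move=> Dz; rewrite /conf_N !(ipBl, ipBr, ipNl, ipNr, ipZl, ipZr).
rewrite (ipC _ (F z)) laplacian_lift // FF //; field.
exact: mR0.
Qed.

Lemma confN_tangent i z : D z -> <<conf_N s F z, dv i F z>> = 0.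
Proof.
move=> Dz; rewrite /conf_N ipBl ipNl !ipZl laplacian_tangent // lift_tangent //; ring.
Qed.

Lemma laplacian_confN z : D z -> <<lift_laplacian s F z, conf_N s F z>> =
  - (<<lift_laplacian s F z, lift_laplacian s F z>> / (2 * m%:R)).
Proof.
move=> Dz; rewrite /conf_N !(ipBr, ipNr, ipZr) laplacian_lift //; field.
exact: mR0.
Qed.

End ChartMetric.

(** * Para-umbilical lifts in a chart *)

Section Umbilic.
Variables (R : realType) (m s : nat).
Variables (D : set 'rV[R]_m) (F X N : 'rV[R]_m -> 'rV[R]_m.+3) (l u : 'rV[R]_m -> R).
Hypotheses (oD : open D) (sF : smv D F) (sX : smv D X) (sl : sms D l) (su : sms D u).
Hypothesis uG : forall z, D z -> lift_gram s F z \in unitmx.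

Local Notation "<< a , b >>" := (ip s.+1 a b).
Local Notation g := (lift_gram s F).
Local Notation Gam := (christoffel g).
Local Notation e := (fun z => <<X z, X z>>).
Local Notation h := (fun i j z => <<dv i (dv j F) z, X z>>).
Local Notation a := (fun i j z => <<dv j N z, dv i F z>>).

(* a variable, so that rewriting does not unfold [conf_N] *)
Hypothesis NE : N = conf_N s F.
Hypothesis FF : forall z, D z -> <<F z, F z>> = 0.
Hypothesis m1 : (1 < m)%N.
Hypothesis hn : forall z, D z -> is_unit_normal s F X z.
Hypothesis hPhi : forall z, D z -> forall v, conf_Phi s F X z v = 0.
Hypothesis hA : forall z, D z ->
  conf_A s F z = (l z)%:M + u z *: conf_B s F X z.

Let m0 : (0 < m)%N := ltnW m1.

Let mR0 : m%:R != 0 :> R.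
Proof. by rewrite pnatr_eq0 -lt0n. Qed.

Let sF1 i : smv D (dv i F). Proof. exact: smv_dv. Qed.
Let sF2 i j : smv D (dv i (dv j F)). Proof. by apply: smv_dv; exact: smv_dv. Qed.
Let sN : smv D N. Proof. by rewrite NE; exact: smooth_N. Qed.
Let FF1' i z : D z -> <<F z, dv i F z>> = 0. Proof. exact: lift_tangent. Qed.
Let NF' z : D z -> <<N z, F z>> = 1. Proof. by rewrite NE; exact: confN_lift. Qed.
Let NN' z : D z -> <<N z, N z>> = 0. Proof. by rewrite NE; exact: confN_null. Qed.
Let NF1' i z : D z -> <<N z, dv i F z>> = 0. Proof. by rewrite NE; exact: confN_tangent. Qed.
Let gE z i j : g z i j = <<dv i F z, dv j F z>>. Proof. exact: lift_gramE. Qed.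

Lemma sq_e z : D z -> e z ^+ 2 = 1.
Proof.
by move=> Dz; have [[-> |->] _ _ _] := is_unit_normal_dv (hn Dz);
  rewrite ?sqrrN expr1n.
Qed.

Lemma e_neq0 z : D z -> e z != 0.
Proof.
move=> Dz; have := sq_e Dz; apply: contra_eq_neq => /= ->.
by rewrite expr0n eq_sym oner_neq0.
Qed.

Lemma smooth_e : sms D e. Proof. exact: (sms_ip oD). Qed.

Lemma ds_e i z : D z -> ds i e z = 0.
Proof.
move=> Dz; apply: (ds_sqr0 oD Dz smooth_e (e_neq0 Dz) _ (ds_cst _ 1 i)).
by move=> y Dy; rewrite -expr2 sq_e.
Qed.

Lemma normal_lift z : D z -> <<X z, F z>> = 0.
Proof. by move=> Dz; case: (is_unit_normal_dv (hn Dz)). Qed.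

Lemma normal_confN z : D z -> <<X z, N z>> = 0.
Proof. by rewrite NE; move=> Dz; case: (is_unit_normal_dv (hn Dz)). Qed.

Lemma normal_tangent i z : D z -> <<X z, dv i F z>> = 0.
Proof. by move=> Dz; case: (is_unit_normal_dv (hn Dz)) => _ _ _; apply. Qed.

Lemma complete z w : D z -> <<w, F z>> = 0 -> <<w, N z>> = 0 -> <<w, X z>> = 0 ->
  (forall i, <<w, dv i F z>> = 0) -> w = 0.
Proof.
move=> Dz; apply: (@frame_complete _ _ _ (F z) (N z) (X z) (fun i => dv i F z) (g z)).
- exact: FF.
- by rewrite ipC NF'.
- exact: NN'.
- exact: normal_lift.
- exact: normal_confN.
- exact: e_neq0.
- by move=> i; exact: FF1'.
- by move=> i; exact: NF1'.
- by move=> i; exact: normal_tangent.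
- by move=> i j; rewrite gE.
- exact: uG.
Qed.

(** * Structure equations of the frame F, N, xi, dF *)

Lemma dvN_F i z : D z -> <<dv i N z, F z>> = 0.
Proof.
by move=> Dz; have := dv_ip_on oD i sN sF NF' Dz; rewrite NF1' // addr0.
Qed.

Lemma dvN_N i z : D z -> <<dv i N z, N z>> = 0.
Proof.
by move=> Dz; have := dv_ip_on oD i sN sN NN' Dz; rewrite (ipC _ (N z)); lra.
Qed.

Lemma dvN_X i z : D z -> <<dv i N z, X z>> = 0.
Proof.
move=> Dz; have := hPhi Dz (delta_mx 0 i); rewrite /conf_Phi.
rewrite (bigD1 i) //= big1 ?addr0 => [|k /negPf ki]; last first.
  by rewrite mxE ki andbF mulr0.
rewrite mxE !eqxx mulr1 conf_C_dv -NE => /(congr1 (fun w => <<w, X z>>)).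
rewrite ip0l ipZl => /eqP; rewrite !mulf_eq0 !(negPf (e_neq0 Dz)) /= orbF.
by move/eqP.
Qed.

Lemma dvN_F1 i j z : D z -> <<dv i N z, dv j F z>> = - <<N z, dv i (dv j F) z>>.
Proof.
move=> Dz; have := dv_ip_on oD i sN (sF1 j) (NF1' j) Dz; lra.
Qed.

Lemma dvX_X i z : D z -> <<dv i X z, X z>> = 0.
Proof.
move=> Dz; have := ds_e i Dz; rewrite (ds_ip Dz) // (ipC _ (X z) (dv i X z)); lra.
Qed.

Lemma dvX_F i z : D z -> <<dv i X z, F z>> = 0.
Proof. by move=> Dz; have := dv_ip_on oD i sX sF normal_lift Dz; rewrite normal_tangent // addr0. Qed.

Lemma dvX_N i z : D z -> <<dv i X z, N z>> = 0.
Proof.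
by move=> Dz; have := dv_ip_on oD i sX sN normal_confN Dz; rewrite (ipC _ (X z)) dvN_X // addr0.
Qed.

Lemma dvX_F1 i j z : D z -> <<dv i X z, dv j F z>> = - h i j z.
Proof.
move=> Dz; have := dv_ip_on oD i sX (sF1 j) (normal_tangent j) Dz.
rewrite /= (ipC _ (X z)); lra.
Qed.

Lemma h_sym i j z : D z -> h i j z = h j i z.
Proof. by move=> Dz; rewrite /= (dv_schwarz oD Dz i j sF). Qed.

Lemma a_formula i j z : D z -> a i j z = l z * g z i j + u z * e z * h i j z.
Proof.
move=> Dz; have /(congr1 (mulmx (g z))) := hA Dz.
rewrite conf_A_dv conf_B_dv -NE mulmxDr -scalemxAr !mulKVmx ?uG // mul_mx_scalar.
move=> /matrixP/(_ i j); rewrite mxE => -> /=.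
rewrite 5!mxE (h_sym i j Dz) /=; ring.
Qed.

Lemma a_sym i j z : D z -> a i j z = a j i z.
Proof.
move=> Dz; have := a_formula i j Dz; have := a_formula j i Dz.
by rewrite (g_sym s F z j i) (h_sym j i Dz) /= => -> ->.
Qed.

(** Both sides are orthogonal to F, N and X, and their tangential parts agree by [a_formula]. *)
Lemma dvN_formula i z : D z ->
  dv i N z = l z *: dv i F z - (e z * u z) *: dv i X z.
Proof.
move=> Dz; apply/eqP; rewrite -subr_eq0 opprB addrA; apply/eqP.
apply: (complete Dz).
- by rewrite ipBl ipDl !ipZl dvN_F // dvX_F // (ipC _ _ (F z)) FF1' // !mulr0 addr0 subr0.
- by rewrite ipBl ipDl !ipZl dvN_N // dvX_N // (ipC _ _ (N z)) NF1' // !mulr0 addr0 subr0.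
- by rewrite ipBl ipDl !ipZl dvN_X // dvX_X // (ipC _ _ (X z)) normal_tangent // !mulr0 addr0 subr0.
move=> j; rewrite ipBl ipDl !ipZl dvX_F1 // -gE.
have := a_formula j i Dz; rewrite /= => ->.
rewrite (g_sym s F z j i) (h_sym j i Dz) /=; ring.
Qed.

(* The symmetry of the second derivatives of N. *)
Lemma ds_relation i j k z : D z ->
  ds j l z * g z i k + e z * ds j u z * h i k z =
  ds i l z * g z j k + e z * ds i u z * h j k z.
Proof.
(* Pairing with a vector frozen at z leaves only scalar functions to differentiate. *)
move=> Dz; pose w := dv k F z.
have key p q : <<dv q (dv p N) z, w>> =
    ds q l z * g z p k + l z * <<dv q (dv p F) z, w>> +
    e z * ds q u z * h p k z - e z * u z * <<dv q (dv p X) z, w>>.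
  rewrite -(ds_ipl Dz); last exact: smv_dv.
  have E y : D y -> <<dv p N y, w>> = l y * <<dv p F y, w>> - e y * u y * <<dv p X y, w>>.
    by move=> Dy; rewrite dvN_formula // ipBl !ipZl.
  have s1 : sms D (fun y => <<dv p F y, w>>) by apply: (sms_ip oD) => //; exact: smv_cst.
  have s2 : sms D (fun y => <<dv p X y, w>>).
    by apply: (sms_ip oD); [exact: smv_dv|exact: smv_cst].
  have s3 : sms D (fun y => e y * u y) by apply: (smsM oD) => //; exact: smooth_e.
  rewrite (ds_on oD q Dz E) (dsB Dz); [|exact: (smsM oD)|exact: (smsM oD)].
  rewrite (dsM Dz) // (dsM Dz) // (dsM Dz) //; last exact: smooth_e.
  rewrite ds_e // mul0r add0r (ds_ipl Dz) // (ds_ipl Dz); last exact: smv_dv.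
  rewrite {1 5}/w dvX_F1 // -gE /=; ring.
have := key i j; have := key j i.
rewrite (dv_schwarz oD Dz i j sN) (dv_schwarz oD Dz i j sF) (dv_schwarz oD Dz i j sX).
lra.
Qed.

(** As F and N are null with <F, N> = 1, the coefficient of F is read off by pairing with N, and
    that of N by pairing with F. *)
Lemma dv2_formula i j z : D z -> dv i (dv j F) z =
  \sum_k Gam k i j z *: dv k F z - a i j z *: F z - g z i j *: N z
  + (e z * h i j z) *: X z.
Proof.
move=> Dz; apply/eqP; rewrite -subr_eq0; apply/eqP.
have sumE w : <<\sum_k Gam k i j z *: dv k F z, w>> = \sum_k Gam k i j z * <<dv k F z, w>>.
  by rewrite ip_suml; apply: eq_bigr => k _; rewrite ipZl.
have sum0 w : (forall k, <<w, dv k F z>> = 0) -> \sum_k Gam k i j z * <<dv k F z, w>> = 0.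
  by move=> w0; rewrite big1 // => k _; rewrite ipC w0 mulr0.
apply: (complete Dz); rewrite ?(ipDl, ipNl, ipZl).
- rewrite sumE sum0 => [|k]; last exact: FF1'.
  by rewrite (lift_dv2 oD sF FF i j Dz) FF // NF' // normal_lift // !mulr0; ring.
- rewrite sumE sum0 => [|k]; last exact: NF1'.
  rewrite (ipC _ (F z)) NF' // NN' // normal_confN //= (a_sym i j Dz) /= dvN_F1 //.
  by rewrite (ipC _ (N z)) !mulr0; ring.
- rewrite sumE sum0 => [|k]; last exact: normal_tangent.
  rewrite (ipC _ (F z)) normal_lift // (ipC _ (N z)) normal_confN // mulrAC -expr2 sq_e //.
  by rewrite !mulr0; ring.
move=> q; rewrite !(ipDl, ipNl, ipZl) sumE FF1' // NF1' // normal_tangent //.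
under eq_bigr do rewrite -gE.
rewrite (christoffel_lowr oD sF uG i j q Dz) !mulr0; ring.
Qed.

(** * Gauss equation in matrix form *)

Definition hmx z : 'M[R]_m := \matrix_(i, j) h i j z.
Definition amx z : 'M[R]_m := \matrix_(i, j) a i j z.
Definition cmx i z : 'M[R]_m := \matrix_(p, q) Gam p i q z.
Definition curv i j z : 'M[R]_m := \matrix_(p, k) riemann g p k i j z.

Lemma ds_h i j k z : D z ->
  ds i (h j k) z = <<dv i (dv j (dv k F)) z, X z>> - \sum_p Gam p j k z * h i p z.
Proof.
move=> Dz; rewrite (ds_ip Dz) //; congr (_ + _).
rewrite [in LHS]dv2_formula // !(ipDl, ipNl, ipZl) ip_suml.
rewrite (ipC _ (F z)) (ipC _ (N z)) (ipC _ (X z)) dvX_F // dvX_N // dvX_X //.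
rewrite !mulr0 !subr0 addr0 -sumrN; apply: eq_bigr => p _.
by rewrite ipZl ipC dvX_F1 // mulrN.
Qed.

Lemma dv3_sym i j k z : D z ->
  dv i (dv j (dv k F)) z = dv j (dv i (dv k F)) z.
Proof. by move=> Dz; rewrite (dv_schwarz oD Dz i j (sF1 k)). Qed.

(* The decomposition of the second derivatives is paired with the constant vector w
   before differentiating, so that only scalar functions are differentiated. *)
Lemma gauss_dv3 i j k q z : D z -> <<dv i (dv j (dv k F)) z, dv q F z>> =
  \sum_p g z q p * (ds i (Gam p j k) z + \sum_r Gam p i r z * Gam r j k z)
  - a j k z * g z i q - g z j k * a q i z - e z * h j k z * h i q z.
Proof.
move=> Dz; pose w := dv q F z.
rewrite -/w -(ds_ipl Dz) //.
have E y : D y -> <<dv j (dv k F) y, w>> =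
    \sum_p Gam p j k y * <<dv p F y, w>> - a j k y * <<F y, w>>
    - g y j k * <<N y, w>> + e y * h j k y * <<X y, w>>.
  move=> Dy; rewrite [in LHS]dv2_formula // !(ipDl, ipNl, ipZl) ip_suml.
  by congr (_ - _ - _ + _); apply: eq_bigr => p _; rewrite ipZl.
have sG p i' j' : sms D (Gam p i' j') by exact: smooth_christoffel.
have sw (H : 'rV[R]_m -> 'rV[R]_m.+3) : smv D H -> sms D (fun y => <<H y, w>>).
  by move=> sH; apply: (sms_ip oD) => //; exact: smv_cst.
have sa : sms D (a j k) by apply: (sms_ip oD) => //; exact: smv_dv.
have sg : sms D (fun y => g y j k) by exact: smooth_g.
have sh : sms D (fun y => e y * h j k y).
  by apply: (smsM oD); [exact: smooth_e|exact: (sms_ip oD)].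
have s1 : sms D (fun y => \sum_p Gam p j k y * <<dv p F y, w>>).
  by apply: (sms_sum oD) => p; apply: (smsM oD) => //; exact: sw.
have s2 : sms D (fun y => a j k y * <<F y, w>>) by apply: (smsM oD) => //; exact: sw.
have s3 : sms D (fun y => g y j k * <<N y, w>>) by apply: (smsM oD) => //; exact: sw.
have s4 : sms D (fun y => e y * h j k y * <<X y, w>>).
  by apply: (smsM oD) => //; exact: sw.
have s12 := smsB oD s1 s2; have s123 := smsB oD s12 s3.
rewrite (ds_on oD i Dz E) (dsD Dz) // (dsB Dz) // (dsB Dz) //.
rewrite (ds_sum Dz) => [|p]; last by apply: (smsM oD) => //; exact: sw.
rewrite (dsM Dz) //; last exact: sw.
rewrite (dsM Dz) //; last exact: sw.
rewrite (dsM Dz) //; last exact: sw.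
rewrite !(ds_ipl Dz) // [in <<F z, w>>]/w [in <<N z, w>>]/w [in <<X z, w>>]/w.
rewrite FF1' // NF1' // normal_tangent // !mulr0 !add0r.
rewrite [in <<dv i X z, w>>]/w dvX_F1 // [in <<dv i F z, w>>]/w -gE.
have -> : \sum_p ds i (fun y => Gam p j k y * <<dv p F y, w>>) z =
  \sum_p g z q p * (ds i (Gam p j k) z + \sum_r Gam p i r z * Gam r j k z).
  under eq_bigr => p _.
    rewrite (dsM Dz) //; last exact: sw.
    rewrite (ds_ipl Dz) // -[<<dv i (dv p F) z, w>>](christoffel_low oD sF uG) //.
    over.
  rewrite big_split /=.
  under [RHS]eq_bigr do rewrite mulrDr.
  rewrite [RHS]big_split /=; congr (_ + _).
    by apply: eq_bigr => p _; rewrite mulrC /w -gE (g_sym s F).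
  under eq_bigr do rewrite mulr_sumr.
  rewrite exchange_big /=; apply: eq_bigr => p _; rewrite mulr_sumr.
  by apply: eq_bigr => r _; ring.
rewrite /w; ring.
Qed.

(** Antisymmetrize [gauss_dv3] in i and j: the third derivatives of F cancel and the Christoffel
    terms assemble to the curvature. *)
Lemma gauss i j z : D z -> g z *m curv i j z =
  wedge i j (g z) (amx z) + wedge i j (amx z) (g z) + e z *: wedge i j (hmx z) (hmx z).
Proof.
move=> Dz; apply/matrixP => q k.
have -> : (g z *m curv i j z) q k = \sum_p g z q p * riemann g p k i j z.
  by rewrite mxE; apply: eq_bigr => p _; rewrite [curv _ _ _ _ _]mxE.
have E : <<dv i (dv j (dv k F)) z, dv q F z>> - <<dv j (dv i (dv k F)) z, dv q F z>> = 0.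
  by rewrite dv3_sym // subrr.
move: E; rewrite !gauss_dv3 // => E.
have -> : \sum_p g z q p * riemann g p k i j z =
  \sum_p g z q p * (ds i (Gam p j k) z + \sum_r Gam p i r z * Gam r j k z) -
  \sum_p g z q p * (ds j (Gam p i k) z + \sum_r Gam p j r z * Gam r i k z).
  rewrite -sumrB; apply: eq_bigr => p _; rewrite -mulrBr riemann_ds sumrB.
  by congr (_ * _); ring.
have wE A B : wedge i j A B q k = A q i * B j k - A q j * B i k by exact: wedgeE.
rewrite [RHS]mxE [X in _ = X + _]mxE [X in _ = _ + X]mxE !wE.
have aE p r : amx z p r = a p r z by rewrite mxE.
have hE p r : hmx z p r = h p r z by rewrite mxE.
rewrite !aE !hE (g_sym s F z q i) (g_sym s F z q j).
rewrite (h_sym q i Dz) (h_sym q j Dz) /=; move: E => /=; lra.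
Qed.

Lemma blaschke_matrix z : D z -> amx z = l z *: g z + (u z * e z) *: hmx z.
Proof.
move=> Dz; apply/matrixP => i j; rewrite [amx z i j]mxE [RHS]mxE.
rewrite [(l z *: g z) i j]mxE [((u z * e z) *: hmx z) i j]mxE [hmx z i j]mxE.
exact: (a_formula i j Dz).
Qed.

Lemma tr_hmx z : D z -> (hmx z)^T = hmx z.
Proof. by move=> Dz; apply/matrixP => i j; rewrite mxE 2![hmx _ _ _]mxE; exact: h_sym. Qed.

(** * Traces and the normalization of the conformal metric *)

Lemma laplacian_pairing w z : (forall k, <<w, dv k F z>> = 0) ->
  <<lift_laplacian s F z, w>> =
  \sum_i \sum_j invmx (g z) i j * <<dv i (dv j F) z, w>>.
Proof.
move=> w0; rewrite lift_laplacian_dv ip_suml; apply: eq_bigr => i _.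
rewrite ip_suml; apply: eq_bigr => j _; rewrite ipZl ipBl ip_suml big1 ?subr0 // => k _.
by rewrite ipZl ipC w0 mulr0.
Qed.

(** The Laplacian is a combination of N and F, and xi is orthogonal to both. *)
Lemma laplacian_normal z : D z -> <<lift_laplacian s F z, X z>> = 0.
Proof.
move=> Dz; have := normal_confN Dz; rewrite NE /conf_N ipBr ipNr !ipZr normal_lift // mulr0 subr0.
move=> /eqP; rewrite oppr_eq0 mulf_eq0 invr_eq0 (negPf mR0) /= => /eqP.
by rewrite ipC.
Qed.

Lemma trace_pair z (T : 'I_m -> 'I_m -> R) :
  \sum_i \sum_j invmx (g z) i j * T i j =
  mxtrace (invmx (g z) *m \matrix_(i, j) T j i).
Proof.
apply: eq_bigr => i _; rewrite mxE; apply: eq_bigr => j _.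
by rewrite [(\matrix_(_, _) _) _ _]mxE.
Qed.

Lemma trace_second_fundamental z : D z -> mxtrace (invmx (g z) *m hmx z) = 0.
Proof.
move=> Dz; rewrite -(laplacian_normal Dz) laplacian_pairing => [|k]; last exact: normal_tangent.
rewrite trace_pair; congr (mxtrace (_ *m _)); apply/matrixP => i j.
by rewrite [hmx _ _ _]mxE [RHS]mxE; exact: h_sym.
Qed.

Lemma trace_blaschke z : D z -> mxtrace (invmx (g z) *m amx z) = m%:R * l z.
Proof.
move=> Dz; rewrite blaschke_matrix // mulmxDr -!scalemxAr mxtraceD !mxtraceZ trace_second_fundamental // mulr0 addr0.
by rewrite mulVmx ?uG // mxtrace_scalar mulrC.
Qed.

(** The pairing of the Laplacian with N is computed twice: from the definition of N it is minus the
    norm over 2 m, and as a trace of second derivatives it is - tr A = - m l. *)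
Lemma laplacian_norm z : D z ->
  <<lift_laplacian s F z, lift_laplacian s F z>> = 2 * m%:R ^+ 2 * l z.
Proof.
move=> Dz; have H := laplacian_confN oD sF uG FF m0 Dz.
have : <<lift_laplacian s F z, N z>> = - (m%:R * l z).
  rewrite -(trace_blaschke Dz) laplacian_pairing => [|k]; last exact: NF1'.
  have -> : mxtrace (invmx (g z) *m amx z) =
      - mxtrace (invmx (g z) *m \matrix_(i, j) <<dv j (dv i F) z, N z>>).
    rewrite -raddfN -mulmxN; congr (mxtrace (_ *m _)).
    apply/matrixP => i j; rewrite [LHS]mxE [RHS]mxE [X in - X]mxE dvN_F1 //.
    by rewrite (ipC _ (N z)).
  by rewrite opprK trace_pair.
rewrite NE H => /oppr_inj E.
have -> : 2 * m%:R ^+ 2 * l z = m%:R * l z * (2 * m%:R) by ring.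
rewrite -E divfK // mulf_neq0 // pnatr_eq0.
Qed.

(** The Gauss equation contracted in i; the traces that occur are tr (g^-1 h) = 0 and tr A = m l. *)
Lemma ricci j k z : D z -> \sum_i riemann g i k i j z =
  ((m%:R - 2) *: amx z + (m%:R * l z) *: g z
   - e z *: (hmx z *m invmx (g z) *m hmx z)) j k.
Proof.
move=> Dz.
have E i : riemann g i k i j z = wedge i j 1%:M (amx z) i k +
    wedge i j (invmx (g z) *m amx z) (g z) i k +
    e z * wedge i j (invmx (g z) *m hmx z) (hmx z) i k.
  have -> : riemann g i k i j z = curv i j z i k by rewrite mxE.
  rewrite -[curv i j z](mulKmx (uG Dz)) gauss // !mulmxDr -scalemxAr !mulmx_wedge.
  rewrite mulVmx ?uG // [LHS]mxE [X in X + _]mxE.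
  by rewrite [X in _ + X]mxE.
under eq_bigr do rewrite E.
have sumw P A : \sum_i wedge i j P A i k = mxtrace P * A j k - (P^T *m A) j k.
  under eq_bigr do rewrite wedgeE.
  rewrite sumrB -mulr_suml; congr (_ - _); rewrite mxE.
  by apply: eq_bigr => i _; rewrite mxE.
have amT : (amx z)^T = amx z.
  by apply/matrixP => p q; rewrite mxE 2![amx _ _ _]mxE; exact: a_sym.
rewrite !big_split /= -mulr_sumr !sumw trmx1 mul1mx mxtrace_scalar trace_blaschke // trace_second_fundamental //.
rewrite !trmx_mul amT (tr_hmx Dz) (tr_invg s F) mulmxKV ?uG //.
set W := hmx z *m invmx (g z) *m hmx z; clearbody W.
rewrite !mxE; ring.
Qed.

Lemma scalar_formula z : D z -> scalar_curvature g z =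
  2 * (m%:R - 1) * m%:R * l z -
  e z * mxtrace ((invmx (g z) *m hmx z) *m (invmx (g z) *m hmx z)).
Proof.
move=> Dz; rewrite /scalar_curvature.
under eq_bigr => j _ do under eq_bigr => k _ do rewrite ricci //.
set W := (_ *: amx z + _ - _).
have WT : W^T = W.
  have amT : (amx z)^T = amx z.
    by apply/matrixP => p q; rewrite mxE 2![amx _ _ _]mxE; exact: a_sym.
  have hT : (hmx z *m invmx (g z) *m hmx z)^T = hmx z *m invmx (g z) *m hmx z.
    by rewrite !trmx_mul (tr_hmx Dz) (tr_invg s F) mulmxA.
  by rewrite /W linearB linearD !linearZ /= amT (tr_g s F) hT.
rewrite trace_pair.
have -> : \matrix_(i, j) W j i = W by rewrite -[RHS]WT; apply/matrixP => i j; rewrite !mxE.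
rewrite /W mulmxBr mulmxDr -!scalemxAr mxtraceD linearN /= mxtraceD !mxtraceZ trace_blaschke //.
rewrite mulVmx ?uG // mxtrace_scalar !mulmxA; ring.
Qed.

(** This is tr B^2: [conf_B] equals e g^-1 h, and e^2 = 1. *)
Definition tau z := mxtrace ((invmx (g z) *m hmx z) *m (invmx (g z) *m hmx z)).

Let m10 : m%:R - 1 != 0 :> R.
Proof. by rewrite subr_eq0 pnatr_eq1 gtn_eqF. Qed.

(** The coefficient m / (m - 1) of the scalar curvature is exactly the one for which the terms in l
    cancel. *)
Lemma conf_factor_formula z : D z ->
  conf_factor s F z = e z * (m%:R / (m%:R - 1)) * tau z.
Proof.
move=> Dz; rewrite /conf_factor laplacian_norm // scalar_formula // -/(tau z); field.
exact: m10.
Qed.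

Hypothesis hcan : forall z, D z -> conf_metric s F z = g z.

Lemma conf_factor_unit z : D z -> `|conf_factor s F z| = 1.
Proof.
move=> Dz; have := hcan Dz; rewrite /conf_metric => E.
have := congr1 (fun M => mxtrace (invmx (g z) *m M)) E.
rewrite /= -scalemxAr mxtraceZ mulVmx ?uG // mxtrace_scalar => /eqP.
by rewrite -subr_eq0 -[X in _ - X]mul1r -mulrBl mulf_eq0 (negPf mR0) orbF subr_eq0 => /eqP.
Qed.

(** The normalization involves an absolute value, so the sign of [tau] is left undetermined and only
    its square is computed. *)
Lemma tau_sq z : D z -> tau z ^+ 2 = ((m%:R - 1) / m%:R) ^+ 2.
Proof.
move=> Dz; have /(congr1 (fun t => t ^+ 2)) := conf_factor_unit Dz.
rewrite real_normK ?num_real // conf_factor_formula // expr1n !exprMn sq_e // mul1r => E.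
have -> : tau z ^+ 2 = ((m%:R - 1) / m%:R) ^+ 2 * (m%:R ^+ 2 * (m%:R - 1)^-1 ^+ 2 * tau z ^+ 2).
  by field; rewrite m10 mR0.
by rewrite E mulr1 exprMn.
Qed.

Lemma tau_neq0 z : D z -> tau z != 0.
Proof.
by move=> Dz; rewrite -sqrf_eq0 tau_sq // sqrf_eq0 mulf_neq0 ?invr_neq0.
Qed.

Lemma smooth_hmx : msm D hmx.
Proof.
move=> i j; have -> : (fun y => hmx y i j) = (fun y => h i j y).
  by apply/funext => y; rewrite mxE.
by apply: (sms_ip oD).
Qed.

Lemma smooth_tau : sms D tau.
Proof.
have sB : msm D (fun y => invmx (g y) *m hmx y).
  by apply: msm_mul => //; [move=> i j; exact: smooth_invg|exact: smooth_hmx].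
by apply: (sms_mxtrace oD); apply: msm_mul.
Qed.

Lemma ds_tau i z : D z -> ds i tau z = 0.
Proof.
move=> Dz; apply: (ds_sqr0 oD Dz smooth_tau (tau_neq0 Dz) _ (ds_cst _ (((m%:R - 1) / m%:R) ^+ 2) i)).
by move=> y Dy; rewrite -expr2 tau_sq.
Qed.

(** * Connection matrices and the Codazzi equation *)

Lemma mpd_g i z : D z -> mpd i g z = (cmx i z)^T *m g z + g z *m cmx i z.
Proof.
move=> Dz; apply/matrixP => j k; rewrite mpdE [RHS]mxE.
have := ds_gentry s sF i j k Dz; rewrite /gentry => ->.
rewrite (ipC _ (dv j F z)) -(christoffel_lowr oD sF uG i j k Dz).
rewrite -(christoffel_low oD sF uG i k j Dz).
congr (_ + _); rewrite [RHS]mxE; apply: eq_bigr => p _.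
  by rewrite [(cmx i z)^T j p]mxE [cmx i z p j]mxE.
by rewrite [cmx _ _ _ _]mxE.
Qed.

Lemma smooth_cmx i : msm D (cmx i).
Proof.
move=> p q; have -> : (fun y => cmx i y p q) = Gam p i q by apply/funext => y; rewrite mxE.
exact: smooth_christoffel.
Qed.

Lemma curvE i j z : curv i j z = mpd i (cmx j) z - mpd j (cmx i) z +
  (cmx i z *m cmx j z - cmx j z *m cmx i z).
Proof.
apply/matrixP => p k; rewrite [LHS]mxE riemann_ds.
rewrite [RHS]mxE [X in _ = X + _]mxE [X in _ = _ + X + _]mxE !mpdE.
have E a' b' : (fun y => cmx a' y p b') = Gam p a' b' by apply/funext => y; rewrite mxE.
rewrite !E; congr (_ + _); rewrite sumrB [RHS]mxE [X in _ = _ + X]mxE.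
by congr (_ - _); rewrite [RHS]mxE; apply: eq_bigr => r _; rewrite 2![cmx _ _ _ _]mxE.
Qed.

(** Exchanging i and j exchanges two of the three Christoffel sums and fixes the third; the third
    derivatives of F are symmetric. *)
Lemma codazzi i j p z : D z ->
  (mpd i hmx z - ((cmx i z)^T *m hmx z + hmx z *m cmx i z)) j p =
  (mpd j hmx z - ((cmx j z)^T *m hmx z + hmx z *m cmx j z)) i p.
Proof.
move=> Dz.
have E a' b' : (mpd a' hmx z - ((cmx a' z)^T *m hmx z + hmx z *m cmx a' z)) b' p =
    <<dv a' (dv b' (dv p F)) z, X z>> - \sum_r Gam r b' p z * h a' r z
    - (\sum_r Gam r a' b' z * h r p z + \sum_r h b' r z * Gam r a' p z).
  rewrite [LHS]mxE [X in _ + X]mxE mpdE.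
  have -> : (fun y => hmx y b' p) = h b' p by apply/funext => y; rewrite mxE.
  rewrite ds_h //; congr (_ - _); rewrite [LHS]mxE; congr (_ + _); rewrite mxE.
    by apply: eq_bigr => r _; rewrite !mxE.
  by apply: eq_bigr => r _; rewrite !mxE.
apply: (etrans (E i j)); apply: (etrans _ (esym (E j i))).
rewrite (dv3_sym i j p Dz).
have -> : \sum_r h j r z * Gam r i p z = \sum_r Gam r i p z * h j r z.
  by apply: eq_bigr => r _; rewrite mulrC.
have -> : \sum_r h i r z * Gam r j p z = \sum_r Gam r j p z * h i r z.
  by apply: eq_bigr => r _; rewrite mulrC.
have -> : \sum_r Gam r i j z * h r p z = \sum_r Gam r j i z * h r p z.
  by apply: eq_bigr => r _; rewrite (christoffel_sym s oD sF).
lra.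
Qed.

(** * Constancy of lambda and mu *)

Let Q z := hmx z *m invmx (g z).
Let la z : 'cV[R]_m := \col_i ds i l z.
Let mu z : 'cV[R]_m := \col_i ds i u z.

Lemma trace_shape z : D z -> mxtrace (Q z) = 0.
Proof. by move=> Dz; rewrite mxtrace_mulC trace_second_fundamental. Qed.

Lemma trace_shape_sq z : mxtrace (Q z *m Q z) = tau z.
Proof. by rewrite /tau /Q -mulmxA mxtrace_mulC !mulmxA. Qed.

(** [ds_relation] with the index k raised. Q is the transpose of g^-1 h, so it acts on columns of
    partial derivatives. *)
Lemma ds_relationQ z : D z -> forall i j q,
  la z j 0 * (i == q)%:R + e z * mu z j 0 * Q z i q =
  la z i 0 * (j == q)%:R + e z * mu z i 0 * Q z j q.
Proof.
move=> Dz i j q; rewrite 2![la _ _ _]mxE 2![mu _ _ _]mxE.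
have QE i' : Q z i' q = \sum_k h i' k z * invmx (g z) k q.
  by rewrite mxE; apply: eq_bigr => k _; rewrite [hmx _ _ _]mxE.
rewrite !QE -!(mul_g_invg uG Dz) !mulr_sumr -!big_split /=.
apply: eq_bigr => k _; have := ds_relation i j k Dz => /= E.
transitivity ((ds j l z * g z i k + e z * ds j u z * h i k z) * invmx (g z) k q).
  by rewrite /=; ring.
by rewrite /= E; ring.
Qed.

(** By contradiction, on the open set D' where [ds j0 u] does not vanish: there b is defined and
    smooth, and the identities can be differentiated. *)
Lemma mu_constant j0 z0 : D z0 -> ds j0 u z0 = 0.
Proof.
move=> Dz0; apply/eqP/negPn/negP => nz0.
pose D' := [set y | D y /\ ds j0 u y != 0].
have oD' : open D' by apply: (open_neq0 oD); exact: sms_ds.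
have Dz0' : D' z0 by split.
have sub : D' `<=` D by move=> y [].
have sube (f : 'rV[R]_m -> R) : sms D f -> sms D' f by apply: sms_sub.
pose b y := - (e y * ds j0 l y / ds j0 u y).
pose d y := (m%:R - 2) / 2 * b y.
pose kap y := m%:R * tau y / (4 * (m%:R - 1)).
have sb : sms D' b.
  apply: (smsN oD'); apply: (smsM oD').
    by apply: sube; apply: (smsM oD); [exact: smooth_e|exact: sms_ds].
  by apply: (smsV oD') => [y []|] //; apply: sube; exact: sms_ds.
have sd : sms D' d by apply: (smsM oD') => //; exact: sms_cst.
have skap : sms D' kap.
  apply: (smsM oD'); last exact: sms_cst.
  by apply: (smsM oD'); [exact: sms_cst|apply: sube; exact: smooth_tau].
have R1 y (Dy : D' y) : [/\ (Q y + (d y)%:M) *m (Q y + (d y)%:M) = (kap y)%:M,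
    (2 < m)%N -> tau y = m%:R * (m%:R - 1) * b y ^+ 2 &
    (2 < m)%N -> la y = - (e y * b y) *: mu y].
  have [Dy1 Dy2] := Dy.
  have nz : mu y j0 0 != 0 by rewrite mxE.
  have := rank_one_algebra m1 (sq_e Dy1) (trace_shape Dy1) (ds_relationQ Dy1) nz.
  have -> : - (e y * la y j0 0 / mu y j0 0) = b y by rewrite 2!mxE.
  by rewrite !trace_shape_sq.
(* For m > 2, b^2 is a constant multiple of [tau]. For m = 2 nothing is needed about b, since then d
   = 0. *)
have db i y : (2 < m)%N -> D' y -> ds i b y = 0.
  move=> m2 Dy; have [_ /(_ m2) T _] := R1 _ Dy.
  have bn : b y != 0.
    apply: contraTneq (tau_neq0 Dy.1) => b0.
    by rewrite T b0 expr0n mulr0 eqxx.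
  pose c := (m%:R * (m%:R - 1))^-1 : R.
  apply: (ds_sqr0 oD' Dy (t := fun y => c * tau y) sb bn).
    move=> w Dw; have [_ /(_ m2) -> _] := R1 _ Dw; rewrite /c; field.
    by rewrite m10 mR0.
  rewrite (dsM Dy) ?ds_cst; [|exact: sms_cst|apply: sube; exact: smooth_tau].
  by rewrite ds_tau ?mulr0 ?mul0r ?addr0 //; exact: sub.
have dd i y : D' y -> ds i d y = 0.
  move=> Dy; rewrite (dsM Dy) ?ds_cst //; last exact: sms_cst.
  rewrite mul0r add0r; move: m1; rewrite leq_eqVlt => /orP[/eqP m2|m2].
    have -> : m%:R = 2 :> R by rewrite -m2.
    by rewrite subrr !mul0r.
  by rewrite db // mulr0.
have dkap i y : D' y -> ds i kap y = 0.
  move=> Dy; have s1 : sms D' tau by apply: sube; exact: smooth_tau.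
  have s2 : sms D' (fun y => m%:R * tau y) by apply: (smsM oD') => //; exact: sms_cst.
  rewrite (dsM Dy) ?ds_cst //; last exact: sms_cst.
  rewrite (dsM Dy) ?ds_cst //; last exact: sms_cst.
  by rewrite ds_tau ?mulr0 ?mul0r ?addr0 ?mul0r //; exact: sub.
have kap0 y : D' y -> kap y != 0.
  move=> [Dy _]; apply: mulf_neq0; first by apply: mulf_neq0 => //; exact: tau_neq0.
  by rewrite invr_neq0 // mulf_neq0 // pnatr_eq0.
(* Q + d I with its index lowered. As d is constant and g parallel, k has the same covariant
   derivative as h, so it inherits the Codazzi symmetry. *)
pose k y := hmx y + d y *: g y.
have sk : msm D' k.
  apply: (msmD oD'); first by move=> i j; apply: sube; exact: smooth_hmx.
  by apply: (msmZ oD') => // i j; apply: sube; exact: smooth_g.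
have kE y : D y -> k y = (Q y + (d y)%:M) *m g y.
  by move=> Dy; rewrite mulmxDl /Q mulmxKV ?uG // mul_scalar_mx.
have kk y : D' y -> k y *m invmx (g y) *m k y = kap y *: g y.
  move=> Dy; have [K1 _ _] := R1 _ Dy; have Dy1 := sub _ Dy.
  rewrite (kE _ Dy1) mulmxK ?uG // mulmxA K1 mul_scalar_mx //.
have kT y : D y -> (k y)^T = k y.
  by move=> Dy; rewrite /k linearD linearZ /= (tr_g s F) (tr_hmx Dy).
have sgm : msm D' g by move=> i j; apply: sube; exact: smooth_g.
have shm : msm D' hmx by move=> i j; apply: sube; exact: smooth_hmx.
have SE i y : D' y -> mpd i k y - ((cmx i y)^T *m k y + k y *m cmx i y) =
    mpd i hmx y - ((cmx i y)^T *m hmx y + hmx y *m cmx i y).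
  move=> Dy; rewrite (mpdD Dy) //; last exact: msmZ.
  rewrite (mpdZ Dy) // dd // scale0r add0r mpd_g; last exact: sub.
  rewrite /k mulmxDl mulmxDr -scalemxAl -scalemxAr scalerDr.
  move: (mpd i hmx y) (_ *m hmx y) (hmx y *m _) (d y *: _) (d y *: _) => M1 M2 M3 M4 M5.
  by apply/matrixP => p q; rewrite !mxE; lra.
have par i j y : D' y -> k y *m curv i j y + (curv i j y)^T *m k y = 0.
  move=> Dy; apply: (@parallel_curv R m D' oD' g k cmx kap) => //.
  - by move=> i' p q; apply: sube; exact: smooth_cmx.
  - by move=> w /sub; exact: uG.
  - by move=> w _; exact: tr_g.
  - by move=> w /sub; exact: kT.
  - by move=> i' w /sub; exact: mpd_g.
  - by move=> i' j' p w Dw; rewrite !SE //; apply: codazzi; exact: sub.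
  - exact: curvE.
(* The left side is the coefficient c1 of the Gauss equation written in k. The trace-free part of
   g^-1 k is g^-1 h, which is nonzero because [tau] is, so c1 = e kap. *)
have key y : D' y -> 2 * (l y - u y * e y * d y) + e y * d y ^+ 2 = e y * kap y.
  move=> Dy; have Dy1 := sub _ Dy.
  have hk : hmx y = k y - d y *: g y by rewrite addrK.
  have ak : amx y = (l y - u y * e y * d y) *: g y + (u y * e y) *: k y.
    rewrite blaschke_matrix // {1}hk scalerBr scalerA scalerBl.
    by rewrite addrC -addrA [X in _ + X]addrC [in RHS]addrC.
  have gR i j : g y *m curv i j y =
      (2 * (l y - u y * e y * d y) + e y * d y ^+ 2) *: wedge i j (g y) (g y) +
      (u y * e y - e y * d y) *: (wedge i j (g y) (k y) + wedge i j (k y) (g y)) +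
      e y *: wedge i j (k y) (k y).
    by rewrite gauss //; exact: wedge_gauss ak hk.
  have := parallel_curvature (tr_g s F y) (kT _ Dy1) (uG Dy1) (kk _ Dy) gR
    (fun i j => par i j _ Dy).
  have -> : invmx (g y) *m k y = invmx (g y) *m hmx y + (d y)%:M.
    by rewrite /k mulmxDr -scalemxAr mulVmx ?uG // scalemx1.
  rewrite mxtraceD trace_second_fundamental // add0r mxtrace_scalar.
  have -> : m%:R *: (invmx (g y) *m hmx y + (d y)%:M) - (d y *+ m)%:M =
      m%:R *: (invmx (g y) *m hmx y).
    by rewrite scalerDr scale_scalar_mx mulr_natl addrK.
  move/eqP; rewrite !scaler_eq0 (negPf mR0) /= => /orP[|/eqP B0].
    by rewrite subr_eq0 => /eqP.
  by case/eqP: (tau_neq0 Dy1); rewrite /tau B0 mul0mx mxtrace0.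
(* Differentiate [key], in which e, d and kap are constant. *)
have dl i : ds i l z0 = e z0 * d z0 * ds i u z0.
  have se' : sms D' e by apply: sube; exact: smooth_e.
  have sl' := sube _ sl; have su' := sube _ su.
  have sue := smsM oD' su' se'; have sued := smsM oD' sue sd.
  have sle := smsB oD' sl' sued.
  have E1 y : D' y -> l y - u y * e y * d y = 2^-1 * (e y * (kap y - d y * d y)).
    by move=> Dy; have := key _ Dy => /= E; move: E; rewrite expr2; lra.
  have L1 : ds i (fun y => l y - u y * e y * d y) z0 =
      ds i l z0 - ds i u z0 * e z0 * d z0.
    rewrite (dsB Dz0' i sl' sued) (dsM Dz0' i sue sd) (dsM Dz0' i su' se').
    by rewrite (dd i z0 Dz0') (ds_e i Dz0) mulr0 addr0 mulr0 addr0.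
  have sdd := smsM oD' sd sd; have skd := smsB oD' skap sdd.
  have sek := smsM oD' se' skd.
  have L2 : ds i (fun y => 2^-1 * (e y * (kap y - d y * d y))) z0 = 0.
    rewrite (dsM Dz0' i (sms_cst D' 2^-1) sek) ds_cst mul0r add0r.
    rewrite (dsM Dz0' i se' skd) (ds_e i Dz0) mul0r add0r.
    rewrite (dsB Dz0' i skap sdd) (dsM Dz0' i sd sd) (dd i z0 Dz0') (dkap i z0 Dz0').
    by rewrite mul0r mulr0 addr0 subr0 mulr0 mulr0.
  have := ds_on oD' i Dz0' E1; rewrite L1 L2 /= => /eqP.
  by rewrite subr_eq0 => /eqP ->; rewrite -[LHS]mulrA [LHS]mulrC.
have [K1 K2 K3] := R1 _ Dz0'.
have laE : la z0 = (e z0 * d z0) *: mu z0.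
  by apply/matrixP => i j; rewrite ord1 [RHS]mxE 2!mxE dl.
have mun0 : mu z0 != 0.
  by apply: contraNneq nz0 => /matrixP/(_ j0 0); rewrite 2!mxE => ->.
(* If m = 2, then d = 0 and so dlambda = 0; the trace relation gives Q dmu = 0, against Q^2 = kap I
   with kap nonzero. *)
move: (m1); rewrite leq_eqVlt => /orP[/eqP m2|m2].
  have mR : m%:R = 2 :> R by rewrite -m2.
  have d0 : d z0 = 0 by rewrite /d mR subrr !mul0r.
  have := trace_relation (trace_shape Dz0) (ds_relationQ Dz0).
  rewrite laE d0 mulr0 scale0r scaler0 => /esym/eqP.
  rewrite scaler_eq0 (negPf (e_neq0 Dz0)) /= => /eqP Q0.
  move: K1; rewrite d0 raddf0 addr0 => /(congr1 (mulmx^~ (mu z0))).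
  rewrite -mulmxA Q0 mulmx0 mul_scalar_mx => /esym/eqP.
  by rewrite scaler_eq0 (negPf (kap0 _ Dz0')) (negPf mun0).
(* If m > 2, the two expressions e d dmu and - e b dmu of dlambda give (d + b) dmu = 0, but d + b =
   m b / 2 is nonzero. *)
have : (e z0 * (d z0 + b z0)) *: mu z0 = 0.
  rewrite mulrDr scalerDl -laE K3 // scaleNr addNr //.
move/eqP; rewrite scaler_eq0 (negPf mun0) orbF mulf_eq0 (negPf (e_neq0 Dz0)) /=.
have -> : d z0 + b z0 = m%:R / 2 * b z0 by rewrite /d; field.
rewrite !mulf_eq0 (negPf mR0) invr_eq0 pnatr_eq0 /= => /eqP b0.
by case/eqP: (tau_neq0 Dz0); rewrite (K2 m2) b0 expr0n mulr0.
Qed.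

(** With dmu = 0 the trace relation reduces to (m - 1) dlambda = 0. *)
Lemma lambda_constant j z : D z -> ds j l z = 0.
Proof.
move=> Dz; have := trace_relation (trace_shape Dz) (ds_relationQ Dz).
have -> : mu z = 0 by apply/matrixP => i k; rewrite 2!mxE mu_constant.
rewrite mulmx0 scaler0 => /eqP; rewrite scaler_eq0 (negPf m10) /= => /eqP/matrixP/(_ j 0).
by rewrite 2!mxE.
Qed.

End Umbilic.

(** * Change of lift and of chart *)

Section Scaling.
Variables (R : realType) (m : nat) (D : set 'rV[R]_m) (oD : open D).
Variables (G G' : 'rV[R]_m -> 'M[R]_m) (k : R).
Hypotheses (k0 : k != 0) (sG : msm D G) (uG : forall z, D z -> G z \in unitmx).
Hypothesis GG' : forall z, D z -> G' z = k *: G z.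

Lemma invmx_scaled z : D z -> invmx (G' z) = k^-1 *: invmx (G z).
Proof. by move=> Dz; rewrite GG' // invmxZ // unitmxZ ?uG // unitfE. Qed.

Lemma ds_gentry_scaled i j p z : D z -> ds p (gentry G' i j) z = k * ds p (gentry G i j) z.
Proof.
move=> Dz; have E y : D y -> gentry G' i j y = k * gentry G i j y.
  by move=> Dy; rewrite /gentry GG' // mxE.
have sk := sms_cst D k; have sg : sms D (gentry G i j) by exact: sG.
by rewrite (ds_on oD p Dz E) (dsM Dz p sk sg) ds_cst mul0r add0r.
Qed.

Lemma christoffel_scaled p i j z : D z -> christoffel G' p i j z = christoffel G p i j z.
Proof.
move=> Dz; rewrite !christoffel_ds; congr (_ * _); apply: eq_bigr => q _.
rewrite invmx_scaled // !ds_gentry_scaled // mxE; field.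
exact: k0.
Qed.

Lemma riemann_scaled q p i j z : D z -> riemann G' q p i j z = riemann G q p i j z.
Proof.
move=> Dz; rewrite !riemann_ds.
rewrite (ds_on oD i Dz (christoffel_scaled q j p)) (ds_on oD j Dz (christoffel_scaled q i p)).
by congr (_ + _); apply: eq_bigr => r _; rewrite !christoffel_scaled.
Qed.

Lemma scalar_curvature_scaled z : D z ->
  scalar_curvature G' z = k^-1 * scalar_curvature G z.
Proof.
move=> Dz; rewrite /scalar_curvature mulr_sumr; apply: eq_bigr => j _.
rewrite mulr_sumr; apply: eq_bigr => p _; rewrite invmx_scaled // mxE mulrA.
by congr (_ * _); apply: eq_bigr => i _; rewrite riemann_scaled.
Qed.

End Scaling.

Section LiftChange.
Variables (R : realType) (m s : nat) (D : set 'rV[R]_m) (oD : open D).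
Variables (F : 'rV[R]_m -> 'rV[R]_m.+3).
Hypotheses (sF : smv D F) (uG : forall z, D z -> lift_gram s F z \in unitmx).
Hypothesis FF : forall z, D z -> ip s.+1 (F z) (F z) = 0.

(** Pairing with the derivatives of F removes the multiple of F and leaves v g = 0. *)
Lemma immersive_lift z : D z -> lift_immersive F z.
Proof.
move=> Dz v a; have -> : \sum_i v 0 i *: pd i F z = \sum_i v 0 i *: dv i F z.
  by rewrite dv.unlock.
move=> E; apply: (can_inj (mulmxK (uG Dz))); rewrite mul0mx.
apply/rowP => j; rewrite [RHS]mxE mxE.
have := congr1 (fun w => ip s.+1 w (dv j F z)) E.
rewrite /= ipZl (lift_tangent oD sF FF) // mulr0 ip_suml => E2.
by rewrite -[RHS]E2; apply: eq_bigr => i _; rewrite ipZl lift_gramE.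
Qed.

Variables (T : 'M[R]_m.+3) (oT : orthogonal_mx s.+1 T).
Let FT z := F z *m T.

Let dFT k z : D z -> dv k FT z = dv k F z *m T.
Proof. by move=> Dz; rewrite (dv_mulmx oD Dz). Qed.

Lemma lift_gram_mul z : D z -> lift_gram s FT z = lift_gram s F z.
Proof.
move=> Dz; apply/matrixP => i j; rewrite (lift_gramE s FT) (lift_gramE s F).
by rewrite (dFT i Dz) (dFT j Dz) oT.
Qed.

(** A scaling by 1, so that the results on homothetic metrics apply to isometries. *)
Let ggT z : D z -> lift_gram s FT z = 1 *: lift_gram s F z.
Proof. by move=> Dz; rewrite scale1r lift_gram_mul. Qed.

Let sg : msm D (lift_gram s F). Proof. exact: smooth_g. Qed.

Lemma christoffel_mul k i j z : D z ->
  christoffel (lift_gram s FT) k i j z = christoffel (lift_gram s F) k i j z.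
Proof. by move=> Dz; exact: (christoffel_scaled oD (oner_neq0 R) sg uG ggT). Qed.

Lemma lift_laplacian_mul z : D z -> lift_laplacian s FT z = lift_laplacian s F z *m T.
Proof.
move=> Dz; rewrite (lift_laplacian_dv s FT) (lift_laplacian_dv s F) mulmx_suml.
apply: eq_bigr => i _.
rewrite mulmx_suml; apply: eq_bigr => j _; rewrite (lift_gram_mul Dz) -[RHS]scalemxAl.
congr (_ *: _); rewrite mulmxBl; congr (_ - _).
  rewrite (dv_on oD i Dz (dFT j)).
  by apply: (dv_mulmx oD Dz); exact: smv_dv.
rewrite mulmx_suml; apply: eq_bigr => k _; rewrite -[RHS]scalemxAl.
by rewrite (dFT k Dz) (christoffel_mul k i j Dz).
Qed.

Lemma conf_metric_mul z : D z -> conf_metric s FT z = conf_metric s F z.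
Proof.
move=> Dz; rewrite /conf_metric /conf_factor (lift_laplacian_mul Dz) oT (lift_gram_mul Dz).
by rewrite (scalar_curvature_scaled oD (oner_neq0 R) sg uG ggT Dz) invr1 mul1r.
Qed.

End LiftChange.

Section Index.
Variables (R : realType) (m : nat).

Lemma has_index_scale (G : 'M[R]_m) t (a : R) : a != 0 ->
  has_index G t -> has_index (a ^+ 2 *: G) t.
Proof.
move=> a0 [uG [W nW] maxW].
have a2 : 0 < a ^+ 2 by rewrite lt_def sqrf_eq0 a0 sqr_ge0.
have E k (W' : 'M[R]_(k, m)) (v : 'rV[R]_k) :
    (v *m (W' *m (a ^+ 2 *: G) *m W'^T) *m v^T) 0 0 =
    a ^+ 2 * (v *m (W' *m G *m W'^T) *m v^T) 0 0.
  by rewrite -!scalemxAr -!scalemxAl -scalemxAr -scalemxAl mxE.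
split; first by rewrite unitmxZ // unitfE gt_eqF.
  by exists W => v /nW; rewrite E pmulr_rlt0.
by move=> k W' nW'; apply: (maxW k W') => v /nW'; rewrite E pmulr_rlt0.
Qed.

(** Writing F = al H, the terms with a derivative of al vanish because <H, H> = 0 and <H, dH> =
    0. *)
Lemma gram_conformal s (D : set 'rV[R]_m) (F H : 'rV[R]_m -> 'rV[R]_m.+3) z :
  open D -> smv D F -> smv D H -> D z -> H z != 0 ->
  (forall y, D y -> ip s.+1 (H y) (H y) = 0) ->
  (forall y, D y -> exists2 a, a != 0 & F y = a *: H y) ->
  exists2 a : R, a != 0 & lift_gram s F z = a ^+ 2 *: lift_gram s H z.
Proof.
move=> oD sF sH Dz Hz HH FH.
have [k Hk] : exists k, H z 0 k != 0.
  apply/existsP; apply: contraNT Hz; rewrite negb_exists => /forallP H0.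
  by apply/eqP/rowP => k; rewrite mxE; apply/eqP; rewrite -[_ == _]negbK; exact: H0.
pose D' := [set y | D y /\ H y 0 k != 0].
have sHk : sms D (fun y => H y 0 k) by exact: sms_coord.
have oD' : open D' by apply: (open_neq0 oD).
have Dz' : D' z by [].
have sub : D' `<=` D by move=> y [].
have sH' : smv D' H by apply: smv_row => // j; apply: (sms_sub sub); exact: sms_coord.
(* The factor is given only pointwise; as a quotient of coordinates it is smooth where H y 0 k is
   nonzero. *)
pose al y := F y 0 k * (H y 0 k)^-1.
have sal : sms D' al.
  apply: (smsM oD'); first by apply: (sms_sub sub); exact: sms_coord.
  by apply: (smsV oD') => [y []|] //; apply: (sms_sub sub).
have E y : D' y -> F y = al y *: H y.
  move=> [Dy nz]; have [a a0 Fa] := FH y Dy.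
  by rewrite /al Fa mxE mulfK.
exists (al z).
  have [a a0 Fa] := FH z Dz.
  by rewrite /al Fa mxE mulfK.
apply/matrixP => i j; rewrite lift_gramE [RHS]mxE lift_gramE.
rewrite (dv_on oD' i Dz' E) (dv_on oD' j Dz' E) !(dvZ oD' Dz') //.
rewrite !(ipDl, ipDr, ipZl, ipZr) HH //.
rewrite (ipC _ (dv i H z) (H z)) !(lift_tangent oD sH HH) //; ring.
Qed.

(** Under the change of basis J the operator g^-1 h is conjugated by J^T. *)
Lemma trace_congruent (g h g' h' J : 'M[R]_m) : g \in unitmx -> g' \in unitmx ->
  g' = J *m g *m J^T -> h' = J *m h *m J^T ->
  mxtrace ((invmx g' *m h') *m (invmx g' *m h')) =
  mxtrace ((invmx g *m h) *m (invmx g *m h)).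
Proof.
move=> ug ug' Eg Eh.
have uJ : J \in unitmx by move: ug'; rewrite Eg !unitmx_mul => /andP[/andP[]].
have uJT : J^T \in unitmx by rewrite unitmx_tr.
set B' := invmx g' *m h'; set B := invmx g *m h.
have E : J^T *m B' = B *m J^T.
  have : g' *m B' = h' by rewrite mulKVmx.
  rewrite {1}Eg Eh -!mulmxA => /(can_inj (mulKmx uJ)) H.
  by rewrite -[LHS](mulKmx ug) H /B mulmxA.
have -> : B' = invmx J^T *m B *m J^T by rewrite -mulmxA -E mulKmx.
have -> : invmx J^T *m B *m J^T *m (invmx J^T *m B *m J^T) = invmx J^T *m (B *m B *m J^T).
  by rewrite -!mulmxA mulKVmx.
by rewrite mxtrace_mulC mulmxK.
Qed.

End Index.

Section Constancy.
Variables (R : realType) (m : nat).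

Lemma ds0_const_ball (f : 'rV[R]_m -> R) z0 r z :
  sms (ball z0 r) f -> (forall y i, ball z0 r y -> ds i f y = 0) ->
  ball z0 r z -> f z = f z0.
Proof.
rewrite sms.unlock ds.unlock => sf f0 bz; apply: (@pd0_const_ball _ _ f z0 r z) => //.
by move=> y hy; exact: smooth_diff sf hy.
Qed.

Lemma dv_comp n (D : set 'rV[R]_m) (F : 'rV[R]_m -> 'rV[R]_n)
    (phi : 'rV[R]_m -> 'rV[R]_m) E z : smv D phi -> D z -> smv E F -> E (phi z) ->
  forall i, dv i (F \o phi) z = \sum_k dv i phi z 0 k *: dv k F (phi z).
Proof.
rewrite !smv.unlock !dv.unlock => sp Dz sF Ez i; apply: pd_comp.
  exact: smooth_diff sp Dz.
exact: smooth_diff sF Ez.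
Qed.

End Constancy.

(** * Hypersurfaces of space forms *)

Section ManifoldCharts.
Variables (R : realType) (m : nat) (M : manifold R m).

Lemma chart_image_open (c : chart R M m) (W : set M) :
  open W -> open (chart_map c @` (W `&` chart_dom c)).
Proof.
move=> oW; rewrite openE => z [q [Wq dq] <-]; rewrite /interior.
have hz : (chart_map c @` chart_dom c) (chart_map c q) by exists q.
have n1 : \forall y \near chart_map c q, (chart_map c @` chart_dom c) y.
  by apply: open_nbhs_nbhs; split=> //; exact: chart_img_open.
have n2 : \forall y \near chart_map c q, W (chart_inv c y).
  apply: (chart_inv_cont hz); rewrite chart_mapK //.
  by apply: open_nbhs_nbhs; split.
apply: filterS2 n1 n2 => y [q' dq' <-]; rewrite chart_mapK // => Wq'.
by exists q'.
Qed.

Lemma msmooth_smv n (W : set M) (f : M -> 'rV[R]_n) c :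
  msmooth W f -> atlas c -> smv (chart_map c @` (W `&` chart_dom c)) (f \o chart_inv c).
Proof. by rewrite smv.unlock => sf; exact: sf. Qed.

Lemma msmooth_sms (W : set M) (f : M -> R) c :
  msmooth W f -> atlas c -> sms (chart_map c @` (W `&` chart_dom c)) (f \o chart_inv c).
Proof. by rewrite sms.unlock => sf; exact: sf. Qed.

Lemma smv_msmooth n (W : set M) (f : M -> 'rV[R]_n) :
  (forall c, atlas c -> smv (chart_map c @` (W `&` chart_dom c)) (f \o chart_inv c)) ->
  msmooth W f.
Proof. by rewrite smv.unlock => sf c ac; exact: sf. Qed.

Lemma msmooth_sub (V : normedModType R) (W W' : set M) (f : M -> V) :
  W' `<=` W -> msmooth W f -> msmooth W' f.
Proof.
move=> sub sf c ac; apply: smooth_sub (sf c ac) => z [q [Wq dq] <-].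
by exists q => //; split=> //; exact: sub.
Qed.

End ManifoldCharts.

Lemma proj_class_scale (R : realType) N (X : 'rV[R]_N) (a : R) : a != 0 ->
  proj_class (a *: X) = proj_class X.
Proof.
move=> a0; apply/seteqP; split=> Z [b b0 <-].
  by exists (b * a); [exact: mulf_neq0|rewrite scalerA].
by exists (b / a); [rewrite /= mulf_neq0 ?invr_neq0|rewrite scalerA divfK].
Qed.

Lemma proj_class_mulmx (R : realType) N (X : 'rV[R]_N) (T : 'M[R]_N) :
  proj_class (X *m T) = conf_transf T (proj_class X).
Proof.
apply/seteqP; split=> Z.
  by move=> [b b0 <-]; exists (b *: X); [exists b|rewrite -scalemxAl].
by move=> [_ [b b0 <-] <-]; exists b => //; rewrite -scalemxAl.
Qed.

Lemma proj_class_eq (R : realType) N (X X' : 'rV[R]_N) :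
  proj_class X = proj_class X' -> exists2 a : R, a != 0 & X = a *: X'.
Proof.
move=> E; have : proj_class X X by exists 1; [exact: oner_neq0|rewrite scale1r].
by rewrite E => -[a a0 <-]; exists a.
Qed.

Section SpaceFormUnfolding.
Variables (R : realType) (m s : nat) (M : manifold R m) (S : space_form R m).
Variables (u : M -> 'rV[R]_(sf_dim S)).

Lemma sf_gram_dv c z i j : @sf_gram R m M S u c z i j =
  ip (sf_index S) (dv i (u \o chart_inv c) z) (dv j (u \o chart_inv c) z).
Proof. by rewrite dv.unlock mxE. Qed.

Lemma mean_curvature_dv eta c q : @mean_curvature R m M S u eta c q =
  m%:R^-1 * ip (sf_index S) (eta q) (eta q) *
  \sum_i \sum_j invmx (sf_gram u c (chart_map c q)) i j *
    ip (sf_index S) (dv i (dv j (u \o chart_inv c)) (chart_map c q)) (eta q).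
Proof. by rewrite dv.unlock. Qed.

Lemma sf_unit_normal_dv (W : set M) (eta : M -> 'rV[R]_(sf_dim S)) :
  msmooth W eta ->
  (forall c q, atlas c -> W q -> chart_dom c q ->
    [/\ sf_tangent (u q) (eta q),
        ip (sf_index S) (eta q) (eta q) = 1 \/
          ip (sf_index S) (eta q) (eta q) = -1 &
        forall i,
          ip (sf_index S) (eta q) (dv i (u \o chart_inv c) (chart_map c q)) = 0]) ->
  sf_unit_normal W u eta.
Proof. by rewrite dv.unlock => seta H; split. Qed.

End SpaceFormUnfolding.

Section ModelHypersurface.
Variables (R : realType) (m s t : nat) (M : manifold R m).
Variables (x : M -> set 'rV[R]_m.+3) (U : set M) (Y xi : M -> 'rV[R]_m.+3).
Variables (c0 : 'rV[R]_m.+3) (e0 mu0 rho0 : R).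
Variables (S : space_form R m) (r : R) (T : 'M[R]_m.+3) (P : 'M[R]_(m.+3, sf_dim S)).

Local Notation "<< a , b >>" := (ip s.+1 a b).
Local Notation F c := (Y \o chart_inv c).
Local Notation g c := (lift_gram s (Y \o chart_inv c)).

Hypothesis m0 : (0 < m)%N.
Hypothesis oU : open U.
Hypotheses (sY : msmooth U Y) (sxi : msmooth U xi).
Hypothesis lift : forall q, U q -> @lightcone R m.+3 s (Y q) /\ x q = proj_class (Y q).
Hypothesis e01 : e0 = 1 \/ e0 = -1.
Hypothesis Yc : forall q, U q -> <<Y q, c0>> = 1.
Hypothesis xic : forall q, U q -> <<xi q, c0>> = mu0.
Hypothesis xixi : forall q, U q -> <<xi q, xi q>> = e0.
Hypothesis xiY : forall q, U q -> <<xi q, Y q>> = 0.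
Hypothesis xi1 : forall c q i, atlas c -> U q -> chart_dom c q ->
  <<xi q, dv i (F c) (chart_map c q)>> = 0.
Hypothesis idx : forall c q, atlas c -> U q -> chart_dom c q ->
  has_index (g c (chart_map c q)) t.
Hypothesis can : forall c q, atlas c -> U q -> chart_dom c q ->
  conf_metric s (F c) (chart_map c q) = g c (chart_map c q).
Hypothesis trh : forall c q, atlas c -> U q -> chart_dom c q ->
  \sum_i \sum_j invmx (g c (chart_map c q)) i j *
    <<dv i (dv j (F c)) (chart_map c q), xi q>> = 0.
Hypothesis rho : forall c q, atlas c -> U q -> chart_dom c q ->
  scalar_curvature (g c) (chart_map c q) = rho0.
Hypothesis mod : model s c0 r T P.

Let oT : orthogonal_mx s.+1 T. Proof. by case: mod. Qed.
Let r0 : r != 0. Proof. by case: mod. Qed.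
Let ipP v w : <<v, c0>> = 0 -> <<w, c0>> = 0 ->
  ip (sf_index S) (v *m P) (w *m P) = r ^+ 2 * <<v, w>>.
Proof. by case: mod => _ _ H _ _; exact: H. Qed.

Let Dc (c : chart R M m) := chart_map c @` (U `&` chart_dom c).
Let u q := Y q *m P.
(** xi - mu0 Y is orthogonal to c0, where P is a homothety of ratio r; the factor r^-1 makes the
    image a unit vector. *)
Let eta q := (r^-1 *: (xi q - mu0 *: Y q)) *m P.

Let oD c : open (Dc c). Proof. exact: chart_image_open. Qed.

Let sF c : atlas c -> smv (Dc c) (F c). Proof. exact: msmooth_smv. Qed.

Let Dq c q : U q -> chart_dom c q -> Dc c (chart_map c q).
Proof. by move=> Uq dq; exists q. Qed.

Let FF c z : Dc c z -> <<F c z, F c z>> = 0.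
Proof.
by move=> [q [Uq dq] <-]; rewrite /= chart_mapK //; have [[]] := lift Uq.
Qed.

Let Fc c z : Dc c z -> <<F c z, c0>> = 1.
Proof. by move=> [q [Uq dq] <-]; rewrite /= chart_mapK //; exact: Yc. Qed.

Let uG c z : atlas c -> Dc c z -> g c z \in unitmx.
Proof. by move=> ac [q [Uq dq] <-]; have [] := idx ac Uq dq. Qed.

Let Fc1 c i z : atlas c -> Dc c z -> <<dv i (F c) z, c0>> = 0.
Proof.
move=> ac Dz; rewrite -(ds_ipl Dz s.+1 c0 i (sF ac)).
by rewrite (ds_on (oD (c := c)) i Dz (Fc (c := c))) ds_cst.
Qed.

Let Fc2 c i j z : atlas c -> Dc c z -> <<dv i (dv j (F c)) z, c0>> = 0.
Proof.
move=> ac Dz; rewrite -(ds_ipl Dz s.+1 c0 i (smv_dv j (sF ac))).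
by rewrite (ds_on (oD (c := c)) i Dz (fun y Dy => Fc1 j ac Dy)) ds_cst.
Qed.

Let du c i z : atlas c -> Dc c z -> dv i (u \o chart_inv c) z = dv i (F c) z *m P.
Proof. by move=> ac Dz; apply: (dv_mulmx (oD (c := c)) Dz P i (sF ac)). Qed.

Let ddu c i j z : atlas c -> Dc c z ->
  dv i (dv j (u \o chart_inv c)) z = dv i (dv j (F c)) z *m P.
Proof.
move=> ac Dz; rewrite (dv_on (oD (c := c)) i Dz (fun y Dy => du j ac Dy)).
exact: (dv_mulmx (oD (c := c)) Dz P i (smv_dv j (sF ac))).
Qed.

Let gram_u c z : atlas c -> Dc c z -> sf_gram u c z = r ^+ 2 *: g c z.
Proof.
move=> ac Dz; apply/matrixP => i j; rewrite sf_gram_dv [RHS]mxE lift_gramE.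
by rewrite !du // ipP //; exact: Fc1.
Qed.

Let sfQ q : U q -> sf_hypersurface_in_Q u q = proj_class (Y q *m T).
Proof.
move=> Uq; rewrite /sf_hypersurface_in_Q.
have [_ _ _ H _] := mod; have [[YY _] _] := lift Uq.
by have [_ ->] := H (Y q) YY (Yc Uq); rewrite proj_class_scale.
Qed.

Let coneT q : U q -> @lightcone R m.+3 s (Y q *m T).
Proof.
move=> Uq; have [[YY _] _] := lift Uq; split; first by rewrite oT.
apply/eqP => YT0; have := oT (Y q) c0; rewrite YT0 ip0l Yc // => /eqP.
by rewrite eq_sym oner_eq0.
Qed.

Let liftT : local_lift s (sf_hypersurface_in_Q u) U (fun q => Y q *m T).
Proof.
split=> // [|q Uq]; last by rewrite sfQ; [split=> //; exact: coneT|].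
by apply: smv_msmooth => c ac; exact: (smv_mulmx (oD (c := c)) T (sF ac)).
Qed.

Let regular_u : sf_regular s U u t.
Proof.
split.
- move=> q Uq; have [_ _ _ H _] := mod; have [[YY _] _] := lift Uq.
  by have [] := H (Y q) YY (Yc Uq).
- by apply: smv_msmooth => c ac; exact: (smv_mulmx (oD (c := c)) P (sF ac)).
split; first split.
- by move=> q Uq; rewrite sfQ //; exists (Y q *m T) => //; exact: coneT.
- move=> q Uq; exists U, (fun q => Y q *m T); split=> // c q' ac Uq' dq'.
  have Dz := Dq Uq' dq'.
  split; last by rewrite (lift_gram_mul (oD (c := c)) (sF ac) oT Dz); exact: idx.
  have uGT z : Dc c z -> lift_gram s (fun y => F c y *m T) z \in unitmx.
    by move=> Dz'; rewrite (lift_gram_mul (oD (c := c)) (sF ac) oT Dz'); exact: uG.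
  apply: (immersive_lift (oD (c := c)) _ uGT _ Dz).
    exact: (smv_mulmx (oD (c := c)) T (sF ac)).
  by move=> z Dz'; rewrite oT FF.
- move=> q Uq; exists U, (fun q => Y q *m T); split=> // c q' ac Uq' dq'.
  have Dz := Dq Uq' dq'.
  rewrite (conf_metric_mul (oD (c := c)) (sF ac) (fun z => uG ac) oT Dz).
  by rewrite can //; exact: uG.
Qed.

Let smooth_gc c : atlas c -> msm (Dc c) (g c).
Proof. by move=> ac; exact: (smooth_g s (oD (c := c)) (sF ac)). Qed.

Let r20 : r ^+ 2 != 0. Proof. by rewrite sqrf_eq0. Qed.

Let csc_u : constant_scalar_curvature U u.
Proof.
exists ((r ^+ 2)^-1 * rho0) => c q ac Uq dq; rewrite -(rho ac Uq dq).
exact: (scalar_curvature_scaled (oD (c := c)) r20 (smooth_gc ac) (fun z => uG ac)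
  (fun z => gram_u ac) (Dq Uq dq)).
Qed.

Let vq q := r^-1 *: (xi q - mu0 *: Y q).

Let vc q : U q -> <<vq q, c0>> = 0.
Proof. by move=> Uq; rewrite ipZl ipBl ipZl xic // Yc // mulr1 subrr mulr0. Qed.

Let eta_eta q : U q -> ip (sf_index S) (eta q) (eta q) = e0.
Proof.
move=> Uq; have [[YY _] _] := lift Uq.
rewrite ipP ?vc // !(ipZl, ipZr, ipBl, ipBr) xixi // (ipC _ (Y q)) xiY // YY.
by field.
Qed.

Let cmc_u : constant_mean_curvature U u.
Proof.
exists eta; split.
  apply: sf_unit_normal_dv.
    apply: smv_msmooth => c ac; apply: (smv_mulmx (oD (c := c)) P).
    apply: (smvZ (oD (c := c)) (sms_cst _ _)); apply: (smvB (oD (c := c))).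
      exact: msmooth_smv.
    exact: (smvZ (oD (c := c)) (sms_cst _ _) (sF ac)).
  move=> c q ac Uq dq; have Dz := Dq Uq dq; have [[YY _] _] := lift Uq; split.
  - have [_ _ _ _ H] := mod; apply: H => //; [exact: Yc|exact: vc|].
    by rewrite ipZr ipBr ipZr (ipC _ (Y q)) xiY // YY mulr0 subrr mulr0.
  - by rewrite eta_eta.
  - move=> i; rewrite du // ipP ?vc //; last exact: Fc1.
    have := lift_tangent (oD (c := c)) (sF ac) (FF (c := c)) i Dz.
    rewrite /= chart_mapK // => FF1q.
    by rewrite ipZl ipBl ipZl xi1 // FF1q mulr0 subrr !mulr0.
(* The trace of the xi part vanishes. The part - mu0 Y contributes mu0 g_ij, as <d_i d_j Y, Y> = -
   g_ij, and its trace is m mu0. *)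
exists (e0 * mu0 / r) => c q ac Uq dq; have Dz := Dq Uq dq.
rewrite mean_curvature_dv eta_eta // gram_u // invmxZ; last first.
  by rewrite unitmxZ ?unitfE //; exact: uG.
have E i j : ((r ^+ 2)^-1 *: invmx (g c (chart_map c q))) i j *
    ip (sf_index S) (dv i (dv j (u \o chart_inv c)) (chart_map c q)) (eta q) =
    r^-1 * (invmx (g c (chart_map c q)) i j *
       <<dv i (dv j (F c)) (chart_map c q), xi q>>) +
    r^-1 * mu0 * (invmx (g c (chart_map c q)) i j * g c (chart_map c q) j i).
  have := lift_dv2 (oD (c := c)) (sF ac) (FF (c := c)) i j Dz.
  rewrite /= chart_mapK // => FF2q.
  rewrite ddu // ipP ?vc //; last exact: Fc2.
  rewrite [X in X * _ = _]mxE ipZr ipBr ipZr FF2q.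
  rewrite (g_sym s (F c) _ i j) /=; field.
  exact: r0.
under eq_bigr do under eq_bigr do rewrite E.
under eq_bigr do rewrite big_split /= -!mulr_sumr.
rewrite big_split /= -!mulr_sumr trh // mulr0 add0r.
have -> : \sum_i \sum_j invmx (g c (chart_map c q)) i j * g c (chart_map c q) j i = m%:R.
  under eq_bigr do rewrite (mul_invg_g (fun z => uG ac) Dz) eqxx.
  by rewrite sumr_const card_ord.
field.
by rewrite r0 pnatr_eq0 -lt0n m0.
Qed.

Lemma csc_cmc_of_model : equivalent_to_csc_cmc s t U x S.
Proof.
exists u; split; [exact: regular_u|exact: csc_u|exact: cmc_u|].
exists T => // q Uq; rewrite sfQ // proj_class_mulmx.
by have [_ ->] := lift Uq.
Qed.

End ModelHypersurface.

(** * Local constancy *)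

Section LocalConstancy.
Variables (R : realType) (m s t : nat) (M : manifold R m) (x : M -> set 'rV[R]_m.+3).
Variables (lambda mu : M -> R) (V : set M) (Y xi : M -> 'rV[R]_m.+3).
Hypothesis m1 : (1 < m)%N.
Hypothesis hreg : regular_hypersurface s x t [set: M].
Hypotheses (slam : msmooth setT lambda) (smu : msmooth setT mu).
Hypothesis hY : canonical_lift s x V Y.
Hypothesis sxi : msmooth V xi.
Hypothesis hpu : forall c q, atlas c -> V q -> chart_dom c q ->
  let F := Y \o chart_inv c in
  let X := xi \o chart_inv c in
  let z := chart_map c q in
  [/\ is_unit_normal s F X z,
      forall v, conf_Phi s F X z v = 0 &
      conf_A s F z = (lambda q)%:M + mu q *: conf_B s F X z].

Local Notation "<< a , b >>" := (ip s.+1 a b).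
Local Notation F c := (Y \o chart_inv c).
Local Notation Xi c := (xi \o chart_inv c).
Let Dc (c : chart R M m) := chart_map c @` (V `&` chart_dom c).

Let oV : open V. Proof. by case: hY => -[]. Qed.
Let oD c : open (Dc c). Proof. exact: chart_image_open. Qed.
Let liftY q : V q -> @lightcone R m.+3 s (Y q) /\ x q = proj_class (Y q).
Proof. by case: hY => -[_ _ H] _ Vq; exact: H. Qed.
Let sY : msmooth V Y. Proof. by case: hY => -[]. Qed.
Let sF c : atlas c -> smv (Dc c) (F c). Proof. exact: msmooth_smv. Qed.
Let sX c : atlas c -> smv (Dc c) (Xi c). Proof. exact: msmooth_smv. Qed.

Let smoothT (f : M -> R) c : msmooth setT f -> atlas c -> sms (Dc c) (f \o chart_inv c).
Proof. by move=> sf; apply: msmooth_sms; exact: (msmooth_sub (@subsetT _ V) sf). Qed.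

(** Regularity provides the index for some local lift; the canonical lift is a pointwise multiple of
    it, which rescales the metric by a positive factor. *)
Lemma canonical_index c q : atlas c -> V q -> chart_dom c q ->
  has_index (lift_gram s (F c) (chart_map c q)) t.
Proof.
move=> ac Vq dq; have [[_ hl] _] := hreg.
have [V' [y [V'q _ [oV' sy liy] Hy]]] := hl q I.
have [_ iy] := Hy c q ac V'q dq.
pose D := chart_map c @` ((V `&` V') `&` chart_dom c).
have oW : open (V `&` V') by exact: openI.
have sFD : smv D (F c).
  by apply: (msmooth_smv _ ac); apply: (msmooth_sub _ sY) => w [].
have sHD : smv D (y \o chart_inv c).
  by apply: (msmooth_smv _ ac); apply: (msmooth_sub _ sy) => w [].
have [a a0 ->] : exists2 a : R, a != 0 & lift_gram s (F c) (chart_map c q) =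
    a ^+ 2 *: lift_gram s (y \o chart_inv c) (chart_map c q).
  apply: (gram_conformal (chart_image_open (c := c) oW) sFD sHD).
  - by exists q.
  - by rewrite /= chart_mapK //; have [[]] := liy q V'q.
  - by move=> z [w [[_ V'w] dw] <-]; rewrite /= chart_mapK //; have [[]] := liy w V'w.
  move=> z [w [[Vw V'w] dw] <-]; rewrite /= chart_mapK //.
  by apply: proj_class_eq; have [_ <-] := liftY Vw; have [_ <-] := liy w V'w.
exact: has_index_scale.
Qed.

Let uG c z : atlas c -> Dc c z -> lift_gram s (F c) z \in unitmx.
Proof. by move=> ac [q [Vq dq] <-]; have [] := canonical_index ac Vq dq. Qed.

Let FF c z : Dc c z -> <<F c z, F c z>> = 0.
Proof. by move=> [q [Vq dq] <-]; rewrite /= chart_mapK //; have [[]] := liftY Vq. Qed.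

Let hn c z : atlas c -> Dc c z -> is_unit_normal s (F c) (Xi c) z.
Proof. by move=> ac [q [Vq dq] <-]; have [] := hpu ac Vq dq. Qed.

Let hPhi c z : atlas c -> Dc c z -> forall v, conf_Phi s (F c) (Xi c) z v = 0.
Proof. by move=> ac [q [Vq dq] <-]; have [] := hpu ac Vq dq. Qed.

Let hA c z : atlas c -> Dc c z -> conf_A s (F c) z =
  ((lambda \o chart_inv c) z)%:M + (mu \o chart_inv c) z *: conf_B s (F c) (Xi c) z.
Proof. by move=> ac [q [Vq dq] <-] /=; rewrite chart_mapK //; have [] := hpu ac Vq dq. Qed.

Let hcan c z : atlas c -> Dc c z -> conf_metric s (F c) z = lift_gram s (F c) z.
Proof. by move=> ac [q [Vq dq] <-]; case: hY => _ H; exact: H. Qed.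

Lemma gram_congruent (J : 'M[R]_m) (A B : 'I_m -> 'rV[R]_m.+3) :
  \matrix_(i, j) <<\sum_k J i k *: A k, \sum_k J j k *: B k>> =
  J *m \matrix_(i, j) <<A i, B j>> *m J^T.
Proof.
apply/matrixP => i j; rewrite [LHS]mxE ip_suml.
rewrite -mulmxA [RHS]mxE; apply: eq_bigr => k _.
rewrite ipZl ip_sumr [X in _ = _ * X]mxE; congr (_ * _); apply: eq_bigr => p _.
by rewrite ipZr mulrC !mxE.
Qed.

(* Involves first derivatives only, which makes chart changes easy. *)
Lemma hmx_first_order c z : atlas c -> Dc c z ->
  hmx s (F c) (Xi c) z = - \matrix_(i, j) <<dv i (Xi c) z, dv j (F c) z>>.
Proof.
move=> ac Dz; apply/matrixP => i j; rewrite [LHS]mxE [RHS]mxE [X in - X]mxE.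
by rewrite (dvX_F1 (oD (c := c)) (sF ac) (sX ac) (fun z => hn ac) i j Dz) opprK.
Qed.

(** [tau] is shown to be constant in one chart, whereas the scalar curvature has to be the same
    constant in every chart. *)
Lemma tau_chart c c' q : atlas c -> atlas c' -> V q -> chart_dom c q -> chart_dom c' q ->
  tau s (F c') (Xi c') (chart_map c' q) = tau s (F c) (Xi c) (chart_map c q).
Proof.
move=> ac ac' Vq dq dq'; set z := chart_map c q; set z' := chart_map c' q.
have Dz : Dc c z by exists q.
have Dz' : Dc c' z' by exists q.
pose phi := chart_map c \o chart_inv c'.
pose E := chart_map c' @` ((V `&` chart_dom c) `&` chart_dom c').
have oE : open E by apply: chart_image_open; apply: openI => //; exact: chart_dom_open.
have Ez' : E z' by exists q.
have sphi : smv E phi.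
  rewrite smv.unlock; apply: smooth_sub (atlas_compat ac' ac).
  by move=> _ [w [[Vw dw] dw'] <-]; exists w.
have phiz : phi z' = z by rewrite /phi /z' /= chart_mapK.
have EE (f : M -> 'rV[R]_m.+3) y : E y -> (f \o chart_inv c') y = ((f \o chart_inv c) \o phi) y.
  by move=> [w [[Vw dw] dw'] <-]; rewrite /phi /= chart_mapK // chart_mapK.
pose J : 'M[R]_m := \matrix_(i, k) dv i phi z' 0 k.
have dE (f : M -> 'rV[R]_m.+3) i : smv (Dc c) (f \o chart_inv c) ->
    dv i (f \o chart_inv c') z' = \sum_k J i k *: dv k (f \o chart_inv c) z.
  move=> sf; rewrite (dv_on oE i Ez' (EE f)).
  have Dp : Dc c (phi z') by rewrite phiz.
  rewrite (dv_comp sphi Ez' sf Dp) phiz.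
  by apply: eq_bigr => k _; rewrite [J i k]mxE.
apply: (trace_congruent (J := J)); [exact: uG|exact: uG| |].
  have -> : lift_gram s (F c') z' = \matrix_(i, j) <<dv i (F c') z', dv j (F c') z'>>.
    by apply/matrixP => i j; rewrite lift_gramE [RHS]mxE.
  have -> : lift_gram s (F c) z = \matrix_(i, j) <<dv i (F c) z, dv j (F c) z>>.
    by apply/matrixP => i j; rewrite lift_gramE [RHS]mxE.
  rewrite -gram_congruent; apply/matrixP => i j; rewrite [LHS]mxE [RHS]mxE.
  by rewrite (dE Y i (sF ac)) (dE Y j (sF ac)).
rewrite !hmx_first_order // mulmxN mulNmx -gram_congruent; congr (- _).
apply/matrixP => i j; rewrite [LHS]mxE [RHS]mxE.
by rewrite (dE Y j (sF ac)) (dE xi i (sX ac)).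
Qed.

Lemma locally_csc_cmc p : V p -> exists U : set M,
  [/\ open U, U p &
      equivalent_to_csc_cmc s t U x (flat_form R m s) \/
      equivalent_to_csc_cmc s t U x (sphere_form R m s) \/
      equivalent_to_csc_cmc s t U x (hyperbolic_form R m s)].
Proof.
move=> Vp; have [c ac dp] := atlas_cover p.
set z0 := chart_map c p.
have Dz0 : Dc c z0 by exists p.
have /nbhs_ballP[r /= r0 hr] : nbhs z0 (Dc c) by apply: open_nbhs_nbhs.
(* U is made to correspond to a ball in the chart, where vanishing first derivatives force
   constancy. *)
pose B := ball z0 r.
pose U := V `&` (chart_dom c `&` [set q | B (chart_map c q)]).
have Up : U p by split=> //; split=> //; exact: ballxx.
have oB : open B by exact: ball_open.
have oU : open U.
  rewrite openE => q [Vq [dq Bq]]; rewrite /interior.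
  have n1 : nbhs q V by apply: open_nbhs_nbhs.
  have n2 : nbhs q (chart_dom c).
    by apply: open_nbhs_nbhs; split=> //; exact: chart_dom_open.
  have n3 : \forall w \near q, B (chart_map c w).
    by apply: (chart_map_cont dq); apply: open_nbhs_nbhs.
  by apply: filterS3 n1 n2 n3 => w.
have UV : U `<=` V by move=> q [].
have BD : B `<=` Dc c by [].
have Uz q : U q -> B (chart_map c q) by move=> [_ []].
have Ud q : U q -> chart_dom c q by move=> [_ []].
have const (f : M -> R) : sms (Dc c) (f \o chart_inv c) ->
    (forall z i, Dc c z -> ds i (f \o chart_inv c) z = 0) ->
    forall q, U q -> f q = f p.
  move=> sf f0 q Uq; transitivity ((f \o chart_inv c) (chart_map c q)).
    by rewrite /= chart_mapK //; exact: Ud.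
  transitivity ((f \o chart_inv c) z0); last by rewrite /= /z0 chart_mapK.
  apply: (@ds0_const_ball _ _ _ z0 r); last exact: Uz.
    exact: (sms_sub BD).
  by move=> y i /BD; exact: f0.
have sl := smoothT slam ac; have su := smoothT smu ac.
have uGc z := @uG c z ac.
have hnc z := @hn c z ac.
have hPc z := @hPhi c z ac.
have hAc z := @hA c z ac.
have hcc z := @hcan c z ac.
have lamE := const lambda sl (fun z i Dz => lambda_constant (oD (c := c)) (sF ac) (sX ac) sl su uGc erefl
   (FF (c := c)) m1 hnc hPc hAc hcc i Dz).
have muE := const mu su (fun z i Dz => mu_constant (oD (c := c)) (sF ac) (sX ac) sl su uGc erefl
   (FF (c := c)) m1 hnc hPc hAc hcc i Dz).
have xiE := const (fun q => <<xi q, xi q>>) (smooth_e s (oD (c := c)) (sX ac))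
  (fun z i Dz => ds_e (oD (c := c)) (sX ac) hnc i Dz).
(* [tau] is a function on the chart; [ta] transports it to M, where [const] applies. *)
pose ta q := tau s (F c) (Xi c) (chart_map c q).
have taK z : Dc c z -> tau s (F c) (Xi c) z = (ta \o chart_inv c) z.
  by move=> [w [Vw dw] <-]; rewrite /ta /= chart_mapK.
have taE := const ta (sms_eq (oD (c := c)) taK (smooth_tau (oD (c := c)) (sF ac) (sX ac) uGc))
  (fun z i Dz => etrans (esym (ds_on (oD (c := c)) i Dz taK))
    (ds_tau (oD (c := c)) (sF ac) (sX ac) uGc erefl (FF (c := c)) m1 hnc hAc hcc i Dz)).
pose e0 := <<xi p, xi p>>; pose mu0 := mu p; pose lam0 := lambda p.
have e01 : e0 = 1 \/ e0 = -1.
  by have [] := is_unit_normal_dv (hnc _ Dz0); rewrite /= chart_mapK.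
pose N := conf_N s (F c).
have sN : smv (Dc c) N by exact: (smooth_N (oD (c := c)) (sF ac) uGc).
(* The coefficients are frozen at p, so by [dvN_formula] the derivative of C vanishes wherever e, mu
   and lambda keep their values at p. *)
pose C z := N z + (e0 * mu0) *: Xi c z - lam0 *: F c z.
have sX' : smv (Dc c) (fun z => (e0 * mu0) *: Xi c z).
  exact: (smvZ (oD (c := c)) (sms_cst _ _) (sX ac)).
have sF' : smv (Dc c) (fun z => lam0 *: F c z).
  exact: (smvZ (oD (c := c)) (sms_cst _ _) (sF ac)).
have sNX := smvD (oD (c := c)) sN sX'.
have sC : smv (Dc c) C by exact: (smvB (oD (c := c)) sNX sF').
have dC z i : B z -> dv i C z = 0.
  move=> Bz; have Dz := BD _ Bz.
  have Uw : U (chart_inv c z).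
    have [w [Vw dw] wz] := Dz; rewrite -wz chart_mapK //.
    by split=> //; split=> //=; rewrite wz.
  rewrite (dvB Dz i sNX sF') (dvD Dz i sN sX').
  rewrite (dvZ (oD (c := c)) Dz i (sms_cst _ _) (sX ac)).
  rewrite (dvZ (oD (c := c)) Dz i (sms_cst _ _) (sF ac)) !ds_cst !scale0r !add0r.
  rewrite (dvN_formula (oD (c := c)) (sF ac) (sX ac) uGc erefl (FF (c := c)) m1 hnc hPc hAc i Dz).
  by rewrite /= lamE // muE // xiE // subrK subrr.
have CE z : B z -> C z = C z0.
  move=> Bz; apply/rowP => k.
  apply: (@ds0_const_ball _ _ (fun y => C y 0 k) z0 r z) => //.
    by apply: (sms_sub BD); exact: (sms_coord (oD (c := c))).
  move=> y i By; rewrite (dv_coord (BD _ By) i k sC) dC //.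
  by rewrite mxE.
pose v0 := C z0.
have NFz z : Dc c z -> <<N z, F c z>> = 1.
  by move=> Dz; exact: (confN_lift (oD (c := c)) (sF ac) uGc (FF (c := c)) (ltnW m1) Dz).
have Yv q : U q -> <<Y q, v0>> = 1.
  move=> Uq; have Bq := Uz _ Uq; have Dq := BD _ Bq; have dq := Ud _ Uq.
  have := NFz _ Dq; have [_ normal_lift _ _] := is_unit_normal_dv (hnc _ Dq).
  have := FF Dq.
  rewrite /v0 -(CE _ Bq) /C ipBr ipDr !ipZr.
  move: normal_lift; rewrite /= chart_mapK // => normal_lift -> confN_tangent.
  by rewrite ipC confN_tangent (ipC _ (Y q) (xi q)) normal_lift !mulr0 addr0 subr0.
have xiv q : U q -> <<xi q, v0>> = mu0.
  move=> Uq; have Bq := Uz _ Uq; have Dq := BD _ Bq; have dq := Ud _ Uq.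
  have [_ normal_lift normal_confN _] := is_unit_normal_dv (hnc _ Dq).
  have xx := xiE _ Uq.
  rewrite /v0 -(CE _ Bq) /C ipBr ipDr !ipZr.
  move: normal_lift normal_confN; rewrite /= chart_mapK // -/N => normal_lift normal_confN.
  rewrite normal_confN normal_lift xx -/e0 mulr0 subr0 add0r.
  by case: e01 => ->; ring.
have v00 : v0 != 0.
  by apply: contra_eq_neq (Yv _ Up) => ->; rewrite ip0r eq_sym oner_neq0.
have sm : (s < m.+2)%N.
  have [[YY Y0] _] := liftY Vp.
  by have := lightcone_space YY Y0; rewrite ltnS.
(* The value given by [scalar_formula], with l, e and [tau] replaced by their constant values. *)
pose rho0 := 2 * (m%:R - 1) * m%:R * lam0 - e0 * ta p.
have rhoE c' q : atlas c' -> U q -> chart_dom c' q ->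
    scalar_curvature (lift_gram s (F c')) (chart_map c' q) = rho0.
  move=> ac' Uq dq'; have Vq := UV _ Uq.
  have Dq : Dc c' (chart_map c' q) by exists q.
  rewrite (scalar_formula (oD (c := c')) (sF ac') (sX ac') (fun z => uG ac') erefl
    (FF (c := c')) m1 (fun z => hn ac') (fun z => hA ac') Dq).
  rewrite -/(tau s (F c') (Xi c') _) (tau_chart ac ac' Vq (Ud _ Uq) dq') -/(ta q).
  by rewrite /= chart_mapK // lamE // xiE // taE.
have [r1 [T hT]] := exists_model sm v00.
exists U; split=> //.
have fin S P (hM : @model R m s S v0 r1 T P) : equivalent_to_csc_cmc s t U x S.
  apply: (csc_cmc_of_model (ltnW m1) oU (msmooth_sub UV sY) (msmooth_sub UV sxi)
    (fun q Uq => liftY (UV _ Uq)) e01 Yv xiv xiE _ _ _ _ _ rhoE hM).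
  - move=> q Uq; have Dq := BD _ (Uz _ Uq).
    have [_ normal_lift _ _] := is_unit_normal_dv (hnc _ Dq).
    by move: normal_lift; rewrite /= chart_mapK //; exact: Ud.
  - move=> c' q i ac' Uq dq'.
    have Dq : Dc c' (chart_map c' q) by exists q => //; split=> //; exact: UV.
    have [_ _ _ /(_ i)] := is_unit_normal_dv (hn ac' Dq).
    by rewrite /= chart_mapK.
  - by move=> c' q ac' Uq dq'; apply: canonical_index => //; exact: UV.
  - by move=> c' q ac' Uq dq'; apply: hcan => //; exists q => //; split=> //; exact: UV.
  - move=> c' q ac' Uq dq'.
    have Dq : Dc c' (chart_map c' q) by exists q => //; split=> //; exact: UV.
    have := trace_second_fundamental (oD (c := c')) (sF ac') erefl m1 (fun z => hn ac') Dq.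
    move=> trB0; apply: etrans (trace_pair s (F c') (chart_map c' q)
      (fun i j => <<dv i (dv j (F c')) (chart_map c' q), xi q>>)) _.
    rewrite -[RHS]trB0; congr (mxtrace (_ *m _)); apply/matrixP => i j.
    rewrite [LHS]mxE [RHS]mxE /= chart_mapK //.
    by rewrite (dv_schwarz (oD (c := c')) Dq j i (sF ac')).
case: hT => [[P hP]|[[P hP]|[P hP]]]; [left|right; left|right; right]; exact: fin hP.
Qed.

End LocalConstancy.

Theorem theorem4p1 (R : realType) (m s t : nat)
    (hm : (2 <= m)%N) (hs : (1 <= s)%N) (hts : (t <= s)%N)
    (M : manifold R m) (x : M -> set 'rV[R]_m.+3)
    (hreg : regular_hypersurface s x t [set: M])
    (hpu : blaschke_para_umbilical s x) :
  forall p : M, exists U : set M,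
    [/\ open U, U p &
        equivalent_to_csc_cmc s t U x (flat_form R m s) \/
        equivalent_to_csc_cmc s t U x (sphere_form R m s) \/
        equivalent_to_csc_cmc s t U x (hyperbolic_form R m s)].
Proof.
move=> p; have [lambda [mu [slam smu H]]] := hpu.
have [V [Y [xi [Vp hY sxi hV]]]] := H p.
exact: (locally_csc_cmc hm hreg slam smu hY sxi hV Vp).
Qed.
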